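(* Fix $\varepsilon>0$. Let $K\subseteq[N]$, $k=|K|$, let $A\in\mathbb{R}^{m\times N}$ be a Gaussian matrix and $b=A\mathbb{1}_K$. If $$m\ge \Delta_{\mathrm{bin}}(k)+\sqrt{8\log(4/\varepsilon)N},$$ where $$\Delta_{\mathrm{bin}}(k)=\inf_{\tau\ge 0}\Big[k\int_{-\infty}^{\tau}(u-\tau)^2\phi(u)\,du+(N-k)\int_{\tau}^{\infty}(u-\tau)^2\phi(u)\,du\Big],\qquad \phi(u)=(2\pi)^{-1/2}e^{-u^2/2},$$ then with probability larger than $1-\varepsilon$, $\mathbb{1}_K$ is the unique solution of $(P_{\mathrm{bin}})$.
   Context: $[N]=\{1,\dots,N\}$; $\mathbb{1}_K$ is the vector with entries $1$ on $K$ and $0$ elsewhere. A Gaussian matrix is $A=m^{-1/2}[a_{ij}]$ with $a_{ij}$ i.i.d. standard normal. $(P_{\mathrm{bin}})$ is the program $\min\|x\|_1$ subject to $Ax=b$ and $x\in[0,1]^N$; ''unique solution'' means unique minimizer. $\log$ is the natural logarithm. *)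

(* Defs.v *)
From HB Require Import structures.
From mathcomp Require Import all_boot all_order all_algebra.
From mathcomp Require Import all_classical all_reals all_analysis.
Set Implicit Arguments. Unset Strict Implicit. Unset Printing Implicit Defensive.
Import Order.TTheory GRing.Theory Num.Theory.
Import numFieldNormedType.Exports.
Local Open Scope classical_set_scope.
Local Open Scope ring_scope.

Definition phi {R : realType} (u : R) : R :=
  (Num.sqrt (pi *+ 2))^-1 * expR (- (u ^+ 2) / 2).

Definition Delta_bin_fun {R : realType} (N k : nat) (tau : R) : \bar R :=
  ((k%:R)%:E * (\int[lebesgue_measure]_(u in `]-oo, tau]) ((u - tau) ^+ 2 * phi u)%:E)
   + ((N - k)%:R)%:E * (\int[lebesgue_measure]_(u in `[tau, +oo[) ((u - tau) ^+ 2 * phi u)%:E))%E.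

Definition Delta_bin {R : realType} (N k : nat) : \bar R :=
  ereal_inf [set Delta_bin_fun N k tau | tau in [set tau : R | 0 <= tau]].

Definition ind_vec {R : realType} (N : nat) (K : {set 'I_N}) : 'cV[R]_N :=
  \col_j (j \in K)%:R.

Definition l1norm {R : realType} (N : nat) (x : 'cV[R]_N) : R :=
  \sum_j `|x j 0|.

Definition Pbin_feasible {R : realType} (m N : nat) (A : 'M[R]_(m, N))
  (b : 'cV[R]_m) (x : 'cV[R]_N) : Prop :=
  A *m x = b /\ (forall j, 0 <= x j 0 <= 1).

Definition Pbin_unique_solution {R : realType} (m N : nat) (A : 'M[R]_(m, N))
  (b : 'cV[R]_m) (x0 : 'cV[R]_N) : Prop :=
  Pbin_feasible A b x0 /\
  (forall x, Pbin_feasible A b x -> x <> x0 -> l1norm x0 < l1norm x).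

Definition gauss_mx {R : realType} (m N : nat) {T : Type}
  (a : 'I_m -> 'I_N -> T -> R) (omega : T) : 'M[R]_(m, N) :=
  \matrix_(i, j) ((Num.sqrt (m%:R))^-1 * a i j omega).

(* mutual independence of the finite family (a_ij): product rule for every
   family of Borel sets (taking B = setT covers subfamilies). *)
Definition mutually_independent {R : realType} (d : measure_display)
  (T : measurableType d) (P : probability T R) (m N : nat)
  (a : 'I_m -> 'I_N -> {RV P >-> R}) : Prop :=
  forall B : 'I_m -> 'I_N -> set R, (forall i j, measurable (B i j)) ->
    P (\bigcap_(ij in [set: 'I_m * 'I_N]) (a ij.1 ij.2 @^-1` B ij.1 ij.2))
    = (\prod_(i < m) \prod_(j < N) fine (P (a i j @^-1` B i j)))%:E.

Definition std_normal_rv {R : realType} (d : measure_display)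
  (T : measurableType d) (P : probability T R) (X : {RV P >-> R}) : Prop :=
  forall B : set R, measurable B -> P (X @^-1` B) = normal_prob 0 1 B.

(* Main.v *)
Require Import Defs.
From HB Require Import structures.
From mathcomp Require Import all_boot all_order all_algebra.
From mathcomp Require Import all_classical all_reals all_analysis.
From mathcomp Require Import measurable_realfun ring lra.
Set Implicit Arguments. Unset Strict Implicit. Unset Printing Implicit Defensive.
Import Order.TTheory GRing.Theory Num.Theory.
Import numFieldNormedType.Exports.
Local Open Scope classical_set_scope.
Local Open Scope ring_scope.

(** Failure of uniqueness means that the kernel of A meets the unit sphere of the cone C of
    vectors z with z <= 0 on K, z >= 0 off K and sum z <= 0.  Gordon's comparison of
    <w, A u> + g0 with <g, w> - <h, u>, conditioned on g0 <= - b with b = sqrt (2 ln (4 / eps)),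
    bounds the probability of this by P(|g| < d(h) - b) / P(g0 <= - b) up to small errors, where
    d(h)^2 is the sum of (tau - h_j)_+^2 over K and of (h_j - tau)_+^2 off K: then <h, u> <= d(h)
    for unit u in C, and the infimum of E d(h)^2 over tau is Delta_bin.  The comparison is proved by
    Lindeberg replacement, exchanging small Gaussian increments one at a time.  The
    exponential moment of d is controlled by one-dimensional integrals, the lower tail of |g| by
    Chernoff, and P(g0 <= - b) by Mills' ratio.  When m <= N the hypothesis gives
    sqrt m - sqrt Delta_bin >= b, which suffices; when m > N the kernel of A is trivial with
    probability arbitrarily close to 1, by a small-ball union bound over a net. *)

(** * Densities and affine images of normal laws *)

(** The scalar g0 equalizes variances: the covariance of the matrix process minus that of the
    decoupled one becomes (1 - <w, w'>) (1 - <u, u'>), which is nonnegative and vanishes for u = u'.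
    This is the sign pattern that the comparison requires. Conditioning on g0 <= - b, and not merely
    on g0 <= 0, is what reaches the stated constant. The exponential moments cost v^2 / 4 for |g|
    and v^2 / 2 for d(h), so the failure bound is exp (3/4 v^2 - v gap). With gap = b its minimum
    over v is exp (- b^2 / 3), too large against eps = 4 exp (- b^2 / 2) when b is large. The
    conditioning raises the gap to 2 b at the price 1 / P(g0 <= - b), which is exp (b^2 / 2) up to a
    factor of order b; the choice v = b then leaves exp (- 3/4 b^2) times that factor, and this is
    below eps with room to spare. The comparison concerns finite index sets, so the cone and the
    unit sphere of the w are replaced by finite nets. The resulting losses are paid from that spare
    room. *)

Section density.
Local Open Scope ereal_scope.
Context d (T : measurableType d) (R : realType).
Variables (mu nu : {measure set T -> \bar R}) (p : T -> R).
Hypothesis (mp : measurable_fun setT p) (p0 : forall x, (0 <= p x)%R).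
Hypothesis nuE : forall A, measurable A -> nu A = \int[mu]_(x in A) (p x)%:E.

Import HBNNSimple.

Let density_nnsfun (f : {nnsfun T >-> R}) :
  \int[nu]_x (f x)%:E = \int[mu]_x ((f x)%:E * (p x)%:E).
Proof.
under [LHS]eq_integral do rewrite fimfunE -fsumEFin//.
rewrite [LHS]ge0_integral_fsum//; last 2 first.
  - by move=> r; exact/measurable_EFinP/measurableT_comp.
  - by move=> n x _; rewrite EFinM nnfun_muleindic_ge0.
under [RHS]eq_integral.
  move=> x xD; rewrite fimfunE -fsumEFin// ge0_mule_fsuml; last first.
    by move=> r; rewrite EFinM nnfun_muleindic_ge0.
  over.
rewrite [RHS]ge0_integral_fsum//; last 2 first.
  - move=> r; apply: emeasurable_funM => //; last exact/measurable_EFinP.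
    by apply/measurable_EFinP; do 2 apply/measurableT_comp => //.
  - move=> n x _; apply: mule_ge0; last by rewrite lee_fin.
    by rewrite EFinM nnfun_muleindic_ge0.
apply: eq_fsbigr => r _; rewrite integralZl_indic_nnsfun//= integral_indic//.
rewrite setIT nuE//.
have [r0|r0] := leP 0%R r; last first.
  rewrite preimage_nnfun0// integral_set0 mule0; apply/esym.
  rewrite integral0_eq// => x _.
  by rewrite indicE in_set0 mulr0 mul0e.
rewrite -ge0_integralZl//; last 2 first.
  exact/measurable_EFinP/measurable_funTS.
  by move=> x _; rewrite lee_fin.
rewrite integral_mkcond; apply: eq_integral => x _.
rewrite patchE indicE EFinM; case: ifPn => xr; rewrite ?mule1// mule0 mul0e//.
Qed.

Lemma ge0_integral_density (f : T -> \bar R) :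
  measurable_fun setT f -> (forall x, 0 <= f x) ->
  \int[nu]_x f x = \int[mu]_x (f x * (p x)%:E).
Proof.
move=> mf f0.
pose f_ := nnsfun_approx measurableT mf.
transitivity (lim (\int[nu]_x (f_ n x)%:E @[n --> \oo])).
  rewrite -monotone_convergence//=.
  - apply: eq_integral => ? /[!inE] xD; apply/esym/cvg_lim => //=.
    exact: cvg_nnsfun_approx.
  - by move=> n; exact/measurable_EFinP/measurable_funTS.
  - by move=> n ? _; rewrite lee_fin.
  - by move=> ? _ ? ? mn; rewrite lee_fin; exact/lefP/nd_nnsfun_approx.
transitivity (lim (\int[mu]_x ((f_ n x)%:E * (p x)%:E) @[n --> \oo])).
  by apply: congr_lim; apply/funext => n /=; exact: density_nnsfun.
rewrite -monotone_convergence//=.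
- apply: eq_integral => x _; apply/cvg_lim => //.
  by apply: cvgeZr => //; exact: cvg_nnsfun_approx.
- move=> n; apply: emeasurable_funM => //; last exact/measurable_EFinP.
  exact/measurable_EFinP/measurable_funTS.
- by move=> n x _; rewrite mule_ge0// lee_fin//.
- move=> x _ m n mn; apply: lee_wpmul2r => //; first by rewrite lee_fin.
  by rewrite lee_fin; exact/lefP/nd_nnsfun_approx.
Qed.

End density.

Section affine.
Context {R : realType}.
Local Notation mu := (@lebesgue_measure R).

(** By uniqueness of Lebesgue measure it suffices to compare both sides on half-open intervals. *)
Lemma lebesgue_measure_affine (m s : R) (A : set R) : 0 < s -> measurable A ->
  mu A = (s%:E * mu ((fun x => m + s * x)%R @^-1` A))%E.
Proof.
move=> s0 mA.
pose F (x : measurableTypeR R) : measurableTypeR R := m + s * x.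
have mF : measurable_fun setT F.
  by apply: measurable_funD => //; apply: measurable_funM.
pose pF : {measure set (measurableTypeR R) -> \bar R} :=
  measure_function_pushforward__canonical__measure_function_Measure mu mF.
have := @lebesgue_measure_unique R (mscale (NngNum (ltW s0)) pF).
move=> /(_ _ A mA); rewrite /mscale/= /pushforward/=; apply => _ [[a b] _ <-] /=.
rewrite /mscale/= /pushforward/= [X in (_ * lebesgue_measure X)%E](_ : _ = `](a - m) / s, (b - m) / s]%classic); last first.
  apply/seteqP; split => x /=; rewrite !in_itv/= ltr_pdivrMr// ler_pdivlMr//;
    by rewrite ltrBlDl lerBrDl (mulrC x).
rewrite !lebesgue_measure_itv/= !lte_fin ltr_pM2r ?invr_gt0// ltrD2r.
case: ifPn => _; last by rewrite mule0.
by rewrite -!EFinD -EFinM; congr (_%:E); field; rewrite gt_eqF.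
Qed.

Lemma ge0_integral_affine (m s : R) (f : R -> \bar R) : 0 < s ->
  measurable_fun setT f -> (forall x, 0 <= f x)%E ->
  (\int[mu]_x f x = s%:E * \int[mu]_x f (m + s * x)%R)%E.
Proof.
move=> s0 mf f0.
pose F (x : measurableTypeR R) : measurableTypeR R := m + s * x.
have mF : measurable_fun setT F.
  by apply: measurable_funD => //; apply: measurable_funM.
pose pF : {measure set (measurableTypeR R) -> \bar R} :=
  measure_function_pushforward__canonical__measure_function_Measure mu mF.
transitivity (\int[mscale (NngNum (ltW s0)) pF]_x f x)%E.
  apply: eq_measure_integral => A mA _; rewrite [LHS](lebesgue_measure_affine m s0)//.
rewrite ge0_integral_mscale//=; congr (_ * _)%E.
by rewrite ge0_integral_pushforward.
Qed.

End affine.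

Section normal.
Context {R : realType}.
Local Notation mu := (@lebesgue_measure R).

Lemma phi_normal_pdf (x : R) : normal_pdf 0 1 x = phi x.
Proof.
rewrite normal_pdfE ?oner_eq0// /normal_peak /normal_fun /phi.
by rewrite expr1n mul1r subr0 mulr2n.
Qed.

Lemma normal_pdf_phi (m s x : R) : 0 < s ->
  normal_pdf m s x = s^-1 * phi ((x - m) / s).
Proof.
move=> s0; rewrite normal_pdfE ?gt_eqF// /normal_peak /normal_fun /phi.
rewrite -mulrnAr sqrtrM ?sqr_ge0// sqrtr_sqr gtr0_norm// invfM mulrA.
congr (_ * expR _); field; by rewrite gt_eqF.
Qed.

Lemma phi_gt0 (x : R) : 0 < phi x.
Proof. by rewrite mulr_gt0 ?expR_gt0// invr_gt0 sqrtr_gt0 pmulrn_rgt0// pi_gt0. Qed.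

Lemma phi_ge0 (x : R) : 0 <= phi x. Proof. exact/ltW/phi_gt0. Qed.

Lemma measurable_phi : measurable_fun setT (@phi R).
Proof.
rewrite (_ : phi = normal_pdf 0 1); first exact: measurable_normal_pdf.
by apply/funext => x; rewrite phi_normal_pdf.
Qed.

Lemma ge0_integral_normal_prob (m s : R) (f : R -> \bar R) :
  measurable_fun setT f -> (forall x, 0 <= f x)%E ->
  (\int[normal_prob m s]_x f x = \int[mu]_x (f x * (normal_pdf m s x)%:E))%E.
Proof.
move=> mf f0; apply: (ge0_integral_density (mu := mu)) => //.
- exact: measurable_normal_pdf.
- by move=> x; exact: normal_pdf_ge0.
Qed.

Lemma ge0_integral_stdnormal (f : R -> \bar R) :
  measurable_fun setT f -> (forall x, 0 <= f x)%E ->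
  (\int[normal_prob 0 1]_x f x = \int[mu]_x (f x * (phi x)%:E))%E.
Proof.
by move=> mf f0; rewrite ge0_integral_normal_prob//; under eq_integral do rewrite phi_normal_pdf.
Qed.

Lemma measurable_affine (m s : R) : measurable_fun setT (fun x : R => m + s * x).
Proof. by apply: measurable_funD => //; exact: measurable_funM. Qed.

Lemma ge0_integral_normal_affine (m s : R) (f : R -> \bar R) : 0 < s ->
  measurable_fun setT f -> (forall x, 0 <= f x)%E ->
  (\int[normal_prob 0 1]_x f (m + s * x)%R = \int[normal_prob m s]_x f x)%E.
Proof.
move=> s0 mf f0.
have mfa : measurable_fun setT (fun x => f (m + s * x)).
  exact: (measurableT_comp mf (measurable_affine m s)).
have mpa : measurable_fun setT (fun x => normal_pdf m s (m + s * x)).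
  exact: (measurableT_comp (measurable_normal_pdf m s) (measurable_affine m s)).
rewrite ge0_integral_stdnormal//.
rewrite ge0_integral_normal_prob// [RHS](ge0_integral_affine m s0); last 2 first.
- by apply: emeasurable_funM => //; apply/measurable_EFinP; exact: measurable_normal_pdf.
- by move=> x; rewrite mule_ge0// lee_fin normal_pdf_ge0.
rewrite -ge0_integralZl//; last 3 first.
- by apply: emeasurable_funM => //; exact/measurable_EFinP.
- by move=> x _; rewrite mule_ge0// lee_fin normal_pdf_ge0.
- exact: ltW.
apply: eq_integral => x _; rewrite muleCA; congr (_ * _)%E.
rewrite normal_pdf_phi// -EFinM; congr (_%:E).
rewrite mulrA divff ?gt_eqF// mul1r; congr phi.
by field; rewrite gt_eqF.
Qed.

(** Both sides are the joint density of two standard normals with correlation [c], which is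
    symmetric in its arguments. This symmetry stands in for a two-dimensional change of
    variables. *)
Lemma phi_rotate (c s x u : R) : 0 < s -> c ^+ 2 + s ^+ 2 = 1 ->
  phi x * normal_pdf (c * x) s u = phi u * normal_pdf (c * u) s x.
Proof.
move=> s0 cs; rewrite !normal_pdf_phi//.
suff H : phi x * phi ((u - c * x) / s) = phi u * phi ((x - c * u) / s).
  by rewrite mulrCA H mulrCA.
rewrite /phi; set p := (Num.sqrt _)^-1.
have E a b : p * expR a * (p * expR b) = p * p * expR (a + b).
  by rewrite expRD; ring.
rewrite !E; congr (_ * expR _).
rewrite !expr_div_n (_ : s ^+ 2 = 1 - c ^+ 2); last by rewrite -cs; ring.
field; apply/eqP => h; have : s ^+ 2 = 0 by rewrite -cs in h; nra.
by apply/eqP; rewrite expf_neq0// gt_eqF.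
Qed.

(** Substitute u = c x + s y in the inner integral and exchange the integrals; by [phi_rotate] the
    integral over x is then that of a normal density, hence 1. *)
Lemma normal_rotate (c s : R) (f : R -> \bar R) : 0 < s -> c ^+ 2 + s ^+ 2 = 1 ->
  measurable_fun setT f -> (forall x, 0 <= f x)%E ->
  (\int[normal_prob 0 1]_x \int[normal_prob 0 1]_y f (c * x + s * y)%R =
   \int[normal_prob 0 1]_x f x)%E.
Proof.
move=> s0 cs mf f0.
have mpdf : measurable_fun setT (fun z : R * R => normal_pdf (c * z.1) s z.2).
  rewrite (_ : (fun _ => _) = (fun z : R * R => s^-1 * phi (s^-1 * z.2 - s^-1 * c * z.1))); last first.
    apply/funext => z; rewrite normal_pdf_phi//; congr (_ * phi _).
    by field; rewrite gt_eqF.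
  apply: measurable_funM => //; apply: measurableT_comp; first exact: measurable_phi.
  by apply: measurable_funB; apply: measurable_funM.
transitivity (\int[mu]_x \int[mu]_u (f u * (normal_pdf (c * x) s u)%:E * (phi x)%:E))%E.
  under eq_integral do rewrite ge0_integral_normal_affine// ge0_integral_normal_prob//.
  rewrite ge0_integral_stdnormal//; last 2 first.
  - apply: (@measurable_fun_fubini_tonelli_F _ _ _ _ _ mu (fun z : R * R => f z.2 * (normal_pdf (c * z.1) s z.2)%:E)%E).
      apply: emeasurable_funM; last exact/measurable_EFinP.
      exact: measurableT_comp.
    by move=> z; rewrite mule_ge0// lee_fin normal_pdf_ge0.
  - by move=> x; apply: integral_ge0 => u _; rewrite mule_ge0// lee_fin normal_pdf_ge0.
  apply: eq_integral => x _; rewrite ge0_integralZr//.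
  - apply: emeasurable_funM => //; by apply/measurable_EFinP; exact: measurable_normal_pdf.
  - by move=> u _; rewrite mule_ge0// lee_fin normal_pdf_ge0.
  - by rewrite lee_fin phi_ge0.
rewrite (@fubini_tonelli _ _ _ _ _ mu mu
   (fun z : R * R => f z.2 * (normal_pdf (c * z.1) s z.2)%:E * (phi z.1)%:E)%E); last 2 first.
  apply: emeasurable_funM; last first.
    apply/measurable_EFinP; apply: measurableT_comp => //; exact: measurable_phi.
  apply: emeasurable_funM; last exact/measurable_EFinP.
  exact: measurableT_comp.
  by move=> z; rewrite !mule_ge0// lee_fin ?normal_pdf_ge0 ?phi_ge0.
rewrite [RHS]ge0_integral_stdnormal//; apply: eq_integral => u _ /=.
transitivity (\int[mu]_x ((f u * (phi u)%:E) * (normal_pdf (c * u) s x)%:E))%E.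
  apply: eq_integral => x _; rewrite -!muleA; congr (_ * _)%E.
  by rewrite -!EFinM mulrC phi_rotate.
rewrite ge0_integralZl//; last 3 first.
- by apply/measurable_EFinP; exact: measurable_normal_pdf.
- by move=> x _; rewrite lee_fin normal_pdf_ge0.
- by rewrite mule_ge0// lee_fin phi_ge0.
by rewrite integral_normal_pdf mule1.
Qed.
End normal.

(** * Standard Gaussian vectors *)

Section gaussN.
Context {R : realType}.

Definition Rid (x : measurableTypeR R) : R := x.

Lemma measurable_Rid : measurable_fun setT Rid.
Proof. exact: measurable_id. Qed.

HB.instance Definition _ := isMeasurableFun.Build _ _ _ _ Rid measurable_Rid.

(* [normal_prob 0 1] lives on [measurableTypeR R], whose display differs from
   the one of the canonical measurable structure of [R]. *)
Definition stdG : probability R R := distribution (normal_prob 0 1) Rid.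

Arguments stdG : simpl never.

Lemma ge0_integral_stdG (f : R -> \bar R) :
  measurable_fun setT f -> (forall x, 0 <= f x)%E ->
  (\int[stdG]_x f x = \int[normal_prob 0 1]_x f x)%E.
Proof. by move=> mf f0; rewrite /stdG /distribution ge0_integral_pushforward. Qed.

Lemma stdG_rotate (c s : R) (f : R -> \bar R) : 0 < s -> c ^+ 2 + s ^+ 2 = 1 ->
  measurable_fun setT f -> (forall x, 0 <= f x)%E ->
  (\int[stdG]_x \int[stdG]_y f (c * x + s * y)%R = \int[stdG]_x f x)%E.
Proof.
move=> s0 cs mf f0; rewrite [RHS]ge0_integral_stdG// -(normal_rotate s0 cs)//.
have mg : measurable_fun setT (fun z : R * R => f (c * z.1 + s * z.2)).
  apply: measurableT_comp => //; apply: measurable_funD => //; exact: measurable_funM.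
rewrite ge0_integral_stdG//.
- apply: eq_integral => x _; rewrite ge0_integral_stdG//.
  exact: (measurableT_comp mf (measurable_affine (c * x) s)).
- exact: (@measurable_fun_fubini_tonelli_F _ _ _ _ _ stdG (fun z : R * R => f (c * z.1 + s * z.2))).
- by move=> x; exact: integral_ge0.
Qed.

Definition tcons n (z : R * n.-tuple R) : n.+1.-tuple R := [the n.+1.-tuple R of z.1 :: z.2].

Lemma measurable_tcons n : measurable_fun setT (@tcons n).
Proof. exact: measurable_cons. Qed.

HB.instance Definition _ n := isMeasurableFun.Build _ _ _ _ (@tcons n) (@measurable_tcons n).

(** Built one coordinate at a time, so that nonnegative integrals are iterated integrals and proofs
    go by induction on the dimension. *)
Fixpoint gaussN n : probability (n.-tuple R) R :=
  match n with
  | 0%N => dirac [tuple]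
  | n.+1 => distribution (stdG \x gaussN n)%E (@tcons n)
  end.

Lemma gaussNSE n A : gaussN n.+1 A = (stdG \x gaussN n)%E (@tcons n @^-1` A).
Proof. by []. Qed.

Lemma ge0_integral_gaussNS n (f : n.+1.-tuple R -> \bar R) :
  measurable_fun setT f -> (forall t, 0 <= f t)%E ->
  (\int[gaussN n.+1]_t f t =
   \int[stdG]_x \int[gaussN n]_t f (tcons (x, t)))%E.
Proof.
move=> mf f0 /=; rewrite /distribution ge0_integral_pushforward//=.
rewrite fubini_tonelli1//.
by apply: measurableT_comp => //; exact: measurable_tcons.
Qed.

Lemma ge0_integral_gaussN0 (f : 0.-tuple R -> \bar R) :
  measurable_fun setT f -> (\int[gaussN 0]_t f t = f [tuple])%E.
Proof. by move=> mf /=; rewrite integral_dirac// diracT mul1e. Qed.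

Lemma gaussN_box n (B : 'I_n -> set R) : (forall i, measurable (B i)) ->
  gaussN n [set t | forall i, B i (tnth t i)] = (\prod_(i < n) stdG (B i))%E.
Proof.
elim: n B => [|n IH] B mB.
  rewrite big_ord0 /= (_ : [set _ | _] = setT) ?diracT//.
  by apply/seteqP; split => // t _ [].
rewrite big_ord_recl -IH// gaussNSE.
rewrite (_ : _ @^-1` _ = B ord0 `*` [set t | forall i, B (lift ord0 i) (tnth t i)]).
  apply: product_measure1E => //.
  rewrite (_ : [set _ | _] = \bigcap_(i in [set: 'I_n]) ((fun t => tnth t i) @^-1` B (lift ord0 i))).
    apply: fin_bigcap_measurable => // i _; rewrite -[X in measurable X]setTI.
    exact: measurable_tnth.
  by apply/seteqP; split => t //= h i; [move=> _|]; exact: h.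
apply/seteqP; split => -[x t] /=.
  move=> h; split; first exact: (h ord0).
  by move=> i; have := h (lift ord0 i); rewrite /tcons/= tnthS.
move=> [h0 h] i; have [->//|i0] := eqVneq i ord0.
have [j ->] : exists j, i = lift ord0 j.
  by case: (unliftP ord0 i) i0 => [j -> _|->]; [exists j|rewrite eqxx].
by rewrite /tcons/= tnthS; exact: h.
Qed.

Definition box n (B : 'I_n -> set R) : set (n.-tuple R) :=
  [set t | forall i, B i (tnth t i)].

Lemma measurable_box n (B : 'I_n -> set R) :
  (forall i, measurable (B i)) -> measurable (box B).
Proof.
move=> mB.
rewrite (_ : box B = \bigcap_(i in [set: 'I_n]) ((fun t => tnth t i) @^-1` B i)).
  apply: fin_bigcap_measurable => // i _; rewrite -[X in measurable X]setTI.
  exact: measurable_tnth.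
by apply/seteqP; split => t //= h i; [move=> _|]; exact: h.
Qed.

(** Boxes are stable under intersection and generate the sigma-algebra of tuples. *)
Lemma tuple_measure_unique n (m1 m2 : probability (n.-tuple R) R) :
  (forall B : 'I_n -> set R, (forall i, measurable (B i)) -> m1 (box B) = m2 (box B)) ->
  forall A, measurable A -> m1 A = m2 A.
Proof.
move=> h.
pose G := [set A | exists2 B : 'I_n -> set R, (forall i, measurable (B i)) & box B = A].
apply: (measure_unique G (fun=> setT)).
- apply/seteqP; split.
    apply: smallest_sub; first exact: smallest_sigma_algebra.
    rewrite -bigcup_seq => A [i /= _ [C mC <-]].
    apply: sub_sigma_algebra; exists (fun j => if j == i then C else setT).
      by move=> j; case: ifP.
    apply/seteqP; split => t /=.
      by move=> /(_ i); rewrite eqxx.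
    by move=> [_ Ct] j; case: ifPn => // /eqP ->.
  apply: smallest_sub; first exact: sigma_algebra_measurable.
  by move=> A [B mB <-]; exact: measurable_box.
- move=> _ _ [B mB <-] [C mC <-]; exists (fun i => B i `&` C i).
    by move=> i; exact: measurableI.
  apply/seteqP; split => t /=.
    by move=> H; split => i; have [] := H i.
  by move=> [Hb Hc] i; split; [exact: Hb|exact: Hc].
- by move=> _; exists (fun=> setT) => //; apply/seteqP; split.
- by apply/seteqP; split => // t _; exists 0%N.
- by move=> A [B mB <-]; exact: h.
- by move=> k /=; rewrite probability_setT ltry.
Qed.

(** The form in which independence is exploited: factorization over boxes identifies the law.
    Rotations, concatenations and sign flips all go through this criterion. *)
Lemma eq_integral_law n d (T : measurableType d) (P : probability T R)
  (X : T -> n.-tuple R) (f : n.-tuple R -> \bar R) :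
  measurable_fun setT X ->
  (forall B : 'I_n -> set R, (forall i, measurable (B i)) ->
    P (X @^-1` box B) = (\prod_(i < n) stdG (B i))%E) ->
  measurable_fun setT f -> (forall t, 0 <= f t)%E ->
  (\int[P]_w f (X w) = \int[gaussN n]_t f t)%E.
Proof.
move=> mX hX mf f0.
pose Xm : {mfun T >-> n.-tuple R} := HB.pack X (isMeasurableFun.Build _ _ _ _ X mX).
rewrite -(ge0_integral_distribution Xm)//.
apply: eq_measure_integral => A mA _; apply: tuple_measure_unique => // B mB.
by rewrite gaussN_box// -hX.
Qed.

Lemma eq_law n d (T : measurableType d) (P : probability T R)
  (X : T -> n.-tuple R) :
  measurable_fun setT X ->
  (forall B : 'I_n -> set R, (forall i, measurable (B i)) ->
    P (X @^-1` box B) = (\prod_(i < n) stdG (B i))%E) ->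
  forall A, measurable A -> P (X @^-1` A) = gaussN n A.
Proof.
move=> mX hX A mA.
pose Xm : {mfun T >-> n.-tuple R} := HB.pack X (isMeasurableFun.Build _ _ _ _ X mX).
have -> : P (X @^-1` A) = distribution P Xm A by [].
apply: tuple_measure_unique => // B mB.
by rewrite gaussN_box// -hX.
Qed.

End gaussN.
Arguments stdG : simpl never.
Arguments gaussN : simpl never.

Section gaussN_products.
Context {R : realType}.

Lemma measurable_mktuple d (T : measurableType d) n (F : 'I_n -> T -> R) :
  (forall i, measurable_fun setT (F i)) ->
  measurable_fun setT (fun x => [tuple F i x | i < n]).
Proof.
move=> mF; apply/measurable_fun_tnthP => i.
rewrite (_ : _ \o _ = F i); first exact: mF.
by apply/funext => x /=; rewrite tnth_mktuple.
Qed.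

Lemma measurable_tnth_comp d (T : measurableType d) n (X : T -> n.-tuple R) i :
  measurable_fun setT X -> measurable_fun setT (fun x => tnth (X x) i).
Proof. by move=> mX; exact: (measurableT_comp (measurable_tnth i) mX). Qed.

Lemma emeasurable_prod d (T : measurableType d) n (F : 'I_n -> T -> \bar R) :
  (forall i, measurable_fun setT (F i)) ->
  measurable_fun setT (fun x => \prod_(i < n) F i x)%E.
Proof.
elim: n F => [|n IH] F mF; first by under eq_fun do rewrite big_ord0; exact: measurable_cst.
under eq_fun do rewrite big_ord_recl.
by apply: emeasurable_funM => //; apply: IH.
Qed.

Lemma gaussN_prod n (f : 'I_n -> R -> \bar R) :
  (forall i, measurable_fun setT (f i)) -> (forall i x, 0 <= f i x)%E ->
  (\int[gaussN n]_t (\prod_(i < n) f i (tnth t i)) =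
   \prod_(i < n) \int[stdG]_x (f i x))%E.
Proof.
have mprod k (g : 'I_k -> R -> \bar R) : (forall i, measurable_fun setT (g i)) ->
    measurable_fun setT (fun t : k.-tuple R => \prod_(i < k) g i (tnth t i))%E.
  move=> mg; apply: emeasurable_prod => i.
  exact: (measurableT_comp (mg i) (measurable_tnth i)).
elim: n f => [|n IH] f mf f0.
  rewrite big_ord0 ge0_integral_gaussN0 ?big_ord0//.
  exact: mprod.
rewrite ge0_integral_gaussNS//; last 2 first.
- exact: mprod.
- by move=> t; exact: prode_ge0.
transitivity (\int[stdG]_x ((f ord0 x) *
    \prod_(i < n) \int[stdG]_x (f (lift ord0 i) x)))%E.
  apply: eq_integral => x _; rewrite -IH// -ge0_integralZl//; last 2 first.
  apply: (mprod n (fun i => f (lift ord0 i))) => i; exact: mf.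
  - by move=> t _; exact: prode_ge0.
  apply: eq_integral => t _; rewrite big_ord_recl; congr (_ * _)%E.
  by apply: eq_bigr => i _; rewrite /tcons/= tnthS.
rewrite ge0_integralZr//; last first.
  by apply: prode_ge0 => i _; apply: integral_ge0 => x _.
by rewrite big_ord_recl.
Qed.

Definition tlin n (c s : R) (x y : n.-tuple R) : n.-tuple R :=
  [tuple c * tnth x i + s * tnth y i | i < n].

Lemma measurable_tlin d (T : measurableType d) n (c s : R) (X Y : T -> n.-tuple R) :
  measurable_fun setT X -> measurable_fun setT Y ->
  measurable_fun setT (fun w => tlin c s (X w) (Y w)).
Proof.
move=> mX mY; apply: measurable_mktuple => i.
by apply: measurable_funD; apply: measurable_funM => //; exact: measurable_tnth_comp.
Qed.

Lemma box_indic n (B : 'I_n -> set R) (t : n.-tuple R) :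
  ((\1_(box B) t : R)%:E = \prod_(i < n) (\1_(B i) (tnth t i) : R)%:E)%E.
Proof.
rewrite indicE; have [|tB] := boolP (t \in _).
  rewrite inE => tB; rewrite big1// => i _.
  by rewrite indicE mem_set//; exact: tB.
have [i Bi] : exists i, ~ B i (tnth t i).
  apply/existsNP; move: tB; rewrite notin_setE; exact: contra_not.
by rewrite (bigD1 i)//= indicE memNset// mul0e.
Qed.

(** On a box the double integral factors over the coordinates, which reduces the claim to
    [stdG_rotate]. *)
Lemma gaussN_rotate n (c s : R) (f : n.-tuple R -> \bar R) :
  0 < s -> c ^+ 2 + s ^+ 2 = 1 ->
  measurable_fun setT f -> (forall t, 0 <= f t)%E ->
  (\int[gaussN n]_x \int[gaussN n]_y f (tlin c s x y) = \int[gaussN n]_t f t)%E.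
Proof.
move=> s0 cs mf f0.
pose X (z : n.-tuple R * n.-tuple R) := tlin c s z.1 z.2.
have mX : measurable_fun setT X by apply: measurable_tlin.
rewrite -[RHS](eq_integral_law (P := (gaussN n \x gaussN n)%E) mX)//.
  by rewrite fubini_tonelli1//; exact: (measurableT_comp mf mX).
move=> B mB.
have mXB : measurable (X @^-1` box B).
  by rewrite -[X in measurable X]setTI; apply: mX => //; exact: measurable_box.
transitivity (\int[gaussN n \x gaussN n]_z (\1_(X @^-1` box B) z)%:E)%E.
  by rewrite integral_indic ?setIT.
have mi i : measurable_fun setT (fun z : R * R => (\1_(B i) (c * z.1 + s * z.2) : R)%:E).
  apply/measurable_EFinP; apply: (measurableT_comp (measurable_indic (mB i))).
  by apply: measurable_funD; apply: measurable_funM.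
rewrite fubini_tonelli1//=; last first.
- by apply/measurable_EFinP; exact: measurable_indic.
rewrite /fubini_F /=.
transitivity (\int[gaussN n]_x \prod_(i < n)
    \int[stdG]_u (\1_(B i) (c * tnth x i + s * u) : R)%:E)%E.
  apply: eq_integral => x _; rewrite -gaussN_prod//; last first.
  - move=> i; exact: (measurableT_comp (mi i) (pair1_measurable (tnth x i))).
  apply: eq_integral => y _; rewrite -[LHS]/((\1_(box B) (tlin c s x y))%:E) box_indic.
  by apply: eq_bigr => i _; rewrite tnth_mktuple.
rewrite (gaussN_prod (f := fun i v => \int[stdG]_u (\1_(B i) (c * v + s * u) : R)%:E)%E); last 2 first.
- move=> i; apply: (@measurable_fun_fubini_tonelli_F _ _ _ _ _ stdG
    (fun z : R * R => (\1_(B i) (c * z.1 + s * z.2) : R)%:E)) => //.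
- by move=> i v; apply: integral_ge0 => u _; rewrite lee_fin indicE.
apply: eq_bigr => i _.
rewrite (stdG_rotate (f := fun v => (\1_(B i) v : R)%:E) s0 cs).
- by rewrite integral_indic ?setIT.
- exact/measurable_EFinP/measurable_indic.
- by move=> v; rewrite lee_fin indicE.
Qed.

Definition tcat m n (z : m.-tuple R * n.-tuple R) : (m + n).-tuple R :=
  [tuple of z.1 ++ z.2].

Lemma measurable_tcat m n : measurable_fun setT (@tcat m n).
Proof.
apply/measurable_fun_tnthP => i; case: (split_ordP i) => j ->.
- rewrite (_ : _ \o _ = fun z => tnth z.1 j).
    exact: (measurableT_comp (measurable_tnth j)).
  by apply/funext => z /=; rewrite tnth_lshift.
- rewrite (_ : _ \o _ = fun z => tnth z.2 j).
    exact: (measurableT_comp (measurable_tnth j)).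
  by apply/funext => z /=; rewrite tnth_rshift.
Qed.

Lemma gaussN_cat m n (f : (m + n).-tuple R -> \bar R) :
  measurable_fun setT f -> (forall t, 0 <= f t)%E ->
  (\int[gaussN (m + n)]_t f t =
   \int[gaussN m]_x \int[gaussN n]_y f (tcat (x, y)))%E.
Proof.
move=> mf f0.
rewrite -[LHS](eq_integral_law (P := (gaussN m \x gaussN n)%E) (measurable_tcat (m:=m) (n:=n)))//.
  by rewrite fubini_tonelli1//; exact: (measurableT_comp mf (measurable_tcat (m:=m) (n:=n))).
move=> B mB; rewrite big_split_ord/= -!gaussN_box// -product_measure1E//; last 2 first.
- by apply: (measurable_box (B := fun i => B (lshift n i))).
- by apply: (measurable_box (B := fun i => B (rshift m i))).
rewrite (_ : _ @^-1` _ = [set t | forall i, B (lshift n i) (tnth t i)] `*`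
  [set t | forall i, B (rshift m i) (tnth t i)])//.
apply/seteqP; split => -[x y] /=.
  move=> h; split => i.
    by have := h (lshift n i); rewrite tnth_lshift.
  by have := h (rshift m i); rewrite tnth_rshift.
move=> [h1 h2] i; case: (split_ordP i) => j ->.
  by rewrite tnth_lshift.
by rewrite tnth_rshift.
Qed.

End gaussN_products.

(** * Moments of Gaussian vectors, by domination and by parity *)

Section moments.
Context {R : realType}.
Local Notation mu := (@lebesgue_measure R).

Lemma ge0_integral_stdG_phi (f : R -> \bar R) :
  measurable_fun setT f -> (forall x, 0 <= f x)%E ->
  (\int[stdG]_x f x = \int[mu]_x (f x * (phi x)%:E))%E.
Proof. by move=> mf f0; rewrite ge0_integral_stdG// ge0_integral_stdnormal. Qed.

Lemma integral_expR_stdG (a : R) :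
  (\int[stdG]_x (expR (a * x))%:E = (expR (a ^+ 2 / 2))%:E)%E.
Proof.
have me : measurable_fun setT (fun x : R => expR (a * x)).
  by apply: measurableT_comp => //; exact: measurable_funM.
rewrite ge0_integral_stdG_phi//; last exact/measurable_EFinP.
transitivity (\int[mu]_x ((expR (a ^+ 2 / 2))%:E * (normal_pdf a 1 x)%:E))%E.
  apply: eq_integral => x _; rewrite -!EFinM normal_pdf_phi// invr1 mul1r ?mulr1.
  congr (_%:E); rewrite /phi mulrCA [RHS]mulrCA -!expRD; congr (_ * expR _).
  by field.
rewrite ge0_integralZl//; last 2 first.
- by apply/measurable_EFinP; exact: measurable_normal_pdf.
- by move=> x _; rewrite lee_fin normal_pdf_ge0.
by rewrite integral_normal_pdf mule1.
Qed.

Lemma ge0_integral_stdGN (f : R -> \bar R) :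
  measurable_fun setT f -> (forall x, 0 <= f x)%E ->
  (\int[stdG]_x f (- x)%R = \int[stdG]_x f x)%E.
Proof.
move=> mf f0.
have mfN : measurable_fun setT (fun x : R => f (- x)).
  exact: (measurableT_comp mf (@oppr_measurable R setT)).
rewrite !ge0_integral_stdG_phi//.
pose F (x : measurableTypeR R) : measurableTypeR R := - x.
have mF : measurable_fun setT F by exact: oppr_measurable.
pose pF : {measure set (measurableTypeR R) -> \bar R} :=
  measure_function_pushforward__canonical__measure_function_Measure mu mF.
transitivity (\int[pF]_x (f x * (phi x)%:E))%E; last first.
  by apply: eq_measure_integral => A mA _; exact: lebesgue_measureN.
have mg : measurable_fun setT (fun x => f x * (phi x)%:E)%E.
  by apply: emeasurable_funM => //; apply/measurable_EFinP; exact: measurable_phi.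
have g0 : {in setT, forall x, (0 <= f x * (phi x)%:E)%E}.
  by move=> x _; rewrite mule_ge0// lee_fin phi_ge0.
apply: etrans (esym (ge0_integral_pushforward mF mu measurableT mg g0)).
by apply: eq_integral => x _; rewrite /= /F /phi sqrrN.
Qed.

Lemma stdGN (A : set R) : measurable A -> stdG (-%R @^-1` A) = stdG A.
Proof.
move=> mA.
have mNA : measurable ((-%R : R -> R) @^-1` A).
  by rewrite -[X in measurable X]setTI; exact: oppr_measurable.
have : (\int[stdG]_x (\1_(-%R @^-1` A) x : R)%:E = \int[stdG]_x (\1_A x : R)%:E)%E.
  apply: (ge0_integral_stdGN (f := fun x => (\1_A x)%:E)) => //.
  by apply/measurable_EFinP; exact: measurable_indic.
by rewrite !integral_indic// !setIT.
Qed.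

Definition nrm1 n (t : n.-tuple R) : R := \sum_(i < n) `|tnth t i|.

Lemma measurable_nrm1 n : measurable_fun setT (@nrm1 n).
Proof.
apply: measurable_sum => i; apply: measurableT_comp => //; exact: measurable_tnth.
Qed.

Lemma nrm1_ge0 n (t : n.-tuple R) : 0 <= nrm1 t.
Proof. exact: sumr_ge0. Qed.

(** The integrand factors over the coordinates and exp |x| <= exp x + exp (- x). It is the common
    dominating function for polynomials of low degree, for cubic remainders and for bounded
    functions. *)
Lemma integral_expR_nrm1 n : exists M : R,
  (\int[gaussN n]_t (expR (nrm1 t))%:E <= M%:E)%E.
Proof.
exists ((expR (2^-1) *+ 2) ^+ n).
under eq_integral do rewrite /nrm1 expR_sum -prodEFin.
have me (a : R) : measurable_fun setT (fun x : R => (expR (a * x))%:E).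
  by apply/measurable_EFinP; apply: measurableT_comp => //; exact: measurable_funM.
have mn : measurable_fun setT (fun x : R => (expR `|x|)%:E).
  by apply/measurable_EFinP; apply: measurableT_comp => //; exact: measurableT_comp.
rewrite (gaussN_prod (f := fun i x => (expR `|x|)%:E))//.
have h : (\int[stdG]_x (expR `|x|)%:E <= (expR (2^-1) *+ 2 : R)%:E)%E.
  apply: (@le_trans _ _ (\int[stdG]_x ((expR (1 * x))%:E + (expR (-1 * x))%:E))%E).
    apply: ge0_le_integral => //; first exact: emeasurable_funD.
    move=> x _; rewrite -EFinD lee_fin mul1r mulN1r.
    by case: ger0P => _; [rewrite lerDl|rewrite lerDr]; rewrite expR_ge0.
  rewrite ge0_integralD//; rewrite !integral_expR_stdG expr1n sqrrN expr1n mul1r.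
  by rewrite -EFinD mulr2n.
elim: n => [|n IH]; first by rewrite big_ord0 expr0.
rewrite big_ord_recl exprS EFinM; apply: lee_pmul => //.
  by apply: integral_ge0.
by apply: prode_ge0 => i _; apply: integral_ge0.
Qed.

Lemma integrable_expR_dom n (f : n.-tuple R -> R) (C : R) :
  measurable_fun setT f -> (forall t, `|f t| <= C * expR (nrm1 t)) ->
  (gaussN n).-integrable setT (EFin \o f).
Proof.
move=> mf fC; have [M hM] := integral_expR_nrm1 n.
have mE : measurable_fun setT (fun t : n.-tuple R => (expR (nrm1 t))%:E).
  by apply/measurable_EFinP; apply: measurableT_comp => //; exact: measurable_nrm1.
have C0 : 0 <= C.
  have := fC [tuple 0 | i < n]; move/(le_trans (normr_ge0 _)).
  by rewrite pmulr_lge0 ?expR_gt0.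
apply: (@le_integrable _ _ _ _ _ _ _ (fun t => (C * expR (nrm1 t))%:E)) => //.
- exact/measurable_EFinP.
- by move=> t _ /=; rewrite lee_fin (le_trans (fC t))// ler_norm.
- apply/integrableP; split; first by apply/measurable_EFinP/measurable_funM => //; exact/measurable_EFinP.
  under eq_integral do rewrite gee0_abs ?lee_fin ?mulr_ge0 ?expR_ge0// EFinM.
  rewrite ge0_integralZl//.
  apply: (@le_lt_trans _ _ (C%:E * M%:E)%E); last by rewrite -EFinM ltry.
  by apply: lee_wpmul2l => //; rewrite lee_fin.
Qed.

Definition flip n (k : 'I_n) (t : n.-tuple R) : n.-tuple R :=
  [tuple (if i == k then - tnth t i else tnth t i) | i < n].

Lemma measurable_flip n (k : 'I_n) : measurable_fun setT (flip k).
Proof.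
apply: measurable_mktuple => i; case: (i == k); last exact: measurable_tnth.
by apply: measurableT_comp => //; exact: measurable_tnth.
Qed.

(** [flip k] preserves the law, so the positive and negative parts of [f] have equal integrals;
    integrability makes these finite, and their difference is 0. *)
Lemma integral_flip_odd n (k : 'I_n) (f : n.-tuple R -> R) :
  measurable_fun setT f -> (forall t, f (flip k t) = - f t) ->
  (gaussN n).-integrable setT (EFin \o f) ->
  (\int[gaussN n]_t (f t)%:E = 0)%E.
Proof.
move=> mf fN fi.
have flipE (g : n.-tuple R -> \bar R) : measurable_fun setT g -> (forall t, 0 <= g t)%E ->
    (\int[gaussN n]_t g (flip k t) = \int[gaussN n]_t g t)%E.
  move=> mg g0; apply: eq_integral_law => // [|B mB]; first exact: measurable_flip.
  pose B' i := if i == k then -%R @^-1` B i else B i.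
  rewrite (_ : _ @^-1` _ = box B').
    rewrite gaussN_box.
      by apply: eq_bigr => i _; rewrite /B'; case: ifP => // _; rewrite stdGN.
    move=> i; rewrite /B'; case: ifP => // _.
    by rewrite -[X in measurable X]setTI; exact: oppr_measurable.
  by apply/seteqP; split => t h i; have := h i; rewrite /B' tnth_mktuple /=; case: ifP.
have h : (\int[gaussN n]_t (EFin \o f)^\- t = \int[gaussN n]_t (EFin \o f)^\+ t)%E.
  rewrite -[RHS]flipE//; last by apply: measurable_funepos; exact/measurable_EFinP.
  by apply: eq_integral => t _; rewrite funeposE funenegE /= fN.
have fin : (\int[gaussN n]_t (EFin \o f)^\+ t)%E \is a fin_num.
  by apply: integrable_fin_num => //; exact: integrable_funepos.
by rewrite -[LHS]/(\int[gaussN n]_t (EFin \o f) t)%E integralE h subee.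
Qed.

Lemma expR_ge_exp3 (x : R) : 0 <= x -> x ^+ 3 <= 6 * expR x.
Proof.
move=> x0; have := @expR_ge1Dxn R x 2 x0.
rewrite (_ : 3`!%:R = 6)//; lra.
Qed.

Lemma nrm1_tnth n (t : n.-tuple R) k : `|tnth t k| <= nrm1 t.
Proof. by rewrite /nrm1 (bigD1 k)//= lerDl sumr_ge0. Qed.

(** Kept as an abstract nonnegative constant: it multiplies the second-order terms of both processes
    alike. *)
Definition sigma2 : R := fine (\int[stdG]_x (x ^+ 2)%:E)%E.

Lemma nrm1_pow_le n (t : n.-tuple R) :
  [/\ 1 <= expR (nrm1 t), nrm1 t <= expR (nrm1 t),
      nrm1 t ^+ 2 <= 2 * expR (nrm1 t) & nrm1 t ^+ 3 <= 6 * expR (nrm1 t)].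
Proof.
have t0 := nrm1_ge0 t; split.
- by rewrite -expR0 ler_expR.
- by apply: le_trans (expR_ge1Dx _); rewrite lerDr.
- have := @expR_ge1Dxn R _ 1 t0; rewrite (_ : 2`!%:R = 2)//; lra.
- exact: expR_ge_exp3.
Qed.

Lemma measurable_tnthM n (i j : 'I_n) :
  measurable_fun setT (fun t : n.-tuple R => tnth t i * tnth t j).
Proof. by apply: measurable_funM; exact: measurable_tnth. Qed.

Lemma integrable_tnth n (i : 'I_n) :
  (gaussN n).-integrable setT (EFin \o (fun t : n.-tuple R => tnth t i)).
Proof.
apply: (@integrable_expR_dom _ _ 1); first exact: measurable_tnth.
move=> t; rewrite mul1r; apply: le_trans (nrm1_tnth t i) _.
by have [] := nrm1_pow_le t.
Qed.

Lemma integrable_tnthM n (i j : 'I_n) :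
  (gaussN n).-integrable setT (EFin \o (fun t : n.-tuple R => tnth t i * tnth t j)).
Proof.
apply: (@integrable_expR_dom _ _ 2); first exact: measurable_tnthM.
move=> t; rewrite normrM.
apply: (@le_trans _ _ (nrm1 t ^+ 2)); last by have [] := nrm1_pow_le t.
by rewrite expr2; apply: ler_pM => //; exact: nrm1_tnth.
Qed.

Lemma integral_tnth n (i : 'I_n) : (\int[@gaussN R n]_t (tnth t i)%:E = 0)%E.
Proof.
apply: (integral_flip_odd (k := i)).
- exact: measurable_tnth.
- by move=> t; rewrite tnth_mktuple eqxx.
- exact: integrable_tnth.
Qed.

Lemma integral_tnthM n (i j : 'I_n) :
  (\int[@gaussN R n]_t (tnth t i * tnth t j)%:E = (sigma2 *+ (i == j))%:E)%E.
Proof.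
have [<-|ij] := eqVneq i j; last first.
  rewrite mulr0n; apply: (integral_flip_odd (k := i)).
  - exact: measurable_tnthM.
  - by move=> t; rewrite !tnth_mktuple eqxx eq_sym (negbTE ij) mulNr.
  - exact: integrable_tnthM.
have msq : measurable_fun setT (fun x : R => x ^+ 2) by exact: exprn_measurable.
have E : (\int[@gaussN R n]_t (tnth t i * tnth t i)%:E = \int[stdG]_x (x ^+ 2)%:E)%E.
  pose f (k : 'I_n) (x : R) : \bar R := if k == i then (x ^+ 2)%:E else 1%E.
  have mf k : measurable_fun setT (f k).
    by rewrite /f; case: (k == i) => //; exact/measurable_EFinP.
  have f0 k x : (0 <= f k x)%E.
    by rewrite /f; case: ifP => // _; rewrite lee_fin sqr_ge0.
  transitivity (\int[@gaussN R n]_t \prod_(k < n) f k (tnth t k))%E.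
    apply: eq_integral => t _; rewrite (bigD1 i)//= big1 ?mule1.
      by rewrite /f eqxx expr2.
    by move=> k ki; rewrite /f (negbTE ki).
  rewrite gaussN_prod// (bigD1 i)//= big1 ?mule1.
    by apply: eq_integral => x _; rewrite /f eqxx.
  move=> k ki; under eq_integral do rewrite /f (negbTE ki).
  by rewrite integral_cst//= mul1e; exact: probability_setT.
rewrite mulr1n E /sigma2 fineK// -E.
by apply: integrable_fin_num => //; exact: integrable_tnthM.
Qed.

Lemma sigma2_ge0 : 0 <= sigma2.
Proof. by apply: fine_ge0; apply: integral_ge0 => x _; rewrite lee_fin sqr_ge0. Qed.

End moments.

(** * Gaussian comparison by Lindeberg replacement *)

Section cutoff.
Context {R : realType}.
Implicit Types z v : R.

Definition pos z : R := Num.max z 0.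

Lemma posP z : (0 <= z /\ pos z = z) \/ (z <= 0 /\ pos z = 0).
Proof.
have [z0|z0] := leP 0 z; [left|right]; split; rewrite ?ltW// /pos.
  by apply/max_idPl.
by apply/max_idPr/ltW.
Qed.

(* A C^2 spline equal to 1 for z <= 0 and to 0 for z >= 3; [chi1] is its derivative and [chi2]
   half its second derivative. *)
Definition chi z : R :=
  1 - (pos z ^+ 3 - 3 * pos (z - 1) ^+ 3 + 3 * pos (z - 2) ^+ 3 - pos (z - 3) ^+ 3) / 6.
Definition chi1 z : R :=
  - (pos z ^+ 2 - 3 * pos (z - 1) ^+ 2 + 3 * pos (z - 2) ^+ 2 - pos (z - 3) ^+ 2) / 2.
Definition chi2 z : R :=
  - (pos z - 3 * pos (z - 1) + 3 * pos (z - 2) - pos (z - 3)) / 2.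

Lemma measurable_chi : measurable_fun setT chi.
Proof.
have mp (a : R) : measurable_fun setT (fun z => pos (z - a) ^+ 3).
  apply: measurable_funX; apply: measurable_maxr => //.
  exact: measurable_funB.
have mp0 : measurable_fun setT (fun z => pos z ^+ 3).
  by apply: measurable_funX; apply: measurable_maxr.
apply: measurable_funB => //; apply: measurable_funM => //.
apply: measurable_funB => //; apply: measurable_funD.
  by apply: measurable_funB => //; apply: measurable_funM.
by apply: measurable_funM.
Qed.

Lemma pos_id z : 0 <= z -> pos z = z. Proof. by move=> ?; apply/max_idPl. Qed.
Lemma pos_0 z : z <= 0 -> pos z = 0. Proof. by move=> ?; apply/max_idPr. Qed.

Lemma chi_cases z : [\/ z <= 0 /\ [/\ chi z = 1, chi1 z = 0 & chi2 z = 0],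
  [/\ 0 <= z, z <= 1, chi z = 1 - z ^+ 3 / 6, chi1 z = - z ^+ 2 / 2 & chi2 z = - z / 2],
  [/\ 1 <= z, z <= 2, chi z = 1 - (z ^+ 3 - 3 * (z - 1) ^+ 3) / 6,
     chi1 z = - (z ^+ 2 - 3 * (z - 1) ^+ 2) / 2 & chi2 z = - (z - 3 * (z - 1)) / 2] |
  ([/\ 2 <= z, z <= 3, chi z = (3 - z) ^+ 3 / 6,
     chi1 z = - (3 - z) ^+ 2 / 2 & chi2 z = (3 - z) / 2] \/
   3 <= z /\ [/\ chi z = 0, chi1 z = 0 & chi2 z = 0])].
Proof.
rewrite /chi /chi1 /chi2.
have [z0|z0] := leP z 0.
  by apply: Or41; rewrite !pos_0; try lra; split=> //; split; field.
have [z1|z1] := leP z 1.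
  by apply: Or42; rewrite (@pos_id z) ?(@pos_0 (z - _)); try lra; split; [lra|lra|field..].
have [z2|z2] := leP z 2.
  by apply: Or43; rewrite (@pos_id z) ?(@pos_id (z - 1)) ?(@pos_0 (z - _)); try lra; split; [lra|lra|field..].
have [z3|z3] := leP z 3; apply: Or44; [left|right].
  by rewrite (@pos_id z) ?(@pos_id (z - 1)) ?(@pos_id (z - 2)) ?(@pos_0 (z - 3)); try lra; split; [lra|lra|field..].
by rewrite !pos_id; try lra; split; [lra|split; field].
Qed.

Lemma chi_le0 z : z <= 0 -> chi z = 1.
Proof. by move=> z0; rewrite /chi !pos_0; lra. Qed.

Lemma chi_ge3 z : 3 <= z -> chi z = 0.
Proof. by move=> z0; rewrite /chi !pos_id; lra. Qed.

Lemma chi_bounds z :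
  [/\ 0 <= chi z <= 1, - 1 <= chi1 z <= 0 & `|chi2 z| <= 1].
Proof.
rewrite ler_norml; case: (chi_cases z) => [[z0 [-> -> ->]]|[z0 z1 -> -> ->]|[z0 z1 -> -> ->]|[[z0 z1 -> -> ->]|[z0 [-> -> ->]]]];
  split; try (by lra); try (by nra).
(* On 1 <= z <= 2, products of powers of z - 1 and 2 - z are the nonnegative monomials from which
   [nra] assembles the bound. *)
- have : 0 <= (z - 1) * (2 - z) by nra.
  have : 0 <= (z - 1) ^+ 2 by nra.
  have : 0 <= (z - 1) ^+ 3 by rewrite exprn_ge0; lra.
  have : 0 <= (2 - z) ^+ 3 by rewrite exprn_ge0; lra.
  have : 0 <= (z - 1) ^+ 2 * (2 - z)  by rewrite mulr_ge0 ?exprn_ge0; lra.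
  have : 0 <= (z - 1) * (2 - z) ^+ 2  by rewrite mulr_ge0 ?exprn_ge0; lra.
  nra.
- have : 0 <= (3 - z) ^+ 3 by rewrite exprn_ge0; lra.
  have : (3 - z) ^+ 3 <= 1 by rewrite exprn_ile1; lra.
  lra.
Qed.

(** The second derivative of the cubed positive part is 6 [pos], which is 6-Lipschitz; hence the
    coefficient 1 in the remainder. The proof splits on the signs of z and z + v. *)
Lemma pos3_taylor z v :
  `|pos (z + v) ^+ 3 - pos z ^+ 3 - 3 * pos z ^+ 2 * v - 3 * pos z * v ^+ 2| <= `|v| ^+ 3.
Proof.
rewrite -normrX.
case: (posP z) => -[z0 ->]; case: (posP (z + v)) => -[zv0 ->].
- rewrite (_ : _ - _ = v ^+ 3)//; ring.
- rewrite (_ : _ - _ = (z + v) ^+ 3 * (- 1) + v ^+ 3); last by ring.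
  have v0 : v <= 0 by lra.
  rewrite (@ler0_norm _ (v ^+ 3)); last by rewrite exprS mulr_le0_ge0// sqr_ge0.
  have h1 : (- (z + v)) ^+ 3 <= (- v) ^+ 3 by apply: lerXn2r; rewrite ?nnegrE; lra.
  have h2 : 0 <= (- (z + v)) ^+ 3 by apply: exprn_ge0; lra.
  rewrite ler_norml; move: h1 h2.
  rewrite (_ : (- (z + v)) ^+ 3 = - (z + v) ^+ 3); last by ring.
  rewrite (_ : (- v) ^+ 3 = - v ^+ 3); last by ring.
  lra.
- have v0 : 0 <= v by lra.
  rewrite (_ : _ - _ = (z + v) ^+ 3); last by ring.
  rewrite !ger0_norm ?exprn_ge0//.
  by apply: lerXn2r; rewrite ?nnegrE//; lra.
- by rewrite (_ : _ - _ = 0) ?normr0//; ring.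
Qed.

(** [chi] combines four shifted cubes with weights 1, 3, 3, 1 over 6, so the remainders add up to at
    most 8/6 of |v|^3. *)
Lemma chi_taylor z v :
  `|chi (z + v) - (chi z + chi1 z * v + chi2 z * v ^+ 2)| <= 2 * `|v| ^+ 3.
Proof.
have T a : exists2 r, `|r| <= `|v| ^+ 3 & pos (z + v - a) ^+ 3 =
   pos (z - a) ^+ 3 + 3 * pos (z - a) ^+ 2 * v + 3 * pos (z - a) * v ^+ 2 + r.
  eexists; first exact: (pos3_taylor (z - a) v).
  by rewrite addrAC; ring.
have := T 0; rewrite !subr0 => -[r0 h0 E0].
have [r1 h1 E1] := T 1; have [r2 h2 E2] := T 2; have [r3 h3 E3] := T 3.
rewrite /chi /chi1 /chi2 E0 E1 E2 E3.
rewrite (_ : _ - _ = - (r0 - 3 * r1 + 3 * r2 - r3) / 6); last by field.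
move: h0 h1 h2 h3; rewrite !ler_norml; lra.
Qed.

End cutoff.

(** * Second-order expansions in finitely many variables *)

Section second_order.
Context {R : realType} (P : finType).
Implicit Types (v l : P -> R) (q : P -> P -> R).

Definition l1 v : R := \sum_p `|v p|.
Definition lin l v : R := \sum_p l p * v p.
Definition quad q v : R := \sum_p \sum_p' q p p' * (v p * v p').

Lemma l1_ge0 v : 0 <= l1 v. Proof. exact: sumr_ge0. Qed.

Lemma l1_coord v p : `|v p| <= l1 v.
Proof. by rewrite /l1 (bigD1 p)//= lerDl sumr_ge0. Qed.

Lemma lin_le K l v : (forall p, `|l p| <= K) -> `|lin l v| <= K * l1 v.
Proof.
move=> lK; rewrite (le_trans (ler_norm_sum _ _ _))// /l1 mulr_sumr.
by apply: ler_sum => p _; rewrite normrM ler_wpM2r.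
Qed.

Lemma quad_le K q v : (forall p p', `|q p p'| <= K) -> `|quad q v| <= K * l1 v ^+ 2.
Proof.
move=> qK; rewrite (le_trans (ler_norm_sum _ _ _))// expr2 {1}/l1 mulr_suml mulr_sumr.
apply: ler_sum => p _; rewrite (le_trans (ler_norm_sum _ _ _))// /l1 !mulr_sumr.
by apply: ler_sum => p' _; rewrite !normrM ler_wpM2r.
Qed.

(* A second-order expansion of f at 0 with an explicit cubic remainder: closed under products,
   so no derivative of the smoothed indicator has to be computed. *)
Record taylor2 (K : R) (f : (P -> R) -> R) (c : R) l q : Prop := Taylor2 {
  t2f : forall v, 0 <= f v <= 1;
  t2c : 0 <= c <= 1;
  t2l : forall p, `|l p| <= K;
  t2q : forall p p', `|q p p'| <= K;
  t2r : forall v, `|f v - (c + lin l v + quad q v)| <= K * l1 v ^+ 3 }.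

Lemma taylor2_le K K' f c l q : K <= K' -> taylor2 K f c l q -> taylor2 K' f c l q.
Proof.
move=> KK' [? ? tl tq tr]; split=> //.
- by move=> p; exact: le_trans KK'.
- by move=> p p'; exact: le_trans KK'.
- by move=> v; apply: le_trans (tr v) _; rewrite ler_wpM2r// exprn_ge0// l1_ge0.
Qed.

Lemma remainder_mul (K a f f' c c' l l' q q' : R) : 1 <= K -> 0 <= a ->
  0 <= f <= 1 -> 0 <= f' <= 1 -> 0 <= c <= 1 -> 0 <= c' <= 1 ->
  `|l| <= K * a -> `|l'| <= K * a -> `|q| <= K * a ^+ 2 -> `|q'| <= K * a ^+ 2 ->
  `|f - (c + l + q)| <= K * a ^+ 3 -> `|f' - (c' + l' + q')| <= K * a ^+ 3 ->
  `|f * f' - (c * c' + (c * l' + c' * l) + (c * q' + c' * q + l * l'))| <=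
  7 * K ^+ 2 * a ^+ 3.
Proof.
move=> K1 a0 f01 f'01 c01 c'01 hl hl' hq hq' hr hr'.
have K0 : 0 <= K by lra.
have KK : K <= K ^+ 2 by rewrite expr2; nra.
have nf : `|f| <= 1 by rewrite ger0_norm; lra.
have nf' : `|f'| <= 1 by rewrite ger0_norm; lra.
have nc : `|c| <= 1 by rewrite ger0_norm; lra.
have nc' : `|c'| <= 1 by rewrite ger0_norm; lra.
have M x y X Y : `|x| <= X -> `|y| <= Y -> `|x * y| <= X * Y :> R.
  by move=> hx hy; rewrite normrM; apply: ler_pM.
have T (x y X Y : R) : `|x| <= X -> `|y| <= Y -> `|x + y| <= X + Y.
  by move=> hx hy; apply: le_trans (ler_normD _ _) _; exact: lerD.
have a3 : 0 <= a ^+ 3 by exact: exprn_ge0.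
(* For a <= 1 the terms of order at least 3 are small by an algebraic identity. For a > 1 every term
   of the difference is separately below K^2 a^3. Each case counts seven such units. *)
have [a1|a1] := leP a 1.
- have aa : a ^+ 2 <= 1 by rewrite exprn_ile1.
  have a43 : a ^+ 4 <= a ^+ 3 by rewrite exprS; nra.
  rewrite (_ : _ - _ = (f - (c + l + q)) * f' + (c + l + q) * (f' - (c' + l' + q')) +
     (l * q' + q * l' + q * q')); last by ring.
  have h : `|c + l + q| <= 3 * K.
    apply: le_trans (T _ _ _ _ (T _ _ _ _ nc hl) hq) _; nra.
  have h1 := T _ _ _ _ (M _ _ _ _ hr nf') (M _ _ _ _ h hr').
  have h2 := T _ _ _ _ (T _ _ _ _ (M _ _ _ _ hl hq') (M _ _ _ _ hq hl')) (M _ _ _ _ hq hq').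
  apply: le_trans (T _ _ _ _ h1 h2) _.
  have : K ^+ 2 * a ^+ 4 <= K ^+ 2 * a ^+ 3 by rewrite ler_wpM2l// sqr_ge0.
  have : K * a ^+ 3 <= K ^+ 2 * a ^+ 3 by rewrite ler_wpM2r.
  rewrite (_ : K * a ^+ 3 * 1 + _ + _ = K * a ^+ 3 + 3 * (K ^+ 2 * a ^+ 3)
    + (2 * (K ^+ 2 * a ^+ 3) + K ^+ 2 * a ^+ 4)); last by ring.
  by move=> ? ?; lra.
- have aa : a <= a ^+ 3 by rewrite -{1}(expr1 a) ler_weXn2l// ltW.
  have aa2 : a ^+ 2 <= a ^+ 3 by rewrite ler_weXn2l// ltW.
  have h0 := T _ _ _ _ (M _ _ _ _ nc hl') (M _ _ _ _ nc' hl).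
  have h1 := T _ _ _ _ (T _ _ _ _ (M _ _ _ _ nc hq') (M _ _ _ _ nc' hq)) (M _ _ _ _ hl hl').
  have h2 := T _ _ _ _ (T _ _ _ _ (M _ _ _ _ nc nc') h0) h1.
  have h3 := h2; rewrite -normrN in h3.
  apply: le_trans (T _ _ _ _ (M _ _ _ _ nf nf') h3) _.
  have k1 : K * a <= K ^+ 2 * a ^+ 3 by apply: ler_pM.
  have k2 : K * a ^+ 2 <= K ^+ 2 * a ^+ 3 by apply: ler_pM => //; exact: exprn_ge0.
  have k3 : K ^+ 2 * a ^+ 2 <= K ^+ 2 * a ^+ 3 by rewrite ler_wpM2l// sqr_ge0.
  have k4 : 1 <= K ^+ 2 * a ^+ 3.
    by rewrite -[leLHS]mulr1; apply: ler_pM => //; [exact: le_trans KK|exact/exprn_ege1/ltW].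
  rewrite (_ : K * a * (K * a) = K ^+ 2 * a ^+ 2); last by ring.
  rewrite -mulrA; move: (K * a) (K * a ^+ 2) (K ^+ 2 * a ^+ 2) (K ^+ 2 * a ^+ 3) k1 k2 k3 k4.
  by move=> *; lra.
Qed.

Lemma linD l l' v (a b : R) : lin (fun p => a * l p + b * l' p) v = a * lin l v + b * lin l' v.
Proof.
rewrite /lin !mulr_sumr -big_split/=; apply: eq_bigr => p _.
by rewrite mulrDl !mulrA.
Qed.

Lemma quadD q q' l l' v (a b : R) :
  quad (fun p p' => a * q p p' + b * q' p p' + l p * l' p') v =
  a * quad q v + b * quad q' v + lin l v * lin l' v.
Proof.
rewrite /quad /lin mulr_suml !mulr_sumr -!big_split/=; apply: eq_bigr => p _.
rewrite !mulr_sumr -!big_split/=; apply: eq_bigr => p' _; ring.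
Qed.

Lemma taylor2_mul K f f' c c' l l' q q' : 1 <= K ->
  taylor2 K f c l q -> taylor2 K f' c' l' q' ->
  taylor2 (7 * K ^+ 2) (fun v => f v * f' v) (c * c')
    (fun p => c * l' p + c' * l p)
    (fun p p' => c * q' p p' + c' * q p p' + l p * l' p').
Proof.
move=> K1 [tf tc tl tq tr] [tf' tc' tl' tq' tr'].
have KK : K <= K ^+ 2 by rewrite expr2; nra.
have M (x y X Y : R) : `|x| <= X -> `|y| <= Y -> `|x * y| <= X * Y :> R.
  by move=> hx hy; rewrite normrM; apply: ler_pM.
have T (x y X Y : R) : `|x| <= X -> `|y| <= Y -> `|x + y| <= X + Y.
  by move=> hx hy; apply: le_trans (ler_normD _ _) _; exact: lerD.
have nc : `|c| <= 1 by rewrite ger0_norm; lra.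
have nc' : `|c'| <= 1 by rewrite ger0_norm; lra.
split.
- by move=> v; have := tf v; have := tf' v; nra.
- by nra.
- move=> p; apply: le_trans (T _ _ _ _ (M _ _ _ _ nc (tl' p)) (M _ _ _ _ nc' (tl p))) _; lra.
- move=> p p'.
  apply: le_trans (T _ _ _ _ (T _ _ _ _ (M _ _ _ _ nc (tq' p p')) (M _ _ _ _ nc' (tq p p')))
    (M _ _ _ _ (tl p) (tl' p'))) _.
  by rewrite -expr2; lra.
- move=> v; rewrite linD quadD; apply: remainder_mul => //; first exact: l1_ge0.
  + exact: lin_le.
  + exact: lin_le.
  + exact: quad_le.
  + exact: quad_le.
Qed.

Lemma taylor2_onem K f c l q : taylor2 K f c l q ->
  taylor2 K (fun v => 1 - f v) (1 - c) (fun p => - l p) (fun p p' => - q p p').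
Proof.
move=> [tf tc tl tq tr]; split.
- by move=> v; have := tf v; lra.
- lra.
- by move=> p; rewrite normrN.
- by move=> p p'; rewrite normrN.
- move=> v; have := tr v; rewrite -normrN; congr (`|_| <= _).
  have -> : lin (fun p => - l p) v = - lin l v.
    by rewrite /lin -sumrN; apply: eq_bigr => p _; rewrite mulNr.
  have -> : quad (fun p p' => - q p p') v = - quad q v.
    rewrite /quad -sumrN; apply: eq_bigr => p _.
    by rewrite -sumrN; apply: eq_bigr => p' _; rewrite mulNr.
  ring.
Qed.

Lemma taylor2_chi (z : P -> R) p0 :
  taylor2 2 (fun v => chi (z p0 + v p0)) (chi (z p0))
    (fun p => chi1 (z p0) *+ (p == p0))
    (fun p p' => chi2 (z p0) *+ ((p == p0) && (p' == p0))).
Proof.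
have [h0 h1 h2] := chi_bounds (z p0).
split=> //.
- by move=> v; have [] := chi_bounds (z p0 + v p0).
- by move=> p; rewrite normrMn; case: (p == p0); rewrite ?mulr0n// mulr1n ler_norml; lra.
- by move=> p p'; rewrite normrMn; case: (_ && _); rewrite ?mulr0n// mulr1n; lra.
- move=> v.
  have -> : lin (fun p => chi1 (z p0) *+ (p == p0)) v = chi1 (z p0) * v p0.
    rewrite /lin (bigD1 p0)//= eqxx mulr1n big1 ?addr0// => p pp0.
    by rewrite (negbTE pp0) mulr0n mul0r.
  have -> : quad (fun p p' => chi2 (z p0) *+ ((p == p0) && (p' == p0))) v = chi2 (z p0) * v p0 ^+ 2.
    rewrite /quad (bigD1 p0)//= [X in _ + X]big1 ?addr0.
      rewrite (bigD1 p0)//= eqxx mulr1n big1 ?addr0// => p pp0.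
      by rewrite (negbTE pp0) mulr0n mul0r.
    by move=> p pp0; rewrite big1// => p' _; rewrite (negbTE pp0) mulr0n mul0r.
  apply: le_trans (chi_taylor _ _) _; rewrite ler_wpM2l//.
  by apply: lerXn2r; rewrite ?nnegrE ?l1_ge0//; exact: l1_coord.
Qed.

(** [K] is chosen before [z]: the constant must not depend on the base point, since the replacement
    step integrates over it. [Inv] carries sign and support information on the coefficients through
    the induction, its second premise being the product rule. *)
Lemma taylor2_prod (Z I : Type) (s : seq I) (f : I -> Z -> (P -> R) -> R)
  (Inv : (P -> R) -> (P -> P -> R) -> Prop) :
  Inv (fun=> 0) (fun _ _ => 0) ->
  (forall c c' l l' q q', 0 <= c -> 0 <= c' -> Inv l q -> Inv l' q' ->
     Inv (fun p => c * l' p + c' * l p)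
         (fun p p' => c * q' p p' + c' * q p p' + l p * l' p')) ->
  (forall i, exists2 K, 1 <= K & forall z, exists c l q, taylor2 K (f i z) c l q /\ Inv l q) ->
  exists2 K, 1 <= K & forall z, exists c l q,
    taylor2 K (fun v => \prod_(i <- s) f i z v) c l q /\ Inv l q.
Proof.
move=> Inv0 InvM h; elim: s => [|i s [K K1 IH]].
  exists 1 => // z; exists 1, (fun=> 0), (fun _ _ => 0); split => //.
  have q0 v : quad (fun _ _ => 0) v = 0.
    by rewrite /quad big1// => p _; rewrite big1// => p' _; rewrite mul0r.
  have l0 v : lin (fun=> 0) v = 0 by rewrite /lin big1// => p _; rewrite mul0r.
  split.
  - by move=> v; rewrite big_nil ler01 lexx.
  - by rewrite ler01 lexx.
  - by move=> p; rewrite normr0.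
  - by move=> p p'; rewrite normr0.
  - by move=> v; rewrite big_nil q0 l0 !addr0 subrr normr0 mul1r exprn_ge0// l1_ge0.
have [K' K'1 hi] := h i.
pose M := Num.max K K'.
have MK : K <= M by rewrite le_max lexx.
have MK' : K' <= M by rewrite le_max lexx orbT.
exists (7 * M ^+ 2).
  by rewrite expr2; nra.
move=> z; have [c [l [q [t1 i1]]]] := hi z; have [c' [l' [q' [t2 i2]]]] := IH z.
have := taylor2_mul (le_trans K1 MK) (taylor2_le MK' t1) (taylor2_le MK t2).
move=> t; do 3 eexists; split.
  rewrite (_ : (fun v => _) = (fun v => f i z v * \prod_(j <- s) f j z v)); first exact: t.
  by apply/funext => v; rewrite big_cons.
by apply: InvM => //; [have /andP[] := t2c t1|have /andP[] := t2c t2].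
Qed.

End second_order.

Section gordon_functional.
Context {R : realType} (I J : finType).
Local Notation P := (I * J)%type.
Implicit Types (z v : P -> R).

(* A smoothed indicator of [forall x, exists y, 0 < z (x, y)]. *)
Definition minmax_above z : R := \prod_(x : I) (1 - \prod_(y : J) chi (z (x, y))).

(** Each factor 1 - prod chi is nondecreasing in its own row of variables, so mixed second-order
    coefficients between two rows are products of nonnegative first-order ones. Coefficients inside
    a row have no definite sign, but [D] vanishes there. For [D] the difference of the covariances,
    this is the infinitesimal form of Gordon's inequality. *)
Lemma minmax_above_taylor (D : P -> P -> R) :
  (forall p p', 0 <= D p p') -> (forall p p', p.1 = p'.1 -> D p p' = 0) ->
  exists2 K : R, 1 <= K & forall z, exists c l q,
    taylor2 K (fun v => minmax_above (fun p => z p + v p)) c l q /\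
    0 <= \sum_p \sum_p' q p p' * D p p'.
Proof.
move=> D0 Dx.
(* Invariant for the product over rows: nonnegative slopes make each new cross term l p * l' p'
   nonnegative. *)
pose Inv (l : P -> R) (q : P -> P -> R) :=
  (forall p, 0 <= l p) /\ 0 <= \sum_p \sum_p' q p p' * D p p'.
pose f (x : I) z v := 1 - \prod_(y : J) chi (z (x, y) + v (x, y)).
have := @taylor2_prod R P (P -> R) I (index_enum I) f Inv.
case.
- by split=> //; rewrite big1// => p _; rewrite big1// => p' _; rewrite mul0r.
- move=> c c' l l' q q' c0 c'0 [l0 q0] [l'0 q'0]; split.
    by move=> p; rewrite addr_ge0// mulr_ge0.
  rewrite (_ : \sum_p _ = c * (\sum_p \sum_p' q' p p' * D p p') +
    c' * (\sum_p \sum_p' q p p' * D p p') + \sum_p \sum_p' l p * l' p' * D p p').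
    rewrite !addr_ge0 ?mulr_ge0//; apply: sumr_ge0 => p _; apply: sumr_ge0 => p' _.
    by rewrite !mulr_ge0.
  rewrite !mulr_sumr -!big_split/=; apply: eq_bigr => p _.
  rewrite !mulr_sumr -!big_split/=; apply: eq_bigr => p' _; ring.
- move=> x.
  (* Invariant inside row [x], where the factors [chi] decrease: nonpositive slopes, and all
     coefficients supported on that row. *)
  pose Inv1 (l : P -> R) (q : P -> P -> R) := [/\ forall p, l p <= 0,
    forall p, p.1 != x -> l p = 0 &
    forall p p', ~~ ((p.1 == x) && (p'.1 == x)) -> q p p' = 0].
  have := @taylor2_prod R P (P -> R) J (index_enum J)
    (fun y z v => chi (z (x, y) + v (x, y))) Inv1.
  case.
  + by split.
  + move=> c c' l l' q q' c0 c'0 [l0 lx qx] [l'0 l'x q'x]; split.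
    * by move=> p; have := mulr_ge0_le0 c0 (l'0 p); have := mulr_ge0_le0 c'0 (l0 p); lra.
    * by move=> p px; rewrite lx// l'x// !mulr0 addr0.
    * move=> p p' pp'; rewrite qx// q'x// !mulr0 !add0r.
      by move: pp'; rewrite negb_and => /orP[/lx ->|/l'x ->]; rewrite ?mul0r ?mulr0.
  + move=> y; exists 2; first by lra.
    move=> z; do 3 eexists; split; first exact: (taylor2_chi z (x, y)).
    have [_ h1 _] := chi_bounds (z (x, y)).
    split.
    * by move=> p; case: eqP => _; rewrite ?mulr1n ?mulr0n//; lra.
    * move=> p px; case: eqP => [pE|]; last by rewrite mulr0n.
      by rewrite pE eqxx in px.
    * move=> p p' pp'; case: eqP => [pE|_]; last by rewrite mulr0n.
      case: eqP => [pE'|_]; last by rewrite mulr0n.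
      by rewrite pE pE' eqxx in pp'.
  + move=> K K1 h; exists K => // z; have [c [l [q [t [l0 lx qx]]]]] := h z.
    do 3 eexists; split; first exact: taylor2_onem t.
    split; first by move=> p; rewrite oppr_ge0.
    rewrite big1// => p _; rewrite big1// => p' _.
    have [/andP[/eqP px /eqP p'x]|pp'] := boolP ((p.1 == x) && (p'.1 == x)).
      by rewrite Dx ?mulr0// px p'x.
    by rewrite qx// oppr0 mul0r.
- move=> K K1 h; exists K => // z; have [c [l [q [t [_ q0]]]]] := h z.
  by exists c, l, q.
Qed.

Lemma minmax_above_bounds z : 0 <= minmax_above z <= 1.
Proof.
have h x : 0 <= 1 - \prod_(y : J) chi (z (x, y)) <= 1.
  have : 0 <= \prod_(y : J) chi (z (x, y)) <= 1.
    apply/andP; split; first by apply: prodr_ge0 => y _; have [/andP[]] := chi_bounds (z (x, y)).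
    by apply: prodr_ile1 => y _; have [] := chi_bounds (z (x, y)).
  lra.
apply/andP; split; first by apply: prodr_ge0 => x _; case/andP: (h x).
by apply: prodr_ile1 => x _.
Qed.

Lemma measurable_minmax_above d (T : measurableType d) (Z : P -> T -> R) :
  (forall p, measurable_fun setT (Z p)) ->
  measurable_fun setT (fun w => minmax_above (fun p => Z p w)).
Proof.
move=> mZ; apply: measurable_prod => x _; apply: measurable_funB => //.
apply: measurable_prod => y _; apply: measurableT_comp => //; exact: measurable_chi.
Qed.

End gordon_functional.

(** * The effect of one small Gaussian increment *)

Section gaussian_step.
Context {R : realType} (P : finType).

Definition lmap n (L : P -> 'I_n -> R) (s : n.-tuple R) (p : P) : R :=
  \sum_k L p k * tnth s k.

Lemma measurable_lmap n (L : P -> 'I_n -> R) p : measurable_fun setT (lmap L ^~ p).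
Proof.
apply: measurable_sum => k; apply: measurable_funM => //; exact: measurable_tnth.
Qed.

Definition cov n (L : P -> 'I_n -> R) p p' : R := \sum_k L p k * L p' k.

(** Linear and off-diagonal terms have mean zero, so only the trace of [b] survives. Applied to an
    expansion along [lmap L], this trace is the pairing of [q] with [cov L]. *)
Lemma integral_quadratic n (c : R) (a : 'I_n -> R) (b : 'I_n -> 'I_n -> R) :
  (gaussN n).-integrable setT (fun s => (c + \sum_k a k * tnth s k +
     \sum_k \sum_k' b k k' * (tnth s k * tnth s k'))%:E) /\
  (\int[gaussN n]_s (c + \sum_k a k * tnth s k +
     \sum_k \sum_k' b k k' * (tnth s k * tnth s k'))%:E =
   (c + sigma2 * \sum_k b k k)%:E)%E.
Proof.
have ic : (gaussN n).-integrable setT (EFin \o cst c).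
  exact: finite_measure_integrable_cst.
have i1 k : (gaussN n).-integrable setT (fun s => (a k)%:E * (tnth s k)%:E)%E.
  by apply: integrableZl => //; exact: integrable_tnth.
have i2 k k' : (gaussN n).-integrable setT (fun s => (b k k')%:E * (tnth s k * tnth s k')%:E)%E.
  by apply: integrableZl => //; exact: integrable_tnthM.
have iS1 : (gaussN n).-integrable setT (fun s => \sum_k (a k)%:E * (tnth s k)%:E)%E.
  exact: integrable_sum.
have iS2k k : (gaussN n).-integrable setT (fun s => \sum_k' (b k k')%:E * (tnth s k * tnth s k')%:E)%E.
  exact: integrable_sum.
have iS2 : (gaussN n).-integrable setT (fun s => \sum_k \sum_k' (b k k')%:E * (tnth s k * tnth s k')%:E)%E.
  exact: integrable_sum.
have E s : ((c + \sum_k a k * tnth s k + \sum_k \sum_k' b k k' * (tnth s k * tnth s k'))%:E =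
   (cst c s)%:E + (\sum_k (a k)%:E * (tnth s k)%:E) +
   \sum_k \sum_k' (b k k')%:E * (tnth s k * tnth s k')%:E)%E.
  rewrite !EFinD -!sumEFin; congr (_ + _ + _)%E.
  by apply: eq_bigr => k _; rewrite -sumEFin.
split.
  under eq_fun do rewrite E.
  by apply: integrableD => //; apply: integrableD.
under eq_integral do rewrite E.
rewrite integralD//; last by apply: integrableD.
have Ec : (\int[@gaussN R n]_s (cst c s)%:E = c%:E)%E.
  rewrite -[LHS]/(\int[@gaussN R n]_s cst c%:E s)%E integral_cst//.
  by rewrite [X in (_ * X)%E]probability_setT mule1.
rewrite integralD// Ec !integral_sum//.
rewrite big1 ?adde0; last first.
  by move=> k _; rewrite integralZl ?integral_tnth ?mule0//; exact: integrable_tnth.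
rewrite EFinD; congr (_ + _)%E; rewrite mulr_sumr -sumEFin; apply: eq_bigr => k _.
rewrite integral_sum//.
transitivity (\sum_k' (b k k' * (sigma2 *+ (k == k')))%:E)%E.
  apply: eq_bigr => k' _; rewrite integralZl//; last exact: integrable_tnthM.
  by rewrite integral_tnthM -EFinM.
rewrite (bigD1 k)//= eqxx mulr1n big1 ?adde0 1?mulrC// => k' k'k.
by rewrite eq_sym (negbTE k'k) mulr0n mulr0.
Qed.

(** [M] depends on [L] alone, through the sum of its absolute coefficients and the moment of
    [integral_expR_nrm1]. All dependence on the function and its base point is in [K]. *)
Lemma gaussian_step n (L : P -> 'I_n -> R) : exists2 M : R, 0 <= M &
  forall K f c l q h, 0 <= K -> 0 <= h -> taylor2 K f c l q ->
  measurable_fun setT (fun s => f (fun p => h * lmap L s p)) ->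
  `|fine (\int[gaussN n]_s (f (fun p => h * lmap L s p))%:E) -
    (c + h ^+ 2 * sigma2 * \sum_p \sum_p' q p p' * cov L p p')| <= K * M * h ^+ 3.
Proof.
have [M0 hM0] := integral_expR_nrm1 (R := R) n.
pose Lam : R := \sum_p \sum_k `|L p k|.
have Lam0 : 0 <= Lam by apply: sumr_ge0 => p _; apply: sumr_ge0.
have l1lmap s : l1 (lmap L s) <= Lam * nrm1 s.
  rewrite /l1 /Lam mulr_suml; apply: ler_sum => p _.
  rewrite (le_trans (ler_norm_sum _ _ _))// mulr_suml; apply: ler_sum => k _.
  by rewrite normrM ler_wpM2l// nrm1_tnth.
have M00 : 0 <= M0.
  by rewrite -lee_fin (le_trans _ hM0)//; apply: integral_ge0 => s _; rewrite lee_fin expR_ge0.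
exists (6 * Lam ^+ 3 * M0); first by rewrite !mulr_ge0// exprn_ge0.
move=> K f c l q h K0 h0 t mf.
pose a k := h * \sum_p l p * L p k.
pose b k k' := h ^+ 2 * \sum_p \sum_p' q p p' * (L p k * L p' k').
have [ip Ep] := integral_quadratic c a b.
pose poly s := c + \sum_k a k * tnth s k + \sum_k \sum_k' b k k' * (tnth s k * tnth s k').
have polyE s : poly s = c + lin l (fun p => h * lmap L s p) + quad q (fun p => h * lmap L s p).
  rewrite /poly; congr (_ + _ + _).
    rewrite /lin /a; under eq_bigr do rewrite mulr_sumr mulr_suml.
    rewrite exchange_big/=; apply: eq_bigr => p _; rewrite /lmap !mulr_sumr.
    by apply: eq_bigr => k _; ring.
  rewrite /quad /b.
  under eq_bigr do under eq_bigr do rewrite mulr_sumr mulr_suml.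
  under eq_bigr do rewrite exchange_big/=.
  rewrite exchange_big/=; apply: eq_bigr => p _.
  under eq_bigr do under eq_bigr do rewrite mulr_sumr mulr_suml.
  under eq_bigr do rewrite exchange_big/=.
  rewrite exchange_big/=; apply: eq_bigr => p' _.
  rewrite /lmap (_ : _ * _ = q p p' * h ^+ 2 * ((\sum_k L p k * tnth s k) * (\sum_k L p' k * tnth s k))); last by ring.
  rewrite mulr_suml mulr_sumr; apply: eq_bigr => k _; rewrite !mulr_sumr.
  by apply: eq_bigr => k' _; ring.
have trE : \sum_k b k k = h ^+ 2 * \sum_p \sum_p' q p p' * cov L p p'.
  rewrite /b -mulr_sumr; congr (_ * _); rewrite exchange_big/=; apply: eq_bigr => p _.
  by rewrite exchange_big/=; apply: eq_bigr => p' _; rewrite /cov mulr_sumr.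
have rem s : `|f (fun p => h * lmap L s p) - poly s| <= 6 * Lam ^+ 3 * K * h ^+ 3 * expR (nrm1 s).
  rewrite polyE; apply: le_trans (t2r t _) _.
  have -> : l1 (fun p => h * lmap L s p) = h * l1 (lmap L s).
    by rewrite /l1 mulr_sumr; apply: eq_bigr => p _; rewrite normrM ger0_norm.
  have [_ _ _ e3] := nrm1_pow_le s.
  apply: (@le_trans _ _ (K * (h * (Lam * nrm1 s)) ^+ 3)).
    rewrite ler_wpM2l//; apply: lerXn2r; rewrite ?nnegrE ?mulr_ge0 ?l1_ge0 ?nrm1_ge0//.
    by rewrite ler_wpM2l.
  rewrite !exprMn (_ : K * _ = Lam ^+ 3 * K * h ^+ 3 * nrm1 s ^+ 3); last by ring.
  rewrite (_ : 6 * _ * K * _ * _ = Lam ^+ 3 * K * h ^+ 3 * (6 * expR (nrm1 s))); last by ring.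
  by rewrite ler_wpM2l// !mulr_ge0// exprn_ge0.
have if_ : (gaussN n).-integrable setT (EFin \o (fun s => f (fun p => h * lmap L s p))).
  apply: (@integrable_expR_dom _ _ _ 1) => // s; rewrite mul1r.
  have /andP[f0 f1] := t2f t (fun p => h * lmap L s p).
  by rewrite ger0_norm// (le_trans f1)//; have [] := nrm1_pow_le s.
have -> : c + h ^+ 2 * sigma2 * \sum_p \sum_p' q p p' * cov L p p' =
    fine (\int[gaussN n]_s (poly s)%:E).
  by rewrite Ep /= trE; ring.
rewrite -fineB; [|exact: integrable_fin_num|exact: integrable_fin_num].
rewrite -integralB_EFin//.
have idiff : (gaussN n).-integrable setT (fun s => (f (fun p => h * lmap L s p))%:E - (poly s)%:E)%E.
  exact: integrableB.
rewrite -fine_abse; last exact: integrable_fin_num.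
rewrite -lee_fin fineK; last by rewrite fin_num_abs abse_id -fin_num_abs; exact: integrable_fin_num.
apply: (le_trans (le_abse_integral _ measurableT (measurable_int _ idiff))).
apply: (@le_trans _ _ (\int[gaussN n]_s ((6 * Lam ^+ 3 * K * h ^+ 3)%:E * (expR (nrm1 s))%:E))%E).
  apply: ge0_le_integral => //.
  - exact: (measurableT_comp (@abse_measurable R setT) (measurable_int (gaussN n) idiff)).
  - apply: emeasurable_funM => //; apply/measurable_EFinP; apply: measurableT_comp => //.
    exact: measurable_nrm1.
  - by move=> s _; rewrite -EFinB -EFinM lee_fin.
rewrite ge0_integralZl//; last 2 first.
- by apply/measurable_EFinP; apply: measurableT_comp => //; exact: measurable_nrm1.
- by rewrite lee_fin !mulr_ge0 ?exprn_ge0.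
apply: (@le_trans _ _ ((6 * Lam ^+ 3 * K * h ^+ 3)%:E * M0%:E)%E).
  by apply: lee_wpmul2l => //; rewrite lee_fin !mulr_ge0 ?exprn_ge0.
by rewrite -EFinM lee_fin le_eqVlt; apply/orP; left; apply/eqP; ring.
Qed.

End gaussian_step.

(** * Interpolation between the two processes *)

Section comparison.
Context {R : realType} (I J : finType).
Local Notation P := (I * J)%type.
Variables (n1 n2 : nat) (L1 : P -> 'I_n1 -> R) (L2 : P -> 'I_n2 -> R) (z0 : P -> R).
Hypothesis cov_le : forall p p', cov L2 p p' <= cov L1 p p'.
Hypothesis cov_eq : forall p p', p.1 = p'.1 -> cov L1 p p' = cov L2 p p'.

Let F (z : P -> R) : \bar R := (minmax_above z)%:E.

Let F0 z : (0 <= F z)%E.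
Proof. by rewrite lee_fin; have /andP[] := minmax_above_bounds z. Qed.

Let mF d (T : measurableType d) (Z : T -> P -> R) :
  (forall p, measurable_fun setT (Z ^~ p)) -> measurable_fun setT (fun w => F (Z w)).
Proof. by move=> mZ; apply/measurable_EFinP; exact: (measurable_minmax_above mZ). Qed.

Let mlm n (L : P -> 'I_n -> R) d (T : measurableType d) (X : T -> n.-tuple R) p :
  measurable_fun setT X -> measurable_fun setT (fun w => lmap L (X w) p).
Proof. by move=> mX; exact: (measurableT_comp (measurable_lmap L p) mX). Qed.

Let V n (L : P -> 'I_n -> R) h (z : P -> R) :=
  (\int[gaussN n]_s F (fun p => (z p + h * lmap L s p)%R))%E.

Let V0 n (L : P -> 'I_n -> R) h z : (0 <= V L h z)%E.
Proof. exact: integral_ge0. Qed.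

Let V1 n (L : P -> 'I_n -> R) h z : (V L h z <= 1)%E.
Proof.
apply: (@le_trans _ _ (\int[gaussN n]_s cst 1%E s)%E).
  apply: ge0_le_integral => //.
    apply: (mF (Z := fun s p => z p + h * lmap L s p)) => p.
    by apply: measurable_funD => //; apply: measurable_funM => //; exact: mlm.
  by move=> s _; rewrite lee_fin; have /andP[] := minmax_above_bounds (fun p => z p + h * lmap L s p).
by rewrite integral_cst// mul1e probability_le1.
Qed.

Let mV n (L : P -> 'I_n -> R) h d (T : measurableType d) (Z : T -> P -> R) :
  (forall p, measurable_fun setT (Z ^~ p)) -> measurable_fun setT (fun w => V L h (Z w)).
Proof.
move=> mZ.
apply: (@measurable_fun_fubini_tonelli_F _ _ _ _ _ (gaussN n)
  (fun u : T * n.-tuple R => F (fun p => Z u.1 p + h * lmap L u.2 p))) => //.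
apply: (mF (Z := fun (u : T * n.-tuple R) p => Z u.1 p + h * lmap L u.2 p)) => p.
apply: measurable_funD; first exact: (measurableT_comp (mZ p)).
by apply: measurable_funM => //; exact: mlm.
Qed.

(** Both averages are expanded at the same point with the same coefficients: the constants cancel,
    the terms in h^2 are ordered by [minmax_above_taylor], and only the cubic remainders are
    left. *)
Let V_step : exists2 C : R, 0 <= C & forall h z, 0 <= h ->
  (V L2 h z <= V L1 h z + (C * h ^+ 3)%:E)%E.
Proof.
have := @minmax_above_taylor R I J (fun p p' => cov L1 p p' - cov L2 p p').
case.
- by move=> p p'; rewrite subr_ge0.
- by move=> p p' pp'; rewrite cov_eq// subrr.
move=> K K1 hK; have K0 : 0 <= K by lra.
have [M1 M10 h1] := gaussian_step L1; have [M2 M20 h2] := gaussian_step L2.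
exists (K * M1 + K * M2); first by rewrite addr_ge0// mulr_ge0.
move=> h z h0; have [c [l [q [t q0]]]] := hK z.
have m n (L : P -> 'I_n -> R) : measurable_fun setT
    (fun s => minmax_above (fun p => z p + h * lmap L s p)).
  apply: (measurable_minmax_above (Z := fun p s => z p + h * lmap L s p)) => p.
  by apply: measurable_funD => //; apply: measurable_funM => //; exact: mlm.
have b1 : `|fine (V L1 h z) - (c + h ^+ 2 * sigma2 * \sum_p \sum_p' q p p' * cov L1 p p')| <=
  K * M1 * h ^+ 3 := h1 _ _ _ _ _ _ K0 h0 t (m _ _).
have b2 : `|fine (V L2 h z) - (c + h ^+ 2 * sigma2 * \sum_p \sum_p' q p p' * cov L2 p p')| <=
  K * M2 * h ^+ 3 := h2 _ _ _ _ _ _ K0 h0 t (m _ _).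
have fV n (L : P -> 'I_n -> R) : V L h z \is a fin_num.
  by rewrite ge0_fin_numE ?V0// (le_lt_trans (V1 _ _ _))// ltry.
rewrite -(fineK (fV _ L1)) -(fineK (fV _ L2)) -EFinD lee_fin.
move: b1 b2; rewrite !ler_norml => /andP[a1 _] /andP[_ a2].
have : \sum_p \sum_p' q p p' * cov L2 p p' <= \sum_p \sum_p' q p p' * cov L1 p p'.
  rewrite -subr_ge0 -sumrB (eq_bigr (fun p => \sum_p' q p p' * (cov L1 p p' - cov L2 p p')))//.
  by move=> p _; rewrite -sumrB; apply: eq_bigr => p' _; rewrite mulrBr.
have s0 : 0 <= h ^+ 2 * sigma2 :> R by rewrite mulr_ge0 ?sqr_ge0 ?sigma2_ge0.
by move/(ler_wpM2l s0) => a3; rewrite (mulrDl (K * M1)); lra.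
Qed.

Let Z a b (x : n1.-tuple R) (y : n2.-tuple R) p := z0 p + a * lmap L1 x p + b * lmap L2 y p.

Let mZ a b d (T : measurableType d) (X : T -> n1.-tuple R) (Y : T -> n2.-tuple R) p :
  measurable_fun setT X -> measurable_fun setT Y ->
  measurable_fun setT (fun w => Z a b (X w) (Y w) p).
Proof.
move=> mX mY; apply: measurable_funD; last by apply: measurable_funM => //; exact: mlm.
by apply: measurable_funD => //; apply: measurable_funM => //; exact: mlm.
Qed.

(** [U 0 1] belongs to the process [L2] and [U 1 0] to [L1]; the interpolation keeps a^2 + b^2 =
    1. *)
Let U a b := (\int[gaussN n1]_x \int[gaussN n2]_y F (Z a b x y))%E.

Let lmap_tlin n (L : P -> 'I_n -> R) c s x y p :
  lmap L (tlin c s x y) p = c * lmap L x p + s * lmap L y p.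
Proof.
rewrite /lmap !mulr_sumr -big_split/=; apply: eq_bigr => k _.
by rewrite tnth_mktuple; ring.
Qed.

Let rotate_coef (a h : R) : 0 < h ->
  [/\ 0 < Num.sqrt (a ^+ 2 + h ^+ 2), 0 < h / Num.sqrt (a ^+ 2 + h ^+ 2) &
   (a / Num.sqrt (a ^+ 2 + h ^+ 2)) ^+ 2 + (h / Num.sqrt (a ^+ 2 + h ^+ 2)) ^+ 2 = 1].
Proof.
move=> h0; have p0 : 0 < a ^+ 2 + h ^+ 2 by rewrite ltr_wpDl ?sqr_ge0// exprn_gt0.
have r0 : 0 < Num.sqrt (a ^+ 2 + h ^+ 2) by rewrite sqrtr_gt0.
split=> //; first by rewrite divr_gt0.
by rewrite !expr_div_n -mulrDl sqr_sqrtr ?divff// ?gt_eqF// ltW.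
Qed.

(* Moving variance h^2 from the first process to the second costs O(h^3); with n = h^(-2) steps
   the total error is O(n^(-1/2)). *)
Let U_step : exists2 C : R, 0 <= C & forall a b h, 0 < h ->
  (U a (Num.sqrt (b ^+ 2 + h ^+ 2)) <= U (Num.sqrt (a ^+ 2 + h ^+ 2)) b + (C * h ^+ 3)%:E)%E.
Proof.
have [C C0 hC] := V_step; exists C => // a b h h0.
(* By rotation invariance a Gaussian vector of scale sqrt (b^2 + h^2) is the sum of independent ones
   of scales b and h. *)
have -> : U a (Num.sqrt (b ^+ 2 + h ^+ 2)) =
    (\int[gaussN n1]_x \int[gaussN n2]_y V L2 h (Z a b x y))%E.
  apply: eq_integral => x _; have [r0 s0 cs] := rotate_coef b h0.
  have mg : measurable_fun setT (fun y => F (Z a (Num.sqrt (b ^+ 2 + h ^+ 2)) x y)).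
    by apply: mF => p; apply: mZ.
  have E := gaussN_rotate s0 cs mg (fun _ => F0 _).
  apply: etrans (esym E) _.
  apply: eq_integral => y _; apply: eq_integral => y' _; congr F.
  apply/funext => p; rewrite /Z lmap_tlin.
  by field; rewrite gt_eqF.
(* The same splitting for the other process, whose variable is the outer one; Tonelli first brings
   it inside. *)
have -> : U (Num.sqrt (a ^+ 2 + h ^+ 2)) b =
    (\int[gaussN n1]_x \int[gaussN n2]_y V L1 h (Z a b x y))%E.
  have mU : measurable_fun setT (fun v : n1.-tuple R * n2.-tuple R =>
      F (Z (Num.sqrt (a ^+ 2 + h ^+ 2)) b v.1 v.2)) by apply: mF => p; apply: mZ.
  have mVU : measurable_fun setT (fun v : n1.-tuple R * n2.-tuple R =>
      V L1 h (Z a b v.1 v.2)) by apply: mV => p; apply: mZ.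
  have E1 := @fubini_tonelli _ _ _ _ R (gaussN n1) (gaussN n2) _ mU (fun _ => F0 _).
  have E2 := @fubini_tonelli _ _ _ _ R (gaussN n1) (gaussN n2) _ mVU (fun _ => V0 _ _ _).
  apply: etrans E1 _; apply: etrans (esym E2).
  apply: eq_integral => y _; have [r0 s0 cs] := rotate_coef a h0.
  have mg : measurable_fun setT (fun x => F (Z (Num.sqrt (a ^+ 2 + h ^+ 2)) b x y)).
    by apply: mF => p; apply: mZ.
  have E := gaussN_rotate s0 cs mg (fun _ => F0 _).
  apply: etrans (esym E) _.
  apply: eq_integral => x _; apply: eq_integral => x' _; congr F.
  apply/funext => p; rewrite /Z lmap_tlin.
  by field; rewrite gt_eqF.
have e0 : 0 <= C * h ^+ 3 by rewrite mulr_ge0// exprn_ge0// ltW.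
apply: (@le_trans _ _ (\int[gaussN n1]_x \int[gaussN n2]_y (V L1 h (Z a b x y) + cst (C * h ^+ 3)%:E y))%E).
  have m n (L : P -> 'I_n -> R) : measurable_fun setT
     (fun u : n1.-tuple R * n2.-tuple R => V L h (Z a b u.1 u.2)).
    by apply: mV => p; apply: mZ.
  have m' : measurable_fun setT
     (fun u : n1.-tuple R * n2.-tuple R => V L1 h (Z a b u.1 u.2) + cst (C * h ^+ 3)%:E u.2)%E.
    exact: emeasurable_funD.
  apply: ge0_le_integral => //.
  - by move=> x _; apply: integral_ge0.
  - exact: (@measurable_fun_fubini_tonelli_F _ _ _ _ _ (gaussN n2) _ (m _ L2)).
  - apply: (@measurable_fun_fubini_tonelli_F _ _ _ _ _ (gaussN n2) _ m') => u.
    by rewrite adde_ge0// lee_fin.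
  - move=> x _; apply: ge0_le_integral => //.
    + exact: (measurableT_comp (m _ L2) (pair1_measurable x)).
    + exact: (measurableT_comp m' (pair1_measurable x)).
    + by move=> y _; apply: hC; exact: ltW.
have -> : (\int[gaussN n1]_x \int[gaussN n2]_y (V L1 h (Z a b x y) + cst (C * h ^+ 3)%:E y) =
   \int[gaussN n1]_x (\int[gaussN n2]_y V L1 h (Z a b x y) + cst (C * h ^+ 3)%:E x))%E.
  apply: eq_integral => x _; rewrite ge0_integralD//; last first.
    by apply: mV => p; apply: mZ.
  by rewrite integral_cst// [X in (_ * X)%E]probability_setT mule1.
rewrite ge0_integralD//; last 2 first.
- by move=> x _; apply: integral_ge0.
- apply: (@measurable_fun_fubini_tonelli_F _ _ _ _ _ (gaussN n2)
    (fun u : n1.-tuple R * n2.-tuple R => V L1 h (Z a b u.1 u.2))) => //.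
  by apply: mV => p; apply: mZ.
by rewrite integral_cst// [X in (_ * X)%E]probability_setT mule1.
Qed.

Lemma gaussian_comparison :
  (\int[gaussN n2]_y (minmax_above (fun p => z0 p + lmap L2 y p))%:E <=
   \int[gaussN n1]_x (minmax_above (fun p => z0 p + lmap L1 x p))%:E)%E.
Proof.
have -> : (\int[gaussN n2]_y (minmax_above (fun p => z0 p + lmap L2 y p)%R)%:E)%E = U 0 1.
  rewrite /U; under [RHS]eq_integral.
    move=> x _.
    have -> : (\int[gaussN n2]_y F (Z 0 1 x y) =
      \int[gaussN n2]_y (minmax_above (fun p => z0 p + lmap L2 y p)%R)%:E)%E.
      apply: eq_integral => y _; congr F; apply/funext => p.
      by rewrite /Z mul0r addr0 mul1r.
    over.
  by rewrite integral_cst// [X in (_ * X)%E]probability_setT mule1.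
have -> : (\int[gaussN n1]_x (minmax_above (fun p => z0 p + lmap L1 x p)%R)%:E)%E = U 1 0.
  rewrite /U; apply: eq_integral => x _.
  under [RHS]eq_integral.
    move=> y _.
    have -> : F (Z 1 0 x y) = F (fun p => z0 p + lmap L1 x p).
      by congr F; apply/funext => p; rewrite /Z mul0r addr0 mul1r.
    over.
  by rewrite integral_cst// [X in (_ * X)%E]probability_setT mule1.
have [C C0] := U_step; generalize U => W hC.
have h n : (W 0%R 1%R <= W 1%R 0%R + (C / Num.sqrt n.+1%:R)%:E)%E.
  pose hh : R := (Num.sqrt n.+1%:R)^-1.
  have hh0 : 0 < hh by rewrite invr_gt0 sqrtr_gt0 ltr0n.
  have hh2 : hh ^+ 2 = n.+1%:R^-1 by rewrite exprVn sqr_sqrtr// ler0n.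
  (* After k exchanges the process [L1] has variance weight k / (n + 1), and [L2] has the rest. *)
  pose s k : R := Num.sqrt (k%:R * hh ^+ 2).
  have sS k : Num.sqrt (s k ^+ 2 + hh ^+ 2) = s k.+1.
    rewrite {1}/s sqr_sqrtr; last by rewrite mulr_ge0 ?ler0n ?sqr_ge0.
    by rewrite /s -(addn1 k) natrD mulrDl mul1r.
  have H k : (k <= n.+1)%N -> (W 0%R 1%R <= W (s k) (s (n.+1 - k)%N) + (k%:R * (C * hh ^+ 3))%:E)%E.
    elim: k => [_|k IH kn].
      rewrite mul0r adde0 subn0 {1}/s mul0r sqrtr0 /s hh2 divff ?pnatr_eq0// sqrtr1; exact: lexx.
    apply: (le_trans (IH (ltnW kn))).
    have := hC (s k) (s (n.+1 - k.+1)%N) hh hh0; rewrite !sS -subSn// subSS => hk.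
    apply: (le_trans (leeD2r _ hk)).
    by rewrite -addeA -EFinD leeD2l// lee_fin -(addn1 k) natrD mulrDl mul1r addrC.
  have := H n.+1 (leqnn _); rewrite subnn.
  have -> : s n.+1 = 1 by rewrite /s hh2 divff ?pnatr_eq0// sqrtr1.
  have -> : s 0%N = 0 by rewrite /s mul0r sqrtr0.
  rewrite (_ : n.+1%:R * (C * hh ^+ 3) = C * hh)//.
  have n0 : n.+1%:R != 0 :> R by rewrite pnatr_eq0.
  by rewrite exprS hh2 mulrCA [n.+1%:R * _]mulrCA divff// mulr1.
apply/lee_addgt0Pr => e e0.
(* Then n + 1 exceeds (C / e)^2, so the accumulated error C / sqrt (n + 1) is at most e. *)
pose n := Num.truncn ((C / e) ^+ 2).
apply: (le_trans (h n)); rewrite leeD2l// lee_fin.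
rewrite ler_pdivrMr ?sqrtr_gt0 ?ltr0n// mulrC -ler_pdivrMr//.
rewrite -[leLHS]ger0_norm ?divr_ge0 ?(ltW e0)// -sqrtr_sqr ler_wsqrtr// ltW//.
exact: truncnS_gt.
Qed.

End comparison.

Lemma measurable_exists_forall {R : realType} d (T : measurableType d) (I J : finType)
  (Z : I -> J -> T -> R) (Q : set R) :
  measurable Q -> (forall x y, measurable_fun setT (Z x y)) ->
  measurable [set w | exists x, forall y, Q (Z x y w)].
Proof.
move=> mQ mZ.
rewrite (_ : [set _ | _] = \bigcup_(x in [set: I]) \bigcap_(y in [set: J]) (Z x y @^-1` Q)).
  apply: fin_bigcup_measurable => // x _; apply: fin_bigcap_measurable => // y _.
  by rewrite -[X in measurable X]setTI; exact: mZ.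
apply/seteqP; split => w /=.
  by move=> [x h]; exists x => // y _; exact: h.
by move=> [x _ h]; exists x => y; exact: h.
Qed.

Section comparison_of_events.
Context {R : realType} (I J : finType) (n1 n2 : nat).
Variables (L1 : I * J -> 'I_n1 -> R) (L2 : I * J -> 'I_n2 -> R).
Hypothesis cov_le : forall p p', cov L2 p p' <= cov L1 p p'.
Hypothesis cov_eq : forall p p', p.1 = p'.1 -> cov L1 p p' = cov L2 p p'.

(** [chi] falls from 1 to 0 over an interval of length 3, so the scaling [beta] = 3 / [delta] fits
    the smoothed indicator between the thresholds c and c + delta. *)
Lemma comparison_events (c delta : R) : 0 < delta ->
  (gaussN n1 [set t | exists x, forall y, (lmap L1 t (x, y) <= c)%R] <=
   gaussN n2 [set t | exists x, forall y, (lmap L2 t (x, y) < c + delta)%R])%E.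
Proof.
move=> d0; pose beta := 3 / delta; pose z0 := fun _ : I * J => - beta * c.
have b0 : 0 < beta by rewrite divr_gt0.
set EX := [set _ | _]; set EY := [set _ | _].
have mEX : measurable EX.
  by apply: (@measurable_exists_forall _ _ _ I J (fun x y t => lmap L1 t (x, y)) `]-oo, c]%classic) => // x y; exact: measurable_lmap.
have mEY : measurable EY.
  by apply: (@measurable_exists_forall _ _ _ I J (fun x y t => lmap L2 t (x, y)) `]-oo, (c + delta)[%classic) => // x y; exact: measurable_lmap.
have covZ n (L : I * J -> 'I_n -> R) p p' :
    cov (fun p k => beta * L p k) p p' = beta ^+ 2 * cov L p p'.
  by rewrite /cov mulr_sumr; apply: eq_bigr => k _; ring.
have lmapZ n (L : I * J -> 'I_n -> R) t p :
    lmap (fun p k => beta * L p k) t p = beta * lmap L t p.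
  by rewrite /lmap mulr_sumr; apply: eq_bigr => k _; rewrite mulrA.
have h1 p p' : cov (fun p k => beta * L2 p k) p p' <= cov (fun p k => beta * L1 p k) p p'.
  by rewrite !covZ ler_wpM2l ?sqr_ge0.
have h2 p p' : p.1 = p'.1 ->
    cov (fun p k => beta * L1 p k) p p' = cov (fun p k => beta * L2 p k) p p'.
  by move=> pp'; rewrite !covZ cov_eq.
have H := gaussian_comparison z0 h1 h2.
(* [minmax_above] smooths an event of the form forall-exists, hence the passage to complements. *)
rewrite -leeN2 -(leeD2lE (x := 1%E))// -!probability_setC//.
have chiE (v : R) : - beta * c + beta * v = beta * (v - c) by ring.
apply: le_trans (le_trans H _).
  have -> : gaussN n2 (~` EY) = (\int[gaussN n2]_t (\1_(~` EY) t)%:E)%E.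
    by rewrite integral_indic ?setIT//; exact: measurableC.
  apply: ge0_le_integral => //.
  - by apply/measurable_EFinP/measurable_indic/measurableC.
  - apply/measurable_EFinP; apply: (measurable_minmax_above (Z := fun p t => z0 p + lmap (fun p k => beta * L2 p k) t p)) => p.
    by apply: measurable_funD => //; exact: measurable_lmap.
  move=> t _; rewrite lee_fin indicE; case: (boolP (t \in _)) => tE; last first.
    by have /andP[] := minmax_above_bounds (fun p => z0 p + lmap (fun p k => beta * L2 p k) t p).
  rewrite /minmax_above big1// => x _.
  have [y hy] : exists y, c + delta <= lmap L2 t (x, y).
    apply: contrapT => h; move: tE; rewrite inE => -[]; exists x => y.
    by rewrite ltNge; apply/negP => hh; apply: h; exists y.
  rewrite (bigD1 y)//= /z0 lmapZ chiE chi_ge3 ?mul0r ?subr0//.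
  by rewrite /beta mulrAC ler_pdivlMr// ler_pM2l//; lra.
have -> : gaussN n1 (~` EX) = (\int[gaussN n1]_t (\1_(~` EX) t)%:E)%E.
  by rewrite integral_indic ?setIT//; exact: measurableC.
apply: ge0_le_integral => //.
- by move=> t _; rewrite lee_fin; have /andP[] := minmax_above_bounds (fun p => z0 p + lmap (fun p k => beta * L1 p k) t p).
- apply/measurable_EFinP; apply: (measurable_minmax_above (Z := fun p t => z0 p + lmap (fun p k => beta * L1 p k) t p)) => p.
  by apply: measurable_funD => //; exact: measurable_lmap.
- by apply/measurable_EFinP/measurable_indic/measurableC.
move=> t _; rewrite lee_fin indicE; case: (boolP (t \in _)) => tE.
  by have /andP[] := minmax_above_bounds (fun p => z0 p + lmap (fun p k => beta * L1 p k) t p).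
have [x hx] : EX t by apply: contrapT => h; move/negP: tE; apply; rewrite inE.
rewrite /minmax_above (bigD1 x)//= big1 ?subrr ?mul0r// => y _.
rewrite /z0 lmapZ chiE chi_le0//.
by rewrite pmulr_rle0// subr_le0; exact: hx.
Qed.

End comparison_of_events.

Section gaussian_matrix.
Context {R : realType} (m N : nat).

Definition entry (s : #|{: 'I_m * 'I_N}|.-tuple R) (i : 'I_m) (j : 'I_N) : R :=
  tnth s (enum_rank (i, j)).

Lemma measurable_entry i j : measurable_fun setT (fun s => entry s i j).
Proof. exact: measurable_tnth. Qed.

Definition apply_mx s (x : 'I_N -> R) i : R := \sum_j entry s i j * x j.

Lemma measurable_apply_mx x i : measurable_fun setT (fun s => apply_mx s x i).
Proof.
by apply: measurable_sum => j; apply: measurable_funM => //; exact: measurable_entry.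
Qed.

Definition dot n (a b : 'I_n -> R) : R := \sum_i a i * b i.

Lemma dot_unit_le1 n (a b : 'I_n -> R) :
  \sum_i a i ^+ 2 = 1 -> \sum_i b i ^+ 2 = 1 -> dot a b <= 1.
Proof.
move=> a1 b1.
have : 0 <= \sum_i (a i - b i) ^+ 2 by apply: sumr_ge0 => i _; exact: sqr_ge0.
rewrite (eq_bigr (fun i => a i ^+ 2 + b i ^+ 2 - 2 * (a i * b i))); last first.
  by move=> i _; ring.
rewrite sumrB big_split/= a1 b1 -mulr_sumr -/(dot a b); lra.
Qed.

Lemma sum_enum_pair (f : 'I_m -> 'I_N -> R) :
  \sum_(k < #|{: 'I_m * 'I_N}|) f (enum_val k).1 (enum_val k).2 = \sum_i \sum_j f i j.
Proof.
rewrite pair_bigA/= (reindex (@enum_rank {: 'I_m * 'I_N})) /=; last first.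
  by apply: onW_bij; exists enum_val; [exact: enum_rankK|exact: enum_valK].
by apply: eq_bigr => ij _; rewrite enum_rankK.
Qed.

End gaussian_matrix.

(** * Escape through a mesh *)

Section gordon.
Context {R : realType} (I J : finType) (m N : nat).
Variables (u : I -> 'I_N -> R) (w : J -> 'I_m -> R).
Hypothesis u1 : forall x, \sum_j u x j ^+ 2 = 1.
Hypothesis w1 : forall y, \sum_i w y i ^+ 2 = 1.

Let n := #|{: 'I_m * 'I_N}|.

(** Coordinate [ord0] is the scalar g0, with weight 1 for every pair; the other coordinates run over
    the matrix entries. *)
Let LX (p : I * J) (k : 'I_n.+1) : R :=
  if unlift ord0 k is Some k' then w p.2 (enum_val k').1 * u p.1 (enum_val k').2 else 1.

Let LY (p : I * J) (k : 'I_(m + N)) : R :=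
  match fintype.split k with inl i => w p.2 i | inr j => - u p.1 j end.

Let LYl p i : LY p (lshift N i) = w p.2 i.
Proof. by rewrite /LY (_ : fintype.split _ = inl i)// -(unsplitK (inl i)). Qed.

Let LYr p j : LY p (rshift m j) = - u p.1 j.
Proof. by rewrite /LY (_ : fintype.split _ = inr j)// -(unsplitK (inr j)). Qed.

Let covX p p' : cov LX p p' = 1 + dot (w p.2) (w p'.2) * dot (u p.1) (u p'.1).
Proof.
rewrite /cov big_ord_recl /LX unlift_none mulr1.
under eq_bigr do rewrite !liftK.
rewrite (sum_enum_pair (fun i j => w p.2 i * u p.1 j * (w p'.2 i * u p'.1 j))); congr (_ + _).
rewrite /dot mulr_suml; apply: eq_bigr => i _.
by rewrite mulr_sumr; apply: eq_bigr => j _; ring.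
Qed.

Let covY p p' : cov LY p p' = dot (w p.2) (w p'.2) + dot (u p.1) (u p'.1).
Proof.
rewrite /cov big_split_ord/=; congr (_ + _); apply: eq_bigr => i _; first by rewrite !LYl.
by rewrite !LYr mulrNN.
Qed.

Definition gordonY (t : (m + N).-tuple R) x y : R :=
  \sum_i w y i * tnth t (lshift N i) - \sum_j u x j * tnth t (rshift m j).

Let gordonX (t : n.+1.-tuple R) x y : R :=
  tnth t ord0 + \sum_i \sum_j w y i * u x j * tnth t (lift ord0 (enum_rank (i, j))).

Let lmapY t x y : lmap LY t (x, y) = gordonY t x y.
Proof.
rewrite /lmap big_split_ord/= /gordonY -sumrN; congr (_ + _); apply: eq_bigr => i _.
  by rewrite LYl.
by rewrite LYr mulNr.
Qed.

Let lmapX t x y : lmap LX t (x, y) = gordonX t x y.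
Proof.
rewrite /lmap big_ord_recl /LX unlift_none mul1r.
under eq_bigr do rewrite liftK.
rewrite /gordonX; congr (_ + _).
pose f i j := w y i * u x j * tnth t (lift ord0 (enum_rank (i, j))).
rewrite (eq_bigr (fun k => f (enum_val k).1 (enum_val k).2)); last first.
  by move=> k _; rewrite /f -surjective_pairing enum_valK.
by rewrite sum_enum_pair.
Qed.

Lemma measurable_gordonY x y : measurable_fun setT (fun t => gordonY t x y).
Proof.
by apply: measurable_funB; apply: measurable_sum => i;
  apply: measurable_funM => //; exact: measurable_tnth.
Qed.

Let measurable_gordonX x y : measurable_fun setT (fun t => gordonX t x y).
Proof.
apply: measurable_funD; first exact: measurable_tnth.
apply: measurable_sum => i; apply: measurable_sum => j.
by apply: measurable_funM => //; exact: measurable_tnth.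
Qed.

Let gordon_events (c delta : R) : 0 < delta ->
  (gaussN n.+1 [set t | exists x, forall y, (gordonX t x y <= c)%R] <=
   gaussN (m + N) [set t | exists x, forall y, (gordonY t x y < c + delta)%R])%E.
Proof.
move=> d0.
have le1 x x' : dot (u x) (u x') <= 1 by exact: dot_unit_le1.
have le2 y y' : dot (w y) (w y') <= 1 by exact: dot_unit_le1.
have h1 p p' : cov LY p p' <= cov LX p p'.
  by rewrite covX covY; have := le1 p.1 p'.1; have := le2 p.2 p'.2; nra.
have h2 p p' : p.1 = p'.1 -> cov LX p p' = cov LY p p'.
  move=> pp'; rewrite covX covY pp' (_ : dot (u _) (u _) = 1) ?mulr1 1?addrC//.
  by rewrite -(u1 p'.1); apply: eq_bigr => j _; rewrite expr2.
have := comparison_events h1 h2 c d0.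
rewrite (_ : [set t | exists x, forall y, lmap LX t (x, y) <= c] =
  [set t | exists x, forall y, gordonX t x y <= c]); last first.
  by apply/seteqP; split => t [x h]; exists x => y; have := h y; rewrite lmapX.
rewrite (_ : [set t | exists x, forall y, lmap LY t (x, y) < c + delta] =
  [set t | exists x, forall y, gordonY t x y < c + delta])//.
by apply/seteqP; split => t [x h]; exists x => y; have := h y; rewrite lmapY.
Qed.

(** g0 is independent of the matrix, which produces the product on the left. When both events occur,
    <w, A u> <= |A u| <= eta for every unit w, so the process stays below eta - b along a whole
    row. *)
Lemma gordon_escape (b eta delta : R) : 0 < delta -> 0 <= eta ->
  (stdG [set g0 | (g0 <= - b)%R] *
   gaussN n [set s | exists x, (\sum_i apply_mx s (u x) i ^+ 2 <= eta ^+ 2)%R] <=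
   gaussN (m + N) [set t | exists x, forall y, (gordonY t x y < eta - b + delta)%R])%E.
Proof.
move=> d0 eta0; apply: le_trans (gordon_events (eta - b) d0).
set B := [set g0 | _]; set S := [set s | exists x, _].
have mB : measurable B.
  have BE : B = `]-oo, (- b)]%classic by apply/seteqP; split => x /=; rewrite in_itv.
  by rewrite BE; exact: measurable_itv.
have mS : measurable S.
  rewrite (_ : S = [set s | exists x, forall _ : unit, `]-oo, (eta ^+ 2)]%classic (\sum_i apply_mx s (u x) i ^+ 2)]).
    apply: (@measurable_exists_forall _ _ _ I unit (fun x _ s => \sum_i apply_mx s (u x) i ^+ 2)) => // x _.
    by apply: measurable_sum => i; apply: measurable_funX; exact: measurable_apply_mx.
  apply/seteqP; split => s /= [x h]; exists x; last by have := h tt; rewrite /= in_itv.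
  by move=> _; rewrite /= in_itv.
rewrite -[leLHS]product_measure1E//.
rewrite gaussNSE; apply: le_measure; rewrite ?inE.
- exact: measurableX.
- rewrite -[X in measurable X]setTI; apply: measurable_tcons => //.
  by apply: (@measurable_exists_forall _ _ _ I J (fun x y t => gordonX t x y)
    `]-oo, (eta - b)]%classic) => // x y; exact: measurable_gordonX.
move=> [g0 s] /= [gb [x hx]]; exists x => y.
have {}gb : g0 <= - b := gb.
rewrite /gordonX {1}/tcons/= (tnth_nth 0)/=.
under eq_bigr do under eq_bigr do rewrite /tcons/= tnthS/=.
suff : \sum_i \sum_j w y i * u x j * tnth s (enum_rank (i, j)) <= eta by lra.
have -> : \sum_i \sum_j w y i * u x j * tnth s (enum_rank (i, j)) = \sum_i w y i * apply_mx s (u x) i.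
  apply: eq_bigr => i _; rewrite /apply_mx mulr_sumr; apply: eq_bigr => j _.
  by rewrite /entry; ring.
(* The general argument divides by eta; for eta = 0 the image vector is zero. *)
have [e0|e0] := eqVneq eta 0.
  rewrite e0 big1// => i _.
  move: hx; rewrite e0 expr0n/= => hx.
  have : apply_mx s (u x) i ^+ 2 <= 0.
    apply: le_trans hx; rewrite (bigD1 i)//= lerDl sumr_ge0// => k _; exact: sqr_ge0.
  by rewrite real_exprn_even_le0//= ?num_real// => /eqP ->; rewrite mulr0.
have ep : 0 < eta by rewrite lt_neqAle eq_sym e0.
(* Expanding the square gives Cauchy-Schwarz without square roots. *)
have : 0 <= \sum_i (eta * w y i - apply_mx s (u x) i) ^+ 2.
  by apply: sumr_ge0 => i _; exact: sqr_ge0.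
rewrite (eq_bigr (fun i => eta ^+ 2 * w y i ^+ 2 + apply_mx s (u x) i ^+ 2 -
  2 * eta * (w y i * apply_mx s (u x) i))); last by move=> i _; ring.
rewrite sumrB big_split/= -!mulr_sumr w1 mulr1 => h.
have h' : 2 * eta * (\sum_i w y i * apply_mx s (u x) i) <= 2 * eta * eta by nra.
by rewrite ler_pM2l in h'; [|lra].
Qed.

End gordon.

(** * One-dimensional Gaussian integrals *)

Section real_derivatives.
Context {R : realType}.
Implicit Types (f g : R -> R) (x df dg : R).

Lemma is_derive1_add f g x df dg : is_derive x 1 f df -> is_derive x 1 g dg ->
  is_derive x 1 (fun y => f y + g y) (df + dg).
Proof. by move=> hf hg; exact: is_deriveD. Qed.

Lemma is_derive1_mul f g x df dg : is_derive x 1 f df -> is_derive x 1 g dg ->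
  is_derive x 1 (fun y => f y * g y) (df * g x + f x * dg).
Proof.
move=> hf hg; apply: (is_derive_eq (is_deriveM hf hg)).
by rewrite /GRing.scale /=; ring.
Qed.

Lemma is_derive1_fcomp f g x df dg : is_derive x 1 g dg -> is_derive (g x) 1 f df ->
  is_derive x 1 (fun y => f (g y)) (df * dg).
Proof. by move=> hg hf; exact: is_derive1_comp. Qed.

Lemma is_derive1_scale f x df (c : R) : is_derive x 1 f df ->
  is_derive x 1 (fun y => c * f y) (c * df).
Proof.
move=> hf; have h := is_derive1_mul (is_derive_cst c x 1) hf.
by apply: (is_derive_eq h); rewrite mul0r add0r.
Qed.

Lemma is_derive1_sqr x : is_derive x 1 (fun y : R => y ^+ 2) (2 * x).
Proof.
have h := is_derive1_mul (is_derive_id x 1) (is_derive_id x 1).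
by apply: (is_derive_eq h); rewrite mul1r mulr1 mulr2n mulrDl mul1r.
Qed.

Lemma is_derive1_continuous f x df : is_derive x 1 f df -> {for x, continuous f}.
Proof.
by case=> h _; apply: differentiable_continuous; apply/derivable1_diffP; exact: h.
Qed.

Lemma nondecreasing_deriv (f df : R -> R) : (forall x, is_derive x 1 f (df x)) ->
  (forall x, 0 <= df x) -> {homo f : x y / x <= y}.
Proof.
move=> hf df0 x y xy.
have [c _ E] := @MVT_segment R f df x y xy (fun z _ => hf z)
  (continuous_subspaceT (fun z => is_derive1_continuous (hf z))).
by rewrite -subr_ge0 E mulr_ge0// subr_ge0.
Qed.

End real_derivatives.

(** * The normal distribution function, its tails and truncated second moments *)

Section gaussian_cdf.
Context {R : realType}.
Local Notation mu := (@lebesgue_measure R).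
Implicit Types x b : R.

Lemma deriv_phi x : is_derive x 1 (@phi R) (- x * phi x).
Proof.
have h := is_derive1_scale ((Num.sqrt (pi *+ 2))^-1)
  (is_derive1_fcomp (is_derive1_scale (- 2^-1) (is_derive1_sqr x)) (is_derive_expR _)).
have -> : @phi R = fun y => (Num.sqrt (pi *+ 2))^-1 * expR (- 2^-1 * y ^+ 2).
  by apply/funext => y; rewrite /phi; congr (_ * expR _); field.
by apply: (is_derive_eq h); move: (_^-1) (expR _) => c e; field.
Qed.

Lemma continuous_phi : continuous (@phi R).
Proof. by move=> x; apply: is_derive1_continuous; exact: deriv_phi. Qed.

Lemma phiN x : phi (- x) = phi x. Proof. by rewrite /phi sqrrN. Qed.

Definition Phi b : R := fine (stdG `]-oo, b]%classic).

Lemma PhiE b : stdG `]-oo, b]%classic = (Phi b)%:E.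
Proof. by rewrite /Phi fineK// fin_num_measure. Qed.

Lemma Phi_bounds b : 0 <= Phi b <= 1.
Proof.
by rewrite -!lee_fin -PhiE measure_ge0 probability_le1.
Qed.

Lemma stdG_setE (A : set R) : measurable A -> stdG A = (\int[mu]_(x in A) (phi x)%:E)%E.
Proof.
move=> mA; rewrite /stdG /distribution/= /pushforward /normal_prob preimage_id.
by apply: eq_integral => x _; rewrite phi_normal_pdf.
Qed.

Lemma integrable_phi : mu.-integrable setT (EFin \o @phi R).
Proof.
rewrite (_ : _ \o _ = fun x => (normal_pdf 0 1 x)%:E); first exact: integrable_normal_pdf.
by apply/funext => x; rewrite /= phi_normal_pdf.
Qed.

Lemma deriv_Phi x : is_derive x 1 Phi (phi x).
Proof.
have xx1 : x < x + 1 by rewrite ltrDl.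
have int1 : mu.-integrable [set` Interval -oo%O (BRight (x + 1))] (EFin \o @phi R).
  by apply: (integrableS measurableT) => //; exact: integrable_phi.
have PhiR : Phi = fun b => (\int[mu]_(t in [set` Interval -oo%O (BRight b)]) (phi t))%R.
  by apply/funext => b; rewrite /Phi stdG_setE.
have [d E] := @continuous_FTC1 R (@phi R) -oo%O x (x + 1) xx1 int1 (ltNyr _) (@continuous_phi x).
rewrite PhiR; apply: DeriveDef; first exact: d.
by rewrite -derive1E E.
Qed.

Lemma stdG_gt b : stdG `]b, +oo[%classic = (1 - Phi b)%:E.
Proof.
by rewrite EFinB -PhiE -probability_setC// setCitvl.
Qed.

Lemma stdG_ge b : stdG `[b, +oo[%classic = (1 - Phi b)%:E.
Proof.
rewrite -stdG_gt !stdG_setE// integral_itv_obnd_cbnd//.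
by apply/measurable_EFinP; apply: measurable_funTS; exact: measurable_phi.
Qed.

Lemma PhiN b : Phi (- b) = 1 - Phi b.
Proof.
apply: EFin_inj; rewrite -PhiE -stdG_ge -stdGN//; congr (stdG _).
by apply/seteqP; split => x /=; rewrite !in_itv/= andbT lerN2.
Qed.

Lemma integral_ge_deriv (f F : R -> R) (a l : R) :
  (forall x, is_derive x 1 F (f x)) -> continuous f -> (forall x, a <= x -> 0 <= f x) ->
  F x @[x --> +oo%R] --> l ->
  (\int[mu]_(x in `[a, +oo[) (f x)%:E = (l - F a)%:E)%E.
Proof.
move=> dF cf f0 Fl; rewrite (@ge0_continuous_FTC2y R f F a l)//.
- exact: continuous_subspaceT.
- by apply: cvg_at_right_filter; exact: is_derive1_continuous (dF a).
- by move=> x _; rewrite derive1E; case: (dF x).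
Qed.

Lemma phi_le x : 0 < x -> x * phi x <= 2 / x.
Proof.
move=> x0; rewrite ler_pdivlMr// mulrAC -expr2 /phi mulrCA.
have c1 : (Num.sqrt (pi *+ 2))^-1 <= 1 :> R.
  have p0 : 0 < pi *+ 2 :> R by rewrite pmulrn_lgt0// pi_gt0.
  rewrite invf_le1 ?sqrtr_gt0//.
  rewrite -[leLHS]sqrtr1 ler_wsqrtr//; have := pi_ge2 R; rewrite mulr2n; lra.
have c0 : 0 <= (Num.sqrt (pi *+ 2))^-1 :> R by rewrite invr_ge0.
have e : x ^+ 2 * expR (- x ^+ 2 / 2) <= 2.
  rewrite mulNr expRN ler_pdivrMr ?expR_gt0//.
  have := expR_ge1Dx (x ^+ 2 / 2); lra.
have e0 : 0 <= x ^+ 2 * expR (- x ^+ 2 / 2) by rewrite mulr_ge0 ?sqr_ge0 ?expR_ge0.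
by apply: (@le_trans _ _ (1 * 2)); [apply: ler_pM|rewrite mul1r].
Qed.

Lemma cvg_xphi : x * phi x @[x --> +oo%R] --> (0 : R).
Proof.
have inv0 : 2 * x^-1 @[x --> +oo%R] --> (0 : R).
  rewrite -(mulr0 2); apply: cvgM; first exact: cvg_cst.
  by apply/gtr0_cvgV0; [near=> x|exact: cvg_id].
apply: (@squeeze_cvgr _ _ _ _ (cst 0) (fun x => 2 * x^-1)) => //; last exact: cvg_cst.
near=> x; apply/andP; split; last by apply: phi_le.
by rewrite mulr_ge0// phi_ge0.
Unshelve. all: by end_near. Qed.

Lemma cvg_phi : phi x @[x --> +oo%R] --> (0 : R).
Proof.
apply: (@squeeze_cvgr _ _ _ _ (cst 0) (fun x => x * phi x)) => //; last 2 first.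
- exact: cvg_cst.
- exact: cvg_xphi.
near=> x; apply/andP; split; first exact: phi_ge0.
by rewrite ler_peMl// phi_ge0.
Unshelve. all: by end_near. Qed.

Lemma deriv_Nphi x : is_derive x 1 (fun y => - phi y) (x * phi x).
Proof.
have h := is_derive1_scale (-1) (deriv_phi x).
rewrite (_ : (fun y => - phi y) = (fun y => -1 * phi y)); last by apply/funext => y; rewrite mulN1r.
by apply: (is_derive_eq h); ring.
Qed.

(** On [b, +oo) one has b phi x <= x phi x, and x phi x has the primitive - phi. *)
Lemma mills_upper b : b * (1 - Phi b) <= phi b.
Proof.
have [b0|b0] := leP b 0.
  apply: (@le_trans _ _ 0); last exact: phi_ge0.
  by rewrite mulr_le0_ge0//; have := Phi_bounds b; lra.
have c1 : continuous (fun x : R => x * phi x).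
  by move=> x; apply: continuousM; [exact: cvg_id|exact: continuous_phi].
have n1 x : b <= x -> 0 <= x * phi x.
  by move=> bx; rewrite mulr_ge0 ?phi_ge0//; lra.
have l1 : - phi x @[x --> +oo%R] --> (0 : R).
  by rewrite -oppr0; apply: cvgN; exact: cvg_phi.
have E := integral_ge_deriv deriv_Nphi c1 n1 l1.
rewrite sub0r opprK in E; rewrite -lee_fin -E.
rewrite EFinM -stdG_ge stdG_setE// -ge0_integralZl//; last 3 first.
- by apply/measurable_EFinP; apply: measurable_funTS; exact: measurable_phi.
- by move=> x _; rewrite lee_fin phi_ge0.
- by rewrite lee_fin ltW.
apply: ge0_le_integral => //.
- by move=> x _; rewrite mule_ge0 ?lee_fin ?phi_ge0 ?ltW.
- apply: emeasurable_funM => //; apply/measurable_EFinP; apply: measurable_funTS; exact: measurable_phi.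
- apply/measurable_EFinP; apply: measurable_funM => //; apply: measurable_funTS; exact: measurable_phi.
- move=> x /=; rewrite in_itv/= andbT => bx.
  by rewrite -EFinM lee_fin ler_wpM2r// phi_ge0.
Qed.

(** For x >= 1 Mills' inequality gives 1 - Phi x <= phi x, which tends to 0. *)
Lemma cvg_Phi : Phi x @[x --> +oo%R] --> (1 : R).
Proof.
apply: (@squeeze_cvgr _ _ _ _ (fun x => 1 - phi x) (cst 1)) => //; last 2 first.
- rewrite -[X in _ --> X]subr0; apply: cvgB; [exact: cvg_cst|exact: cvg_phi].
- exact: cvg_cst.
near=> x; have /andP[P0 P1] := Phi_bounds x; rewrite P1 andbT.
have x1 : 1 <= x by [].
have := mills_upper x; nra.
Unshelve. all: by end_near. Qed.

(** Closed form of the second moment of pos (g + b) for g standard normal ([integral_sqr_ge]). The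
    two integrals in [Delta_bin_fun] are its values at tau and - tau. *)
Definition mu1 b : R := (1 + b ^+ 2) * Phi b + b * phi b.

Lemma continuous_sqr_phi b : continuous (fun x => (x + b) ^+ 2 * phi x).
Proof.
move=> x.
have h := is_derive1_add (is_derive_id x 1) (is_derive_cst b x 1).
exact: is_derive1_continuous (is_derive1_mul (is_derive1_mul h h) (deriv_phi x)).
Qed.

Lemma integral_sqr_ge b :
  (\int[mu]_(x in `[(- b)%R, +oo[) ((x + b) ^+ 2 * phi x)%:E = (mu1 b)%:E)%E.
Proof.
(* A primitive of (x + b)^2 phi x, found from phi' = - x phi. *)
pose F x := (1 + b ^+ 2) * Phi x + - (x * phi x) + (- (2 * b)) * phi x.
have dF x : is_derive x 1 F ((x + b) ^+ 2 * phi x).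
  have h1 := is_derive1_scale (1 + b ^+ 2) (deriv_Phi x).
  have h2 := is_derive1_scale (-1) (is_derive1_mul (is_derive_id x 1) (deriv_phi x)).
  have h3 := is_derive1_scale (- (2 * b)) (deriv_phi x).
  have h := is_derive1_add (is_derive1_add h1 h2) h3.
  rewrite (_ : F = (fun y => (1 + b ^+ 2) * Phi y + -1 * (y * phi y) + - (2 * b) * phi y)).
    by apply: (is_derive_eq h); ring.
  by apply/funext => y; rewrite /F mulN1r.
have c1 : continuous (fun x => (x + b) ^+ 2 * phi x).
  exact: continuous_sqr_phi.
have n1 x : - b <= x -> 0 <= (x + b) ^+ 2 * phi x.
  by move=> _; rewrite mulr_ge0 ?sqr_ge0 ?phi_ge0.
have l1 : F x @[x --> +oo%R] --> 1 + b ^+ 2.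
  rewrite -[X in _ --> X]addr0 -[X in _ --> X]addr0; apply: cvgD; first apply: cvgD.
  + rewrite -[X in _ --> X]mulr1; apply: cvgM; [exact: cvg_cst|exact: cvg_Phi].
  + by rewrite -oppr0; apply: cvgN; exact: cvg_xphi.
  + by rewrite -(mulr0 (- (2 * b))); apply: cvgM; [exact: cvg_cst|exact: cvg_phi].
rewrite (integral_ge_deriv dF c1 n1 l1).
by congr (_%:E); rewrite /F /mu1 PhiN phiN; ring.
Qed.

Lemma mu1_ge0 b : 0 <= mu1 b.
Proof.
rewrite -lee_fin -integral_sqr_ge; apply: integral_ge0 => x _.
by rewrite lee_fin mulr_ge0 ?sqr_ge0 ?phi_ge0.
Qed.

Lemma integral_sqr_le b :
  (\int[mu]_(x in `]-oo, b]) ((x - b) ^+ 2 * phi x)%:E = (mu1 b)%:E)%E.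
Proof.
rewrite -integral_sqr_ge -{1}(opprK b).
have c : {within `]-oo, (- - b)], continuous (fun x => (x - b) ^+ 2 * phi x)}.
  by apply: continuous_subspaceT; exact: continuous_sqr_phi.
have n : {in `]-oo, (- - b)[, forall x, 0 <= (x - b) ^+ 2 * phi x}.
  by move=> x _; rewrite mulr_ge0 ?sqr_ge0 ?phi_ge0.
apply: etrans (ge0_integration_by_substitutionNy c n) _.
by apply: eq_integral => x _; rewrite /= phiN; congr (_%:E); ring.
Qed.

Lemma deriv_mu1 x : is_derive x 1 mu1 (2 * (phi x + x * Phi x)).
Proof.
have h1 := is_derive1_mul (is_derive1_add (is_derive_cst (1 : R) x 1) (is_derive1_sqr x)) (deriv_Phi x).
have h2 := is_derive1_mul (is_derive_id x 1) (deriv_phi x).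
by apply: (is_derive_eq (is_derive1_add h1 h2)); rewrite /=; ring.
Qed.

(** Chernoff's bound with its optimal parameter x. *)
Lemma Phi_tail x : 0 <= x -> Phi (- x) <= expR (- x ^+ 2 / 2).
Proof.
move=> x0; rewrite -lee_fin -PhiE.
apply: (@le_trans _ _ (\int[stdG]_y ((expR (- x ^+ 2))%:E * (expR (- x * y))%:E))%E).
  have -> : stdG `]-oo, - x]%classic = (\int[stdG]_y (\1_(`]-oo, - x]%classic) y)%:E)%E.
    by rewrite integral_indic ?setIT.
  apply: ge0_le_integral => //.
  - by apply/measurable_EFinP; exact: measurable_indic.
  - apply: emeasurable_funM => //; apply/measurable_EFinP.
    by apply: measurableT_comp => //; exact: measurable_funM.
  move=> y _; rewrite -EFinM lee_fin -expRD indicE.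
  have [|_] := boolP (y \in _); last by rewrite expR_ge0.
  rewrite inE/= in_itv/= => yx; rewrite -[leLHS]expR0 ler_expR; nra.
rewrite ge0_integralZl//; last first.
  by apply/measurable_EFinP; apply: measurableT_comp => //; exact: measurable_funM.
rewrite integral_expR_stdG -EFinM lee_fin -expRD ler_expR; nra.
Qed.

End gaussian_cdf.

(** * Exponential moment of the squared positive part of a shifted normal variable *)

Section excess_mgf.
Context {R : realType}.
Local Notation mu := (@lebesgue_measure R).
Variables (l eta : R).
Hypotheses (l0 : 0 < l) (eta0 : 0 < eta) (etaE : eta ^+ 2 * (1 - 2 * l) = 1).
Implicit Types b x : R.

(** The contribution of x > - b to the exponential moment. Weighted by exp (l (x + b)^2), the
    standard normal law becomes a multiple of a normal law with standard deviation [eta], and [etaE]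
    says that eta^2 = 1 / (1 - 2 l). *)
Definition excess_tilt b : R := eta * expR (l * eta ^+ 2 * b ^+ 2) * Phi (eta * b).

Definition excess_mgf b : R := 1 - Phi b + excess_tilt b.

Lemma measurable_excess b : measurable_fun setT (fun x : R => expR (l * pos (x + b) ^+ 2)).
Proof.
apply: measurableT_comp => //; apply: measurable_funM => //; apply: measurable_funX.
by apply: measurable_maxr => //; exact: measurable_funD.
Qed.

Lemma complete_square b x :
  expR (l * (x + b) ^+ 2) * phi x =
  eta * expR (l * eta ^+ 2 * b ^+ 2) * normal_pdf (2 * l * eta ^+ 2 * b) eta x.
Proof.
rewrite normal_pdf_phi// [RHS]mulrACA divff ?gt_eqF// mul1r /phi.
rewrite mulrCA [RHS]mulrCA -!expRD; congr (_ * expR _).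
have e2 : eta != 0 by rewrite gt_eqF.
have lE : l = (1 - (eta ^+ 2)^-1) / 2.
  have : 1 - 2 * l = (eta ^+ 2)^-1.
    by apply: (mulfI (expf_neq0 2 e2)); rewrite etaE divff// expf_neq0.
  lra.
by rewrite lE; field.
Qed.

Lemma integral_excess_gt b :
  (\int[stdG]_x ((\1_(`](- b)%R, +oo[%classic) x : R)%:E * (expR (l * (x + b) ^+ 2))%:E) =
   (excess_tilt b)%:E)%E.
Proof.
have mi : measurable_fun setT (fun x : R => (\1_(`](- b)%R, +oo[%classic) x : R)%:E).
  by apply/measurable_EFinP; exact: measurable_indic.
have i0 x : (0 <= (\1_(`](- b)%R, +oo[%classic) x : R)%:E)%E by [].
rewrite ge0_integral_stdG_phi; last 2 first.
- apply: emeasurable_funM; first exact: mi.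
  apply/measurable_EFinP; apply: measurableT_comp => //; apply: measurable_funM => //.
  by apply: measurable_funX; exact: measurable_funD.
- by move=> x; rewrite mule_ge0// lee_fin expR_ge0.
set c := eta * expR (l * eta ^+ 2 * b ^+ 2); set m := 2 * l * eta ^+ 2 * b.
transitivity (\int[mu]_x (c%:E * ((\1_(`](- b)%R, +oo[%classic) x : R)%:E * (normal_pdf m eta x)%:E)))%E.
  apply: eq_integral => x _; rewrite -!EFinM -mulrA complete_square -/c -/m.
  by congr (_%:E); ring.
have c0 : 0 <= c by rewrite mulr_ge0 ?expR_ge0// ltW.
rewrite ge0_integralZl; [|exact: measurableT| | |by rewrite lee_fin]; last 2 first.
- apply: emeasurable_funM; first exact: mi.
  by apply/measurable_EFinP; exact: measurable_normal_pdf.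
- by move=> x _; rewrite mule_ge0// lee_fin normal_pdf_ge0.
rewrite -ge0_integral_normal_prob; [|exact: mi|exact: i0].
rewrite -ge0_integral_normal_affine; [|exact: eta0|exact: mi|exact: i0].
rewrite -ge0_integral_stdG; last 2 first.
- exact: (measurableT_comp mi (measurable_affine m eta)).
- by move=> x.
transitivity (c%:E * \int[stdG]_x (\1_(`](- (eta * b))%R, +oo[%classic) x : R)%:E)%E.
  congr (_ * _)%E; apply: eq_integral => x _; congr (_%:E).
  rewrite !indicE; congr (_%:R); congr nat_of_bool; rewrite !mem_setE.
  have -> : m = eta ^+ 2 * b - b.
    transitivity (eta ^+ 2 * b - (eta ^+ 2 * (1 - 2 * l)) * b); first by rewrite /m; ring.
    by rewrite etaE mul1r.
  rewrite !in_itv/= !andbT.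
  rewrite -subr_gt0 -[in RHS]subr_gt0 (_ : _ - - b = eta * (x - - (eta * b))); last by ring.
  by rewrite pmulr_rgt0.
rewrite integral_indic ?setIT//.
transitivity (c%:E * (1 - Phi (- (eta * b)))%:E)%E; first by congr (_ * _)%E; exact: stdG_gt.
rewrite PhiN -EFinM; congr (_%:E).
by rewrite /excess_tilt -/c; ring.
Qed.

Lemma integral_excess b :
  (\int[stdG]_x (expR (l * pos (x + b) ^+ 2))%:E = (excess_mgf b)%:E)%E.
Proof.
have mi (A : set R) : measurable A -> measurable_fun setT (fun x : R => (\1_A x : R)%:E).
  by move=> mA; apply/measurable_EFinP; exact: measurable_indic.
transitivity (\int[stdG]_x ((\1_(`]-oo, (- b)%R]%classic) x : R)%:E +
   (\1_(`](- b)%R, +oo[%classic) x : R)%:E * (expR (l * (x + b) ^+ 2))%:E))%E.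
  apply: eq_integral => x _; rewrite !indicE !mem_setE !in_itv/= andbT.
  have [xb|xb] := leP x (- b).
    by rewrite pos_0 ?expr0n/= ?mulr0 ?expR0 ?mul0e ?adde0//; lra.
  by rewrite pos_id ?mul1e ?add0e//; lra.
rewrite ge0_integralD; last 5 first.
- exact: measurableT.
- by [].
- exact: mi.
- by move=> x _; rewrite mule_ge0// lee_fin expR_ge0.
- apply: emeasurable_funM; first exact: mi.
  apply/measurable_EFinP; apply: measurableT_comp => //; apply: measurable_funM => //.
  by apply: measurable_funX; exact: measurable_funD.
rewrite integral_excess_gt integral_indic ?setIT// /excess_mgf -PhiN EFinD.
by congr (_ + _)%E; exact: PhiE.
Qed.

Lemma excess_mgf_ge1 b : 1 <= excess_mgf b.
Proof.
rewrite -lee_fin -integral_excess.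
have <- : (\int[stdG]_x (cst 1 x : \bar R) = 1)%E.
  by rewrite integral_cst// mul1e; exact: probability_setT.
apply: ge0_le_integral.
- exact: measurableT.
- by [].
- exact: measurable_cst.
- by apply/measurable_EFinP; exact: measurable_excess.
- move=> x _; rewrite lee_fin -expR0 ler_expR mulr_ge0 ?sqr_ge0//; exact: ltW.
Qed.

Lemma expR_phi_eta b : expR (l * eta ^+ 2 * b ^+ 2) * phi (eta * b) = phi b.
Proof.
rewrite /phi mulrCA -expRD; congr (_ * expR _).
have -> : l * eta ^+ 2 = (eta ^+ 2 - 1) / 2.
  transitivity ((eta ^+ 2 - eta ^+ 2 * (1 - 2 * l)) / 2); first by field.
  by rewrite etaE.
by field.
Qed.

Lemma deriv_excess_tilt b :
  is_derive b 1 excess_tilt (2 * l * eta ^+ 2 * b * excess_tilt b + eta ^+ 2 * phi b).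
Proof.
have h1 := is_derive1_fcomp (is_derive1_scale (l * eta ^+ 2) (is_derive1_sqr b)) (is_derive_expR _).
have h2 := is_derive1_fcomp (is_derive1_scale eta (is_derive_id b 1)) (deriv_Phi _).
have h := is_derive1_mul (is_derive1_scale eta h1) h2.
apply: (is_derive_eq h); rewrite -[in RHS](expR_phi_eta b) /excess_tilt.
by move: (expR _) (Phi _) (phi _) => e P p; ring.
Qed.

(** The derivative of - Phi combines with the term eta^2 phi of [deriv_excess_tilt]: by [etaE],
    eta^2 - 1 = 2 l eta^2, which factors out. *)
Lemma deriv_excess_mgf b :
  is_derive b 1 excess_mgf (2 * l * eta ^+ 2 * (phi b + b * excess_tilt b)).
Proof.
have h1 := is_derive1_add (is_derive_cst (1 : R) b 1) (is_derive1_scale (-1) (deriv_Phi b)).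
have h := is_derive1_add h1 (deriv_excess_tilt b).
have -> : excess_mgf = (fun y => 1 + -1 * Phi y + excess_tilt y).
  by apply/funext => y; rewrite /excess_mgf mulN1r.
apply: (is_derive_eq h); move: (excess_tilt b) (phi b) => t p.
transitivity (- ((eta ^+ 2 * (1 - 2 * l)) * p) + eta ^+ 2 * p + 2 * l * eta ^+ 2 * b * t).
  by rewrite etaE /=; ring.
ring.
Qed.

Let gap b := l * eta ^+ 2 * mu1 b - ln (excess_mgf b).

(* [gap] also tends to 0 at -oo ([gap_ge]), hence it is nonnegative; its derivative has the sign
   of phi b - b (1 - Phi b), which is Mills' inequality. *)
Let nondecreasing_gap : {homo gap : x y / x <= y}.
Proof.
pose dgap b := l * eta ^+ 2 * (2 * (phi b + b * Phi b)) +
  -1 * ((excess_mgf b)^-1 * (2 * l * eta ^+ 2 * (phi b + b * excess_tilt b))).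
apply: (@nondecreasing_deriv _ gap dgap) => b.
  have h1 := is_derive1_scale (l * eta ^+ 2) (deriv_mu1 b).
  have G0 : 0 < excess_mgf b by apply: lt_le_trans (excess_mgf_ge1 b).
  have h2 := is_derive1_fcomp (deriv_excess_mgf b) (is_derive1_ln G0).
  have h := is_derive1_add h1 (is_derive1_scale (-1) h2).
  rewrite (_ : gap = fun y => l * eta ^+ 2 * mu1 y + -1 * ln (excess_mgf y)).
    exact: h.
  by apply/funext => y; rewrite /gap mulN1r.
have G1 := excess_mgf_ge1 b; have M := mills_upper b.
have G0 : 0 < excess_mgf b by lra.
have -> : dgap b = 2 * l * eta ^+ 2 * ((excess_mgf b - 1) * (phi b - b * (1 - Phi b)) / excess_mgf b).
  have tE : excess_tilt b = excess_mgf b - 1 + Phi b by rewrite /excess_mgf; ring.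
  rewrite /dgap tE; move: (excess_mgf b) (Phi b) (phi b) G0 => G P p G0.
  by field; rewrite gt_eqF.
apply: mulr_ge0; first by rewrite mulr_ge0 ?sqr_ge0// mulr_ge0// ltW.
by rewrite divr_ge0 ?(ltW G0)// mulr_ge0// subr_ge0.
Qed.

(** Since ln G <= G - 1, the logarithm is at most [excess_tilt b], and [Phi_tail] makes this decay
    as exp (- b^2 / 2) because eta^2 (1 - 2 l) = 1. *)
Let gap_ge b : b <= 0 -> - (eta * expR (- (b ^+ 2 / 2))) <= gap b.
Proof.
move=> b0.
have t : excess_tilt b <= eta * expR (- (b ^+ 2 / 2)).
  rewrite /excess_tilt -mulrA ler_wpM2l ?(ltW eta0)//.
  have nb : 0 <= - (eta * b) by rewrite oppr_ge0 pmulr_rle0.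
  have := Phi_tail nb; rewrite opprK => h.
  apply: le_trans (ler_wpM2l (expR_ge0 _) h) _.
  rewrite -expRD ler_expR.
  have -> : l * eta ^+ 2 * b ^+ 2 + - (- (eta * b)) ^+ 2 / 2 = - ((eta ^+ 2 * (1 - 2 * l)) * b ^+ 2 / 2).
    by field.
  by rewrite etaE mul1r.
have G := excess_mgf_ge1 b.
have lnG : ln (1 + (excess_mgf b - 1)) <= excess_mgf b - 1 by apply: le_ln1Dx; lra.
rewrite subrKC in lnG.
have m0 : 0 <= l * eta ^+ 2 * mu1 b 
  by apply: mulr_ge0; [apply: mulr_ge0; [exact: ltW|exact: sqr_ge0]|exact: mu1_ge0].
have GE : excess_mgf b = 1 - Phi b + excess_tilt b by [].
have /andP[P0 _] := Phi_bounds b; rewrite /gap; lra.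
Qed.

Let gap_ge0 x : 0 <= gap x.
Proof.
rewrite leNgt; apply/negP => gx.
pose e := - gap x; have e0 : 0 < e by rewrite oppr_gt0.
(* The summand 2 ensures b^2 / 2 >= |b| >= 2 eta / e, so that e (1 + b^2 / 2) > eta. This
   contradicts [gap_ge] combined with monotonicity. *)
pose b := Num.min x (- (2 * eta / e) - 2).
have bx : b <= x by rewrite ge_min lexx.
have be : b <= - (2 * eta / e) - 2 by rewrite ge_min lexx orbT.
have h0 : 0 < 2 * eta / e by rewrite divr_gt0// mulr_gt0.
have b0 : b <= 0 by lra.
have := le_trans (gap_ge b0) (nondecreasing_gap bx).
rewrite -[gap x]opprK -/e lerN2 expRN ler_pdivlMr ?expR_gt0// => h.
have h1 : e * (1 + b ^+ 2 / 2) <= eta.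
  by apply: le_trans h; rewrite ler_wpM2l ?(ltW e0)// expR_ge1Dx.
have h2 : 2 * eta / e * e = 2 * eta by field; rewrite gt_eqF.
have : b ^+ 2 / 2 >= 2 * eta / e by nra.
move=> h3; have : e * (2 * eta / e) <= e * (b ^+ 2 / 2) by rewrite ler_wpM2l// ltW.
nra.
Qed.

(** This is [gap_ge0] exponentiated. The exponent is proportional to the second moment [mu1 b], so a
    product over coordinates depends only on the sum of these moments, the functional that
    [Delta_bin] minimizes. *)
Lemma integral_excess_le b :
  (\int[stdG]_x (expR (l * pos (x + b) ^+ 2))%:E <= (expR (l * eta ^+ 2 * mu1 b))%:E)%E.
Proof.
have G1 := excess_mgf_ge1 b; have G0 : 0 < excess_mgf b by lra.
rewrite integral_excess lee_fin -[leLHS]lnK ?posrE// ler_expR.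
by have := gap_ge0 b; rewrite subr_ge0.
Qed.

End excess_mgf.

(** * Concentration of the two norms *)

Section chi_lower_tail.
Context {R : realType}.
Local Notation mu := (@lebesgue_measure R).

Lemma integral_expR_sqr_stdG (s : R) : 0 < s ->
  (\int[stdG]_x (expR (- ((s ^+ 2)^-1 - 1) / 2 * x ^+ 2))%:E = s%:E)%E.
Proof.
move=> s0; rewrite ge0_integral_stdG_phi; last 2 first.
- apply/measurable_EFinP; apply: measurableT_comp => //; apply: measurable_funM => //.
- by move=> x; rewrite lee_fin expR_ge0.
transitivity (\int[mu]_x (s%:E * (normal_pdf 0 s x)%:E))%E.
  apply: eq_integral => x _; rewrite -!EFinM normal_pdf_phi// mulVKf ?gt_eqF// subr0.
  congr (_%:E); rewrite /phi mulrCA -expRD; congr (_ * expR _).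
  by field; rewrite gt_eqF.
rewrite ge0_integralZl; [|exact: measurableT| | |by rewrite lee_fin ltW]; last 2 first.
- by apply/measurable_EFinP; exact: measurable_normal_pdf.
- by move=> x _; rewrite lee_fin normal_pdf_ge0.
by rewrite integral_normal_pdf mule1.
Qed.

(** The derivative of (y - 1) exp (y + y^2 / 2) is y^2 exp (y + y^2 / 2), and the function equals -
    1 at 0. *)
Lemma onem_expR_le1 (y : R) : 0 <= y -> (1 - y) * expR (y + y ^+ 2 / 2) <= 1.
Proof.
move=> y0.
pose f (y : R) := (y - 1) * expR (y + 2^-1 * y ^+ 2).
have df (x : R) : is_derive x 1 f (x ^+ 2 * expR (x + 2^-1 * x ^+ 2)).
  have h1 := is_derive1_add (is_derive_id x 1) (is_derive_cst (-1 : R) x 1).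
  have h2 := is_derive1_add (is_derive_id x 1) (is_derive1_scale 2^-1 (is_derive1_sqr x)).
  have h3 := is_derive1_fcomp h2 (is_derive_expR _).
  have h := is_derive1_mul h1 h3.
  by apply: (is_derive_eq h); rewrite /=; move: (expR _) => e; field.
have f_ge0 (x : R) : 0 <= x ^+ 2 * expR (x + 2^-1 * x ^+ 2).
  by rewrite mulr_ge0 ?sqr_ge0 ?expR_ge0.
have := nondecreasing_deriv df f_ge0 y0.
rewrite /f expr0n/= mulr0 addr0 expR0 (mulrC 2^-1); lra.
Qed.

Definition sumsq n (t : n.-tuple R) : R := \sum_(i < n) tnth t i ^+ 2.

Lemma sumsq_ge0 n (t : n.-tuple R) : 0 <= sumsq t.
Proof. by apply: sumr_ge0 => i _; exact: sqr_ge0. Qed.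

Lemma measurable_sumsq n : measurable_fun setT (@sumsq n).
Proof. by apply: measurable_sum => i; apply: measurable_funX; exact: measurable_tnth. Qed.

Lemma measurable_lt_fun d (T : measurableType d) (f g : T -> R) :
  measurable_fun setT f -> measurable_fun setT g -> measurable [set t | f t < g t].
Proof.
move=> mf mg; rewrite (_ : [set _ | _] = (fun t => f t - g t) @^-1` `]-oo, 0[%classic).
  by rewrite -[X in measurable X]setTI; apply: measurable_funB.
by apply/seteqP; split => t /=; rewrite in_itv/= subr_lt0.
Qed.

(** With s = a / sqrt n, Chernoff gives (s exp ((1 - s^2) / 2))^n. By [onem_expR_le1] at y = 1 - s
    this is at most exp (- n (1 - s)^2). *)
Lemma norm_lower_tail_sqr n (a : R) : (0 < n)%N -> 0 < a -> a < Num.sqrt n%:R ->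
  (gaussN n [set t | (Num.sqrt (sumsq t) < a)%R] <=
   (expR (- (Num.sqrt n%:R - a) ^+ 2))%:E)%E.
Proof.
move=> n0 a0 an.
have rn0 : 0 < Num.sqrt n%:R :> R by exact: lt_trans an.
pose s := a / Num.sqrt n%:R; have s0 : 0 < s by rewrite divr_gt0.
(* The optimal parameter: the weight exp (- c x^2) turns the standard normal law into a multiple of
   the centered one with standard deviation s. *)
pose c := ((s ^+ 2)^-1 - 1) / 2.
have cN : - c = - ((s ^+ 2)^-1 - 1) / 2 by rewrite /c mulNr.
have s1 : s < 1 by rewrite ltr_pdivrMr// mul1r.
have c0 : 0 <= c.
  rewrite divr_ge0// subr_ge0 invf_ge1 ?exprn_gt0// exprn_ile1//; exact: ltW.
set E := [set t | _].
have mE : measurable E.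
  apply: measurable_lt_fun => //; apply: measurableT_comp; last exact: measurable_sumsq.
  exact: continuous_measurable_fun (@sqrt_continuous R).
have mf : measurable_fun setT (fun x : R => (expR (- c * x ^+ 2))%:E).
  by apply/measurable_EFinP; apply: measurableT_comp => //; apply: measurable_funM.
have mS : measurable_fun setT (fun t : n.-tuple R => (expR (- c * sumsq t))%:E).
  apply/measurable_EFinP; apply: measurableT_comp => //; apply: measurable_funM => //.
  exact: measurable_sumsq.
have IS : (\int[gaussN n]_t (expR (- c * sumsq t))%:E = (s ^+ n)%:E)%E.
  transitivity (\int[gaussN n]_t \prod_(i < n) (expR (- c * (tnth t i) ^+ 2))%:E)%E.
    by apply: eq_integral => t _; rewrite prodEFin -expR_sum -mulr_sumr.
  rewrite (gaussN_prod (f := fun i x => (expR (- c * x ^+ 2))%:E)); last 2 first.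
  - by [].
  - by move=> _ x; rewrite lee_fin expR_ge0.
  rewrite (eq_bigr (fun=> s%:E)).
    by rewrite prodEFin prodr_const card_ord.
  move=> _ _; rewrite -(integral_expR_sqr_stdG s0); apply: eq_integral => x _.
  by rewrite cN.
apply: (@le_trans _ _ (\int[gaussN n]_t ((expR (c * a ^+ 2))%:E * (expR (- c * sumsq t))%:E))%E).
  have -> : gaussN n E = (\int[gaussN n]_t (\1_E t)%:E)%E.
    by rewrite integral_indic ?setIT.
  apply: ge0_le_integral.
  - exact: measurableT.
  - by [].
  - by apply/measurable_EFinP; exact: measurable_indic.
  - exact: emeasurable_funM.
  move=> t _; rewrite -EFinM lee_fin -expRD indicE.
  have [|_] := boolP (t \in E); last by rewrite expR_ge0.
  rewrite inE /E/= => ta; rewrite -[leLHS]expR0 ler_expR.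
  rewrite mulNr -mulrBr mulr_ge0// subr_ge0.
  by rewrite -[leLHS](sqr_sqrtr (sumsq_ge0 t)) lerXn2r ?nnegrE ?sqrtr_ge0 ?ltW.
rewrite ge0_integralZl; [|exact: measurableT|exact: mS| |]; last 2 first.
- by move=> t _; rewrite lee_fin expR_ge0.
- by rewrite lee_fin expR_ge0.
rewrite IS -EFinM lee_fin.
have aE : a = s * Num.sqrt n%:R by rewrite divfK// gt_eqF.
clearbody s.
have nE : Num.sqrt n%:R ^+ 2 = n%:R :> R by rewrite sqr_sqrtr.
have y0 : 0 <= 1 - s by lra.
have := onem_expR_le1 y0; set e := expR _ => h.
have {}h : s * e <= 1 by rewrite (_ : s = 1 - (1 - s))//; ring.
have {h} : (s * e) ^+ n <= 1 by rewrite exprn_ile1// mulr_ge0 ?expR_ge0// ltW.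
rewrite exprMn /e -expRM_natl -ler_pdivlMr ?expR_gt0// mul1r -expRN => h.
apply: le_trans (ler_wpM2l (expR_ge0 _) h) _.
rewrite -expRD ler_expR le_eqVlt; apply/orP; left; apply/eqP.
have -> : a ^+ 2 = s ^+ 2 * n%:R by rewrite aE exprMn nE.
have -> : Num.sqrt n%:R - a = (1 - s) * Num.sqrt n%:R by rewrite aE; ring.
by rewrite exprMn nE /c; field; rewrite gt_eqF.
Qed.

(** From t^2 >= v t - v^2 / 4. The exponent is now affine in [a] and the bound holds for every real
    [a], so a random threshold can be inserted and integrated. *)
Lemma norm_lower_tail n (a v : R) : (0 < n)%N -> 0 <= v ->
  (gaussN n [set t | (Num.sqrt (sumsq t) < a)%R] <=
   (expR (v ^+ 2 / 4 - v * (Num.sqrt n%:R - a)))%:E)%E.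
Proof.
move=> n0 v0.
have [a0|a0] := leP a 0.
  rewrite (_ : [set _ | _] = set0) ?measure0 ?lee_fin ?expR_ge0//.
  apply/seteqP; split => t //= h.
  by have := sqrtr_ge0 (sumsq t); lra.
have [an|an] := ltP a (Num.sqrt n%:R).
  apply: le_trans (norm_lower_tail_sqr n0 a0 an) _; rewrite lee_fin ler_expR.
  have := sqr_ge0 (v / 2 - (Num.sqrt n%:R - a)); rewrite sqrrB; nra.
apply: le_trans (probability_le1 _ _) _.
  apply: measurable_lt_fun => //; apply: measurableT_comp; last exact: measurable_sumsq.
  exact: continuous_measurable_fun (@sqrt_continuous R).
rewrite lee_fin -[leLHS]expR0 ler_expR.
have : 0 <= v * (a - Num.sqrt n%:R) by rewrite mulr_ge0// subr_ge0.
have := sqr_ge0 v; lra.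
Qed.

End chi_lower_tail.

(** * Exponential moments of the distance, and comparison of the two norms *)

Section distance_mgf.
Context {R : realType} (N : nat) (K : {set 'I_N}) (tau : R).

(** Squared distance from [h] to the points that are at least tau on K and at most tau off K, a
    translate by tau of the polar of the sign cone. *)
Definition cone_dist2 (h : N.-tuple R) : R :=
  \sum_j (if j \in K then pos (tau - tnth h j) else pos (tnth h j - tau)) ^+ 2.

Definition mean_cone_dist2 : R := #|K|%:R * mu1 tau + (N - #|K|)%:R * mu1 (- tau).

Lemma cone_dist2_ge0 h : 0 <= cone_dist2 h.
Proof. by apply: sumr_ge0 => j _; exact: sqr_ge0. Qed.

Lemma measurable_cone_dist2 : measurable_fun setT cone_dist2.
Proof.
apply: measurable_sum => j; apply: measurable_funX; case: (j \in K).
  by apply: measurable_maxr => //; apply: measurable_funB => //; exact: measurable_tnth.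
by apply: measurable_maxr => //; apply: measurable_funB => //; exact: measurable_tnth.
Qed.

Lemma integral_expR_cone_dist2 (l : R) : 0 < l -> 2 * l < 1 ->
  (\int[gaussN N]_h (expR (l * cone_dist2 h))%:E <=
   (expR (l / (1 - 2 * l) * mean_cone_dist2))%:E)%E.
Proof.
move=> l0 l1.
have q0 : 0 < 1 - 2 * l by lra.
pose eta := (Num.sqrt (1 - 2 * l))^-1.
have eta0 : 0 < eta by rewrite invr_gt0 sqrtr_gt0.
have eta2 : eta ^+ 2 = (1 - 2 * l)^-1 by rewrite exprVn sqr_sqrtr// ltW.
have etaE : eta ^+ 2 * (1 - 2 * l) = 1 by rewrite eta2 mulVf// gt_eqF.
pose g (b x : R) := (expR (l * pos (x + b) ^+ 2))%:E.
have mg b : measurable_fun setT (g b) by apply/measurable_EFinP; exact: measurable_excess.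
have g0 b x : (0 <= g b x)%E by rewrite lee_fin expR_ge0.
pose f (j : 'I_N) (x : R) := if j \in K then g tau (- x) else g (- tau) x.
have mf j : measurable_fun setT (f j).
  rewrite /f; case: (j \in K) => //.
  exact: (measurableT_comp (mg tau) (@oppr_measurable R setT)).
have f0 j x : (0 <= f j x)%E by rewrite /f; case: (j \in K).
have -> : (\int[gaussN N]_h (expR (l * cone_dist2 h))%:E =
   \int[gaussN N]_h \prod_j f j (tnth h j))%E.
  apply: eq_integral => h _; rewrite /cone_dist2 mulr_sumr expR_sum -prodEFin.
  by apply: eq_bigr => j _; rewrite /f /g; case: ifP => _ //; rewrite [- _ + _]addrC.
rewrite gaussN_prod//.
have fj j : (\int[stdG]_x f j x <=
   (expR (l * eta ^+ 2 * (if j \in K then mu1 tau else mu1 (- tau))))%:E)%E.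
  rewrite /f; case: (j \in K); last exact: integral_excess_le.
  by rewrite (ge0_integral_stdGN (mg tau) (g0 tau)); exact: integral_excess_le.
apply: (@le_trans _ _ (\prod_(j < N)
    (expR (l * eta ^+ 2 * (if j \in K then mu1 tau else mu1 (- tau))))%:E)%E).
  apply: (@proj2 (0 <= \prod_(j < N) \int[stdG]_x f j x)%E).
  apply: (big_ind2 (fun u v => (0 <= u)%E /\ (u <= v)%E)).
  - by rewrite lexx.
  - move=> u u' v v' [u0 uu'] [v0 vv']; split; first exact: mule_ge0.
    exact: lee_pmul.
  - by move=> j _; split; [exact: integral_ge0|exact: fj].
rewrite prodEFin -expR_sum -mulr_sumr lee_fin ler_expR eta2.
suff -> : \sum_(j < N) (if j \in K then mu1 tau else mu1 (- tau)) = mean_cone_dist2 by [].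
have cK : (#|[pred j | j \notin K]| = N - #|K|)%N.
  have := cardC (mem K); rewrite card_ord => E.
  by rewrite -[X in (X - _)%N]E addKn; apply: eq_card => j; rewrite !inE.
rewrite /mean_cone_dist2; move: (mu1 tau) (mu1 (- tau)) => p q.
by rewrite big_if/= !sumr_const cK !mulr_natl.
Qed.

Lemma mean_cone_dist2_ge0 : 0 <= mean_cone_dist2.
Proof. by rewrite addr_ge0// mulr_ge0// mu1_ge0. Qed.

(* Linearize d = sqrt(d^2) by AM-GM, d <= d^2 / (2 c) + c / 2, at c = v + sqrt D. *)
Lemma integral_expR_cone_dist (v D : R) : 0 < v -> 0 < D -> mean_cone_dist2 <= D ->
  (\int[gaussN N]_h (expR (v * Num.sqrt (cone_dist2 h)))%:E <=
   (expR (v * Num.sqrt D + v ^+ 2 / 2))%:E)%E.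
Proof.
move=> v0 D0 meanD.
pose s := Num.sqrt D; have s0 : 0 < s by rewrite sqrtr_gt0.
have sD : s ^+ 2 = D by rewrite sqr_sqrtr// ltW.
pose c := v + s; have c0 : 0 < c by rewrite addr_gt0.
pose l := v / (2 * c).
have l0 : 0 < l by rewrite divr_gt0// mulr_gt0.
have lE : 1 - 2 * l = s / c by rewrite /l /c; field; rewrite gt_eqF.
have l1 : 2 * l < 1 by rewrite -subr_gt0 lE divr_gt0.
have mE : measurable_fun setT (fun h => (expR (l * cone_dist2 h))%:E).
  apply/measurable_EFinP; apply: measurableT_comp => //; apply: measurable_funM => //.
  exact: measurable_cone_dist2.
apply: (@le_trans _ _ (\int[gaussN N]_h ((expR (v * c / 2))%:E * (expR (l * cone_dist2 h))%:E))%E).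
  apply: ge0_le_integral.
  - exact: measurableT.
  - by move=> h _; rewrite lee_fin expR_ge0.
  - apply/measurable_EFinP; apply: measurableT_comp => //; apply: measurable_funM => //.
    apply: measurableT_comp; last exact: measurable_cone_dist2.
    exact: continuous_measurable_fun (@sqrt_continuous R).
  - exact: emeasurable_funM.
  move=> h _; rewrite -EFinM lee_fin -expRD ler_expR.
  set r := Num.sqrt _; have rE : r ^+ 2 = cone_dist2 h by rewrite sqr_sqrtr// cone_dist2_ge0.
  rewrite -rE -subr_ge0.
  have -> : v * c / 2 + l * r ^+ 2 - v * r = v / (2 * c) * (r - c) ^+ 2.
    by rewrite /l; field; rewrite gt_eqF.
  by rewrite mulr_ge0 ?sqr_ge0// ltW.
rewrite ge0_integralZl; [|exact: measurableT|exact: mE| |]; last 2 first.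
- by move=> h _; rewrite lee_fin expR_ge0.
- by rewrite lee_fin expR_ge0.
apply: (le_trans (lee_wpmul2l _ (integral_expR_cone_dist2 l0 l1))).
  by rewrite lee_fin expR_ge0.
rewrite -EFinM lee_fin -expRD ler_expR lE.
have h : l / (s / c) * mean_cone_dist2 <= l / (s / c) * D.
  by rewrite ler_wpM2l// divr_ge0// ltW// divr_gt0.
apply: (le_trans (lerD (lexx _) h)); rewrite le_eqVlt; apply/orP; left; apply/eqP.
rewrite -/s -sD /l /c; field.
by rewrite gt_eqF//= gt_eqF// addr_gt0.
Qed.

(* [norm_lower_tail] applied at a = (d - b) / kap, for each value d of the distance. *)
Lemma gaussian_norm_vs_cone_dist m (v D kap b : R) : (0 < m)%N -> 0 < v ->
  0 < D -> mean_cone_dist2 <= D -> 0 < kap -> kap <= 1 ->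
  (\int[gaussN m]_x \int[gaussN N]_y
    (\1_[set z : m.-tuple R * N.-tuple R |
       kap * Num.sqrt (sumsq z.1) < Num.sqrt (cone_dist2 z.2) - b] (x, y))%:E <=
   (expR (3 / 4 * v ^+ 2 - v * (kap * Num.sqrt m%:R + b - Num.sqrt D)))%:E)%E.
Proof.
move=> m0 v0 D0 meanD k0 k1; set E := [set z | _].
have mE : measurable E.
  apply: measurable_lt_fun.
    apply: measurable_funM => //; apply: measurableT_comp.
      exact: continuous_measurable_fun (@sqrt_continuous R).
    exact: (measurableT_comp (@measurable_sumsq R m)).
  apply: measurable_funB => //; apply: measurableT_comp.
    exact: continuous_measurable_fun (@sqrt_continuous R).
  exact: (measurableT_comp measurable_cone_dist2).
have mI : measurable_fun setT (fun z => (\1_E z : R)%:E).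
  by apply/measurable_EFinP; exact: measurable_indic.
have F := @fubini_tonelli _ _ _ _ R (gaussN m) (gaussN N) _ mI.
apply: (@le_trans _ _ (\int[gaussN N]_y \int[gaussN m]_x (\1_E (x, y))%:E)%E).
  by rewrite le_eqVlt F ?eqxx.
pose q := v ^+ 2 / 4 - v * (kap * Num.sqrt m%:R + b).
have mV : measurable_fun setT (fun h => (expR (v * Num.sqrt (cone_dist2 h)))%:E).
  apply/measurable_EFinP; apply: measurableT_comp => //; apply: measurable_funM => //.
  apply: measurableT_comp; last exact: measurable_cone_dist2.
  exact: continuous_measurable_fun (@sqrt_continuous R).
apply: (@le_trans _ _ (\int[gaussN N]_h ((expR q)%:E * (expR (v * Num.sqrt (cone_dist2 h)))%:E))%E).
  apply: ge0_le_integral.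
  - exact: measurableT.
  - by move=> y _; apply: integral_ge0.
  - exact: (@measurable_fun_fubini_tonelli_G _ _ _ _ _ (gaussN m) _ mI).
  - exact: emeasurable_funM.
  move=> h _; rewrite -EFinM -expRD.
  have -> : (\int[gaussN m]_x (\1_E (x, h))%:E =
    gaussN m [set t | (Num.sqrt (sumsq t) < (Num.sqrt (cone_dist2 h) - b) / kap)%R])%E.
    set A := [set t | _]; have mA : measurable A.
      apply: measurable_lt_fun => //; apply: measurableT_comp; last exact: measurable_sumsq.
      exact: continuous_measurable_fun (@sqrt_continuous R).
    transitivity (\int[gaussN m]_x (\1_A x)%:E)%E; last by rewrite integral_indic ?setIT.
    apply: eq_integral => x _; rewrite !indicE; congr (_%:R%:E); congr nat_of_bool.
    by apply/idP/idP; rewrite !inE /E /A /= ltr_pdivlMr// mulrC.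
  have kv : 0 <= kap * v by rewrite mulr_ge0 ?ltW.
  apply: le_trans (norm_lower_tail _ m0 kv) _; rewrite lee_fin ler_expR.
  have -> : kap * v * (Num.sqrt m%:R - (Num.sqrt (cone_dist2 h) - b) / kap) =
    v * (kap * Num.sqrt m%:R + b) - v * Num.sqrt (cone_dist2 h).
    by field; rewrite gt_eqF.
  have : (kap * v) ^+ 2 <= v ^+ 2.
    rewrite exprMn ler_piMl ?sqr_ge0// exprn_ile1//; exact: ltW.
  rewrite /q; lra.
rewrite ge0_integralZl; [|exact: measurableT|exact: mV| |]; last 2 first.
- by move=> h _; rewrite lee_fin expR_ge0.
- by rewrite lee_fin expR_ge0.
apply: (le_trans (lee_wpmul2l _ (integral_expR_cone_dist v0 D0 meanD))).
  by rewrite lee_fin expR_ge0.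
rewrite -EFinM lee_fin -expRD ler_expR /q; lra.
Qed.

End distance_mgf.

(** * Nets and the descent cone *)

Section nets.
Context {R : realType}.

(** Grid cells that meet [P] index the net and each contributes one of its own points. The net thus
    lies in [P], which keeps its points in the cone, and the number of cells bounds its size. *)
Lemma finite_net n (P : ('I_n -> R) -> Prop) (e : R) : 0 < e ->
  (forall x, P x -> forall j, `|x j| <= 1) ->
  exists (I : finType) (u : I -> 'I_n -> R), [/\ forall i, P (u i),
    #|I|%:R <= (2 / e + 1) ^+ n &
    forall x, P x -> exists i, forall j, `|x j - u i j| <= e].
Proof.
move=> e0 P1.
pose q := (Num.truncn (2 / e)).+1.
pose code (x : 'I_n -> R) : {ffun 'I_n -> 'I_q} := [ffun j => inord (Num.truncn ((x j + 1) / e))].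
(* Only occupied cells are kept, so that a representative in [P] exists for each index. *)
pose I : finType := {c : {ffun 'I_n -> 'I_q} | `[< exists2 x, P x & code x = c >]}.
have ex (i : I) : {x | P x & code x = sval i}.
  by apply: cid2; apply/asboolP; exact: svalP i.
exists I, (fun i => s2val (ex i)); split => [i||x Px]; first by case: (ex i).
  apply: (@le_trans _ _ (q ^ n)%:R).
    rewrite ler_nat card_sig; apply: leq_trans (max_card _) _.
    by rewrite card_ffun !card_ord.
  rewrite natrX lerXn2r ?nnegrE ?addr_ge0 ?divr_ge0 ?(ltW e0)//.
  by rewrite /q -natr1 lerD2r truncn_le// divr_ge0 ?(ltW e0).
have Ic : `[< exists2 y, P y & code y = code x >] by apply/asboolP; exists x.
exists (exist _ (code x) Ic) => j.
case: (ex _) => y Py /= /ffunP/(_ j); rewrite !ffunE.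
have b z : P z -> 0 <= (z j + 1) / e /\ (Num.truncn ((z j + 1) / e) < q)%N.
  move=> /P1/(_ j); rewrite ler_norml => /andP[z1 z2].
  have h : 0 <= (z j + 1) / e by rewrite divr_ge0 ?(ltW e0)//; lra.
  split=> //; rewrite ltnS; apply: le_truncn; rewrite ler_pM2r ?invr_gt0//; lra.
have [x0 xq] := b _ Px; have [y0 yq] := b _ Py.
move=> /(congr1 val); rewrite /= !inordK// => E.
have /andP[xl xu] := truncn_itv x0; have /andP[yl yu] := truncn_itv y0.
rewrite E in yl yu.
move: (Num.truncn _) xl xu yl yu => k xl xu yl yu.
rewrite -natr1 in xu yu.
have -> : x j - y j = ((x j + 1) / e - (y j + 1) / e) * e by field; rewrite gt_eqF.
rewrite normrM (gtr0_norm e0) ler_piMl ?(ltW e0)// ler_norml; lra.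
Qed.

Lemma sqr_coord_le n (x : 'I_n -> R) j : x j ^+ 2 <= \sum_i x i ^+ 2.
Proof. by rewrite (bigD1 j)//= lerDl sumr_ge0// => i _; exact: sqr_ge0. Qed.

Lemma unit_coord_le1 n (x : 'I_n -> R) : \sum_i x i ^+ 2 = 1 -> forall j, `|x j| <= 1.
Proof.
move=> x1 j; have := sqr_coord_le x j; rewrite x1 -real_normK ?num_real// => h.
by rewrite -(@expr_le1 _ 2)// normr_ge0.
Qed.

Lemma normalize_unit n (g : 'I_n -> R) : 0 < \sum_i g i ^+ 2 ->
  \sum_i (g i / Num.sqrt (\sum_i g i ^+ 2)) ^+ 2 = 1.
Proof.
move=> g0; under eq_bigr do rewrite expr_div_n.
by rewrite -mulr_suml sqr_sqrtr ?divff ?gt_eqF// ltW.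
Qed.

(** If w is coordinatewise within e of g / |g|, then 2 - 2 <w, g / |g|> <= n e^2. The choice of [e]
    makes this at most 1 - kap, hence <w, g / |g|> >= kap. *)
Lemma norming_net n (kap : R) : (0 < n)%N -> kap < 1 ->
  exists (J : finType) (w : J -> 'I_n -> R), (forall y, \sum_i w y i ^+ 2 = 1) /\
    forall g, exists y, kap * Num.sqrt (\sum_i g i ^+ 2) <= \sum_i w y i * g i.
Proof.
case: n => // n _ k1.
pose c : R := (1 - kap) / n.+1%:R.
have c0 : 0 < c by rewrite divr_gt0 ?ltr0n//; lra.
pose e : R := Num.min 1 c.
have e0 : 0 < e by rewrite lt_min ltr01.
have e1 : e <= 1 by rewrite ge_min lexx.
have ec : e <= c by rewrite ge_min lexx orbT.
have [J [w [w1 _ hw]]] := finite_net (P := fun x : 'I_n.+1 -> R => \sum_i x i ^+ 2 = 1) e0 (@unit_coord_le1 _).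
exists J, w; split => // g.
have [g0|g0] := leP (\sum_i g i ^+ 2) 0.
  have gz i : g i = 0.
    have := le_trans (sqr_coord_le g i) g0.
    by rewrite real_exprn_even_le0//= ?num_real// => /eqP.
  (* For g = 0 any member of the net works; a basis vector shows that there is one. *)
  have [|y _] := hw (fun i => (i == ord0)%:R).
    rewrite (bigD1 ord0)//= expr1n big1 ?addr0// => i /negbTE ->.
    by rewrite expr0n.
  exists y; rewrite !big1; [|by move=> i _; rewrite gz mulr0|by move=> i _; rewrite gz expr0n].
  by rewrite sqrtr0 mulr0.
set r := Num.sqrt _; have r0 : 0 < r by rewrite sqrtr_gt0.
have [y hy] := hw _ (normalize_unit g0); exists y.
have -> : \sum_i w y i * g i = (\sum_i w y i * (g i / r)) * r.
  by rewrite mulr_suml; apply: eq_bigr => i _; field; rewrite gt_eqF.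
rewrite ler_wpM2r ?(ltW r0)//.
have E : \sum_i (g i / r - w y i) ^+ 2 = 2 - 2 * \sum_i w y i * (g i / r).
  rewrite (eq_bigr (fun i => (g i / r) ^+ 2 + w y i ^+ 2 - 2 * (w y i * (g i / r)))).
    by rewrite sumrB big_split/= normalize_unit// w1 -mulr_sumr.
  by move=> i _; ring.
have : \sum_i (g i / r - w y i) ^+ 2 <= \sum_(i < n.+1) c.
  apply: ler_sum => i _; have := hy i; rewrite -/r -real_normK ?num_real// => h.
  by have := normr_ge0 (g i / r - w y i); nra.
rewrite E sumr_const card_ord -[c *+ _]mulr_natr divfK ?pnatr_eq0//.
lra.
Qed.

End nets.

Section descent_cone.
Context {R : realType} (N : nat) (K : {set 'I_N}).

Definition desc_cone (z : 'I_N -> R) : Prop :=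
  [/\ forall j, j \in K -> z j <= 0, forall j, j \notin K -> 0 <= z j & \sum_j z j <= 0].

Lemma desc_cone_scale (c : R) z : 0 <= c -> desc_cone z -> desc_cone (fun j => z j * c).
Proof.
move=> c0 [h1 h2 h3]; split.
- by move=> j jK; rewrite mulr_le0_ge0 ?h1.
- by move=> j jK; rewrite mulr_ge0 ?h2.
- by rewrite -mulr_suml mulr_le0_ge0.
Qed.

(** As tau >= 0 and sum u <= 0, subtracting tau from each h_j does not decrease the pairing. The
    signs of u then allow only the part [p] of h - tau to be kept, and Cauchy-Schwarz concludes. *)
Lemma desc_cone_dot (tau : R) (h : N.-tuple R) u : 0 <= tau -> desc_cone u ->
  \sum_j u j ^+ 2 = 1 -> \sum_j u j * tnth h j <= Num.sqrt (cone_dist2 K tau h).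
Proof.
move=> t0 [u1 u2 u3] un.
pose p j := if j \in K then - pos (tau - tnth h j) else pos (tnth h j - tau).
have pE : cone_dist2 K tau h = \sum_j p j ^+ 2.
  by apply: eq_bigr => j _; rewrite /p; case: ifP => // _; rewrite sqrrN.
apply: (@le_trans _ _ (\sum_j u j * p j)).
  apply: (@le_trans _ _ (\sum_j u j * (tnth h j - tau))).
    under [leRHS]eq_bigr do rewrite mulrBr.
    by rewrite sumrB -mulr_suml; nra.
  apply: ler_sum => j _; rewrite /p; case: ifPn => jK.
    have := u1 _ jK; have [[? ->]|[? ->]] := posP (tau - tnth h j); nra.
  have := u2 _ jK; have [[? ->]|[? ->]] := posP (tnth h j - tau); nra.
rewrite pE; set s := \sum_j p j ^+ 2.
have s0 : 0 <= s by apply: sumr_ge0 => j _; exact: sqr_ge0.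
have [se|sp] := leP s 0.
  rewrite big1 ?sqrtr_ge0// => j _.
  have := le_trans (sqr_coord_le p j) se.
  by rewrite real_exprn_even_le0//= ?num_real// => /eqP ->; rewrite mulr0.
have r0 : 0 < Num.sqrt s by rewrite sqrtr_gt0.
rewrite -[leRHS]mul1r -ler_pdivrMr// mulr_suml.
under eq_bigr do rewrite -mulrA.
exact: (dot_unit_le1 un (normalize_unit sp)).
Qed.

(** A kernel vector in the cone, once normalized, is close to a net point, whose image is then small
    because the entries are bounded by [rad]. Escape on the net therefore implies escape on the
    whole cone. *)
Lemma desc_cone_escape m (a : 'I_m -> 'I_N -> R) (rad eta e : R)
  (I : finType) (u : I -> 'I_N -> R) :
  (forall i j, `|a i j| <= rad) ->
  (forall x, desc_cone x -> \sum_j x j ^+ 2 = 1 -> exists i, forall j, `|x j - u i j| <= e) ->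
  m%:R * (N%:R * (rad * e)) ^+ 2 <= eta ->
  (forall x, eta < \sum_i (\sum_j a i j * u x j) ^+ 2) ->
  forall z, desc_cone z -> (exists j, z j != 0) -> ~ (forall i, \sum_j a i j * z j = 0).
Proof.
move=> arad hu small hF z zC [j0 zj0] az.
have s0 : 0 < \sum_j z j ^+ 2.
  by apply: lt_le_trans (sqr_coord_le z j0); rewrite exprn_even_gt0.
set r := Num.sqrt (\sum_j z j ^+ 2).
have ri : 0 <= r^-1 by rewrite invr_ge0 sqrtr_ge0.
have [x hx] := hu _ (desc_cone_scale ri zC) (normalize_unit s0).
have := hF x; apply/negP; rewrite -leNgt; apply: le_trans small.
have -> : m%:R * (N%:R * (rad * e)) ^+ 2 = \sum_(i < m) (\sum_(j < N) rad * e) ^+ 2.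
  by rewrite !sumr_const !card_ord !mulr_natl.
apply: ler_sum => i _.
have -> : \sum_j a i j * u x j = - \sum_j a i j * (z j / r - u x j).
  under [in RHS]eq_bigr do rewrite mulrBr mulrA.
  by rewrite sumrB -mulr_suml az mul0r sub0r opprK.
rewrite sqrrN -real_normK ?num_real// lerXn2r ?nnegrE//.
  apply: sumr_ge0 => j _; rewrite mulr_ge0//; first exact: le_trans (arad i j).
  exact: le_trans (hx j).
by apply: le_trans (ler_norm_sum _ _ _) _; apply: ler_sum => j _; rewrite normrM ler_pM.
Qed.

(** A feasible competitor of no larger l1 norm differs from the indicator by a kernel vector: the
    box constraints give its signs, and the norm inequality gives its nonpositive sum. The factor 1
    / sqrt m cancels. *)
Lemma unique_solution_of_escape m (T : Type) (a : 'I_m -> 'I_N -> T -> R) (omega : T) :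
  (0 < m)%N ->
  (forall z, desc_cone z -> (exists j, z j != 0) -> ~ (forall i, \sum_j a i j omega * z j = 0)) ->
  Pbin_unique_solution (gauss_mx a omega) (gauss_mx a omega *m ind_vec K) (ind_vec K).
Proof.
move=> m0 esc; split.
  by split => // j; rewrite mxE; case: (j \in K); rewrite ?lexx ler01.
move=> x [Ax x01] xK; rewrite ltNge; apply/negP => l1x.
pose z j := x j 0 - (j \in K)%:R.
apply: (esc z).
- split.
  + by move=> j jK; rewrite /z jK subr_le0; case/andP: (x01 j).
  + by move=> j jK; rewrite /z (negbTE jK) subr0; case/andP: (x01 j).
  + rewrite /z sumrB subr_le0.
    move: l1x; rewrite /l1norm (eq_bigr (fun j => x j 0)); last first.
      by move=> j _; rewrite ger0_norm//; case/andP: (x01 j).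
    rewrite [X in _ <= X -> _](eq_bigr (fun j => (j \in K)%:R))// => j _.
    by rewrite mxE ger0_norm.
- apply: contrapT => h; apply: xK; apply/matrixP => j k; rewrite (ord1 k) mxE.
  apply/eqP; rewrite -subr_eq0; apply/eqP; apply: contrapT => zj; apply: h.
  by exists j; apply/eqP.
- move=> i; have := congr1 (fun M : 'cV[R]_m => M i 0) Ax; rewrite !mxE => E.
  have r0 : (Num.sqrt m%:R)^-1 != 0 :> R by rewrite invr_eq0 gt_eqF// sqrtr_gt0 ltr0n.
  apply: (mulfI r0); rewrite mulr0 mulr_sumr.
  transitivity (\sum_j (gauss_mx a omega i j * x j 0 - gauss_mx a omega i j * ind_vec K j 0)).
    by apply: eq_bigr => j _; rewrite /z !mxE; ring.
  by rewrite sumrB E subrr.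
Qed.

End descent_cone.

(** * Probability of failure *)

Section escape_probability.
Context {R : realType} (m N : nat) (K : {set 'I_N}).
Variables (tau v D kap b : R).
Hypotheses (m0 : (0 < m)%N) (tau0 : 0 <= tau) (v0 : 0 < v) (D0 : 0 < D).
Hypotheses (meanD : mean_cone_dist2 K tau <= D) (kap0 : 0 < kap) (kap1 : kap < 1).

(** With <w, g> >= kap |g| for some w of the norming net and <h, u> <= d(h) on the cone, the event
    of [gordon_escape] forces kap |g| < d(h) - (b - eta - del). *)
Lemma escape_probability (eta del : R) (I : finType) (u : I -> 'I_N -> R) :
  0 <= eta -> 0 < del ->
  (forall x, \sum_j u x j ^+ 2 = 1) -> (forall x, desc_cone K (u x)) ->
  ((Phi (- b))%:E * gaussN _ [set s | exists x, (\sum_(i < m) apply_mx s (u x) i ^+ 2 <= eta ^+ 2)%R] <=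
   (expR (3 / 4 * v ^+ 2 - v * (kap * Num.sqrt m%:R + (b - eta - del) - Num.sqrt D)))%:E)%E.
Proof.
move=> eta0 del0 u1 uC.
have [J [w [w1 hw]]] := norming_net m0 kap1.
have := gordon_escape u1 w1 b del0 eta0.
rewrite (_ : [set g0 : R | _] = `]-oo, (- b)]%classic); last first.
  by apply/seteqP; split => x /=; rewrite in_itv.
rewrite -PhiE => /le_trans; apply.
apply: le_trans (gaussian_norm_vs_cone_dist (b - eta - del) m0 v0 D0 meanD kap0 (ltW kap1)).
set E := [set z : _ * _ | _]; set A := [set t | _].
have mA : measurable A.
  by apply: (@measurable_exists_forall _ _ _ I J (fun x y t => gordonY u w t x y) `]-oo, (eta - b + del)[%classic) => // x y; exact: measurable_gordonY.
have mE : measurable E.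
  apply: measurable_lt_fun.
    apply: measurable_funM => //; apply: measurableT_comp.
      exact: continuous_measurable_fun (@sqrt_continuous R).
    exact: (measurableT_comp (@measurable_sumsq R m)).
  apply: measurable_funB => //; apply: measurableT_comp.
    exact: continuous_measurable_fun (@sqrt_continuous R).
  exact: (measurableT_comp (measurable_cone_dist2 K tau)).
have -> : gaussN (m + N) A = (\int[gaussN (m + N)]_t (\1_A t)%:E)%E.
  by rewrite integral_indic ?setIT.
have mIA : measurable_fun setT (fun t : (m + N).-tuple R => (\1_A t : R)%:E).
  by apply/measurable_EFinP; exact: measurable_indic.
have mIE : measurable_fun setT (fun z : m.-tuple R * N.-tuple R => (\1_E z : R)%:E).
  by apply/measurable_EFinP; exact: measurable_indic.
rewrite gaussN_cat; [|exact: mIA|by move=> t; rewrite lee_fin].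
have mIA' := measurableT_comp mIA (@measurable_tcat R m N).
apply: ge0_le_integral.
- exact: measurableT.
- by move=> x _; apply: integral_ge0 => y _; rewrite lee_fin.
- by apply: (@measurable_fun_fubini_tonelli_F _ _ _ _ _ (gaussN N) _ mIA') => z; rewrite lee_fin.
- by apply: (@measurable_fun_fubini_tonelli_F _ _ _ _ _ (gaussN N) _ mIE) => z; rewrite lee_fin.
move=> x _; apply: ge0_le_integral.
- exact: measurableT.
- by move=> y _; rewrite lee_fin.
- exact: (measurableT_comp mIA' (pair1_measurable x)).
- exact: (measurableT_comp mIE (pair1_measurable x)).
move=> y _; rewrite lee_fin !indicE.
have [/set_mem|_] := boolP (tcat (x, y) \in A); last by [].
move=> [i hi]; rewrite mem_set// /E/=.
have [j hj] := hw (fun k => tnth x k).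
have := hi j; rewrite /gordonY.
under eq_bigr do rewrite /tcat/= tnth_lshift.
under [X in _ - X]eq_bigr do rewrite /tcat/= tnth_rshift.
have := desc_cone_dot y tau0 (uC i) (u1 i).
rewrite /sumsq; lra.
Qed.

End escape_probability.

Section gaussian_tail.
Context {R : realType}.

(** Markov's inequality for exp |s|_1. *)
Lemma gaussN_bounded n (e : R) : 0 < e -> exists rad : R,
  (gaussN n [set s | (rad < nrm1 s)%R] <= e%:E)%E.
Proof.
move=> e0; have [M hM] := @integral_expR_nrm1 R n.
pose M' := Num.max M 1.
have M0 : 0 < M' by rewrite lt_max ltr01 orbT.
exists (ln (M' / e)).
have mA : measurable [set s : n.-tuple R | ln (M' / e) < nrm1 s].
  by apply: measurable_lt_fun => //; exact: measurable_nrm1.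
have q0 : 0 < M' / e by rewrite divr_gt0.
rewrite -(@lee_pmul2l _ (M' / e)%:E) ?lte_fin//.
rewrite -EFinM divfK ?gt_eqF//.
apply: (@le_trans _ _ M%:E); last by rewrite lee_fin le_max lexx.
apply: le_trans hM.
set A := [set s | _] in mA *.
have mI : measurable_fun setT (fun s : n.-tuple R => (\1_A s : R)%:E).
  by apply/measurable_EFinP; exact: measurable_indic.
have -> : gaussN n A = (\int[gaussN n]_t (\1_A t)%:E)%E.
  by rewrite integral_indic ?setIT.
rewrite -ge0_integralZl; [|exact: measurableT|exact: mI|by move=> s _; rewrite lee_fin|by rewrite lee_fin ltW].
apply: ge0_le_integral.
- exact: measurableT.
- by move=> s _; rewrite mule_ge0// lee_fin// ltW.
- exact: emeasurable_funM.
- by apply/measurable_EFinP; apply: measurableT_comp => //; exact: measurable_nrm1.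
move=> s _; rewrite -EFinM lee_fin indicE.
have [/set_mem|_] := boolP (s \in A); last by rewrite mulr0 expR_ge0.
by rewrite mulr1 /A/= => h; rewrite -[leLHS]lnK ?posrE// ler_expR ltW.
Qed.

End gaussian_tail.

Section law_of_matrix.
Context {R : realType} (m N : nat) d (T : measurableType d) (P : probability T R).
Variable a : 'I_m -> 'I_N -> {RV P >-> R}.
Hypotheses (aG : forall i j, std_normal_rv (a i j)) (aI : mutually_independent a).

Definition entries (w : T) : #|{: 'I_m * 'I_N}|.-tuple R :=
  [tuple a (enum_val k).1 (enum_val k).2 w | k < _].

Lemma entry_entries w i j : entry (entries w) i j = a i j w.
Proof. by rewrite /entry tnth_mktuple enum_rankK. Qed.

Lemma measurable_entries : measurable_fun setT entries.
Proof. by apply: measurable_mktuple => k. Qed.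

Lemma stdG_normal_prob (B : set R) : stdG B = normal_prob 0 1 B.
Proof. by rewrite /stdG /distribution /= /pushforward preimage_id. Qed.

Lemma law_entries A : measurable A -> P (entries @^-1` A) = gaussN _ A.
Proof.
move=> mA; apply: eq_law => //; first exact: measurable_entries.
move=> B mB.
pose B' i j := B (enum_rank (i, j)).
have mB' i j : measurable (B' i j) by exact: mB.
have -> : entries @^-1` box B =
    \bigcap_(ij in [set: 'I_m * 'I_N]) (a ij.1 ij.2 @^-1` B' ij.1 ij.2).
  apply/seteqP; split => w /=.
    move=> h [i j] _ /=; have := h (enum_rank (i, j)).
    by rewrite tnth_mktuple enum_rankK.
  move=> h k; have := h (enum_val k) Logic.I.
  by rewrite /= /B' -surjective_pairing enum_valK tnth_mktuple.
rewrite (aI mB') -prodEFin.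
rewrite (reindex (@enum_rank {: 'I_m * 'I_N})) /=; last first.
  by apply: onW_bij; exists enum_val; [exact: enum_rankK|exact: enum_valK].
under eq_bigr do rewrite -prodEFin.
rewrite pair_bigA/=; apply: eq_bigr => -[i j] _ /=.
rewrite fineK; last by rewrite fin_num_measure// -[X in measurable X]setTI; apply: measurable_funPT.
by rewrite aG// stdG_normal_prob.
Qed.

End law_of_matrix.

Section unique_solution_event.
Context {R : realType} (m N : nat) (K : {set 'I_N}).
Context d (T : measurableType d) (P : probability T R).
Variable a : 'I_m -> 'I_N -> {RV P >-> R}.
Hypotheses (aG : forall i j, std_normal_rv (a i j)) (aI : mutually_independent a).
Variables (tau v D kap b : R).
Hypotheses (m0 : (0 < m)%N) (tau0 : 0 <= tau) (v0 : 0 < v) (D0 : 0 < D).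
Hypotheses (meanD : mean_cone_dist2 K tau <= D) (kap0 : 0 < kap) (kap1 : kap < 1).

(** F excludes two measurable bad events, large entries (cost [e]) and a net vector with small
    image. Outside them [desc_cone_escape] applies. *)
Lemma unique_solution_event (eta del e : R) : 0 < eta -> 0 < del -> 0 < e -> 0 < Phi (- b) ->
  exists F : set T, [/\ measurable F,
    F `<=` [set omega | Pbin_unique_solution (gauss_mx a omega)
                          (gauss_mx a omega *m ind_vec K) (ind_vec K)] &
    (P (~` F) <= (e + expR (3 / 4 * v ^+ 2 -
        v * (kap * Num.sqrt m%:R + (b - eta - del) - Num.sqrt D)) / Phi (- b))%:E)%E].
Proof.
move=> eta0 del0 e0 Pb0.
have [rad hrad] := @gaussN_bounded R #|{: 'I_m * 'I_N}| _ e0.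
(* With mesh eta / c the error m N |rad| eta / c stays below eta; the 1 keeps c positive. *)
pose c : R := 1 + m%:R * (N%:R * `|rad|).
have c0 : 0 < c by rewrite ltr_wpDr// !mulr_ge0.
have h0 : 0 < eta / c by rewrite divr_gt0.
pose Q (x : 'I_N -> R) := desc_cone K x /\ \sum_j x j ^+ 2 = 1.
have Q1 x : Q x -> forall j, `|x j| <= 1 by case=> _; exact: unit_coord_le1.
have [I [u [Qu _ hu]]] := finite_net h0 Q1.
have small : m%:R * (N%:R * (rad * (eta / c))) ^+ 2 <= eta ^+ 2.
  apply: (@le_trans _ _ ((m%:R * (N%:R * (rad * (eta / c)))) ^+ 2)).
    rewrite [leRHS]exprMn ler_wpM2r ?sqr_ge0//.
    by rewrite expr2 ler_peMl// ler1n.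
  rewrite -real_normK ?num_real// lerXn2r ?nnegrE ?(ltW eta0)//.
  rewrite normrM normr_nat normrM normr_nat normrM (ger0_norm (ltW h0)).
  have -> : m%:R * (N%:R * (`|rad| * (eta / c))) = (c - 1) / c * eta.
    by rewrite [c - 1]addrC addKr; ring.
  by rewrite ler_piMl ?(ltW eta0)// ler_pdivrMr// mul1r gerBl.
pose S1 : set (#|{: 'I_m * 'I_N}|.-tuple R) := [set s | rad < nrm1 s].
pose S2 := [set s | exists x, \sum_(i < m) apply_mx s (u x) i ^+ 2 <= eta ^+ 2].
have mS1 : measurable S1 by apply: measurable_lt_fun => //; exact: measurable_nrm1.
have mS2 : measurable S2.
  rewrite (_ : S2 = [set s | exists x, forall _ : unit, `]-oo, (eta ^+ 2)]%classic (\sum_i apply_mx s (u x) i ^+ 2)]).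
    apply: (@measurable_exists_forall _ _ _ I unit (fun x _ s => \sum_i apply_mx s (u x) i ^+ 2)) => // x _.
    by apply: measurable_sum => i; apply: measurable_funX; exact: measurable_apply_mx.
  apply/seteqP; split => s /= [x h]; exists x; last by have := h tt; rewrite /= in_itv.
  by move=> _; rewrite /= in_itv.
have mS : measurable (S1 `|` S2) by exact: measurableU.
have mX A : measurable A -> measurable (entries a @^-1` A).
  by move=> mA; rewrite -[X in measurable X]setTI; apply: measurable_entries.
exists (~` (entries a @^-1` (S1 `|` S2))); split.
- by apply: measurableC; exact: mX.
- move=> w /= /not_orP[/negP nS1 nS2].
  apply: unique_solution_of_escape => //.
  apply: (@desc_cone_escape R N K m (fun i j => a i j w) rad (eta ^+ 2) (eta / c) I u).
  + move=> i j; rewrite -entry_entries; apply: le_trans (nrm1_tnth _ _) _.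
    by rewrite leNgt.
  + by move=> x xC x1; apply: hu.
  + exact: small.
  + move=> x; rewrite ltNge; apply/negP => h; apply: nS2; exists x.
    by under eq_bigr do rewrite /apply_mx; under eq_bigr do under eq_bigr do rewrite entry_entries.
- rewrite setCK law_entries//; apply: (le_trans (measureU2 _ mS1 mS2)).
  rewrite EFinD; apply: leeD; first exact: hrad.
  rewrite -(@lee_pmul2l _ (Phi (- b))%:E) ?lte_fin//.
  rewrite -EFinM mulrCA divff ?gt_eqF// mulr1.
  by apply: (escape_probability b m0 tau0 v0 D0 meanD kap0 kap1 (ltW eta0) del0) => x; case: (Qu x).
Qed.

End unique_solution_event.

Lemma measure_exists_le d (T : measurableType d) (R : realType)
  (mu : {measure set T -> \bar R}) (I : finType) (E : I -> set T) (c : R) :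
  (forall x, measurable (E x)) -> (forall x, (mu (E x) <= c%:E)%E) ->
  (mu [set s | exists x, E x s] <= (#|I|%:R * c)%:E)%E.
Proof.
move=> mE Ec.
have -> : [set s | exists x, E x s] = \big[setU/set0]_(x <- enum I) E x.
  rewrite -bigcup_seq; apply/seteqP; split => s /= [x]; last by move=> _ h; exists x.
  by move=> h; exists x => //=; rewrite mem_enum.
rewrite cardE; elim: (enum I) => [|x r IH]; first by rewrite big_nil measure0 mul0r.
rewrite big_cons/= -natr1 mulrDl mul1r addrC EFinD.
apply: le_trans (measureU2 _ _ _) _ => //; first exact: bigsetU_measurable.
apply: leeD; [exact: Ec|exact: IH].
Qed.

(** * Small balls, and triviality of the kernel when m > N *)

Section small_ball.
Context {R : realType}.

Lemma phi_le_half (x : R) : phi x <= 2^-1.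
Proof.
have p0 : 0 < pi *+ 2 :> R by rewrite pmulrn_lgt0// pi_gt0.
have s2 : 2 <= Num.sqrt (pi *+ 2) :> R.
  rewrite -[leLHS]ger0_norm// -sqrtr_sqr ler_wsqrtr//.
  by have := pi_ge2 R; rewrite mulr2n; lra.
rewrite /phi -[leRHS]mulr1; apply: ler_pM => //.
  by rewrite lef_pV2 ?posrE//; apply: lt_le_trans s2.
by rewrite -[leRHS]expR0 ler_expR; have := sqr_ge0 x; lra.
Qed.

Lemma stdG_small (c : R) : 0 < c -> (stdG `](- c)%R, c[%classic <= c%:E)%E.
Proof.
move=> c0; rewrite stdG_setE//.
apply: (@le_trans _ _ (\int[lebesgue_measure]_(x in `](- c)%R, c[) cst (2^-1)%:E x)%E).
  apply: ge0_le_integral.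
  - exact: measurable_itv.
  - by move=> x _; rewrite lee_fin phi_ge0.
  - by apply/measurable_EFinP; apply: measurable_funTS; exact: measurable_phi.
  - exact: measurable_cst.
  - by move=> x _; rewrite lee_fin phi_le_half.
have E : lebesgue_measure `](- c)%R, c[%classic = (2 * c)%:E.
  rewrite lebesgue_measure_itv/= lte_fin (_ : - c < c); last by lra.
  by rewrite -EFinD; congr (_%:E); ring.
rewrite integral_cst//; apply: (@le_trans _ _ ((2^-1)%:E * (2 * c)%:E)%E).
  by rewrite -E; exact: lexx.
by rewrite -EFinM lee_fin; lra.
Qed.

Variables (m N : nat) (u : 'I_N -> R).
Hypothesis u1 : \sum_j u j ^+ 2 = 1.

(** Signed basis vectors: bounding all pairings with them bounds every coordinate in absolute
    value. *)
Let w (y : 'I_m * bool) (i : 'I_m) : R := (-1) ^+ y.2 *+ (i == y.1).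

(* Both families have the same covariance, so that [comparison_events] transfers the law of
   [apply_mx s u] without computing it. *)
Let L1 (p : unit * ('I_m * bool)) (k : 'I_#|{: 'I_m * 'I_N}|) : R :=
  w p.2 (enum_val k).1 * u (enum_val k).2.

Let L2 (p : unit * ('I_m * bool)) (i : 'I_m) : R := w p.2 i.

Let cov12 p p' : cov L1 p p' = cov L2 p p'.
Proof.
rewrite /cov /L1 (sum_enum_pair (fun i j => w p.2 i * u j * (w p'.2 i * u j))).
apply: eq_bigr => i _; rewrite -[RHS]mulr1 -u1 mulr_sumr; apply: eq_bigr => j _.
by rewrite /L2; ring.
Qed.

Let sumw y (g : 'I_m -> R) : \sum_i w y i * g i = (-1) ^+ y.2 * g y.1.
Proof.
rewrite (bigD1 y.1)//= /w eqxx mulr1n big1 ?addr0// => i /negbTE ->.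
by rewrite mulr0n mul0r.
Qed.

Let lmap1 t x y : lmap L1 t (x, y) = (-1) ^+ y.2 * apply_mx t u y.1.
Proof.
rewrite -sumw /lmap /L1 /=.
pose f i j := w y i * u j * entry t i j.
rewrite (eq_bigr (fun k => f (enum_val k).1 (enum_val k).2)); last first.
  by move=> k _; rewrite /f /entry -surjective_pairing enum_valK.
rewrite sum_enum_pair; apply: eq_bigr => i _; rewrite /apply_mx mulr_sumr.
by apply: eq_bigr => j _; rewrite /f; ring.
Qed.

(** For a unit vector u the image has independent standard normal coordinates. The transfer widens
    the threshold from c to 2 c, and an interval of half-width 2 c has probability at most 2 c as
    [phi] <= 1/2. *)
Lemma small_ball (c : R) : 0 < c ->
  (gaussN _ [set s | forall i : 'I_m, (`|apply_mx s u i| <= c)%R] <= ((2 * c) ^+ m)%:E)%E.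
Proof.
move=> c0.
have h1 p p' : cov L2 p p' <= cov L1 p p' by rewrite cov12.
have := comparison_events h1 (fun p p' _ => cov12 p p') c c0.
rewrite (_ : [set t | exists x, forall y, lmap L1 t (x, y) <= c] =
  [set s | forall i, `|apply_mx s u i| <= c]); last first.
  apply/seteqP; split => t /=.
    move=> [x h] i; rewrite ler_norml lerNl.
    have := h (i, true); have := h (i, false); rewrite !lmap1/= expr0 expr1 mul1r mulN1r.
    by move=> -> ->.
  move=> h; exists tt => -[i b]; rewrite lmap1 /=; have := h i; rewrite ler_norml.
  by case: b; rewrite ?expr0 ?expr1; lra.
rewrite (_ : [set t | exists x, forall y, lmap L2 t (x, y) < c + c] =
  box (fun _ : 'I_m => `](- (2 * c))%R, (2 * c)[%classic)); last first.
  have lmap2 t x y : lmap L2 t (x, y) = (-1) ^+ y.2 * tnth t y.1 by rewrite -sumw.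
  apply/seteqP; split => t /=.
    move=> [x h] i; rewrite /= in_itv/=.
    have := h (i, true); have := h (i, false); rewrite !lmap2/= expr0 expr1 mul1r mulN1r.
    by lra.
  move=> h; exists tt => -[i b]; rewrite lmap2 /=; have := h i; rewrite /= in_itv/=.
  by case: b; rewrite ?expr0 ?expr1; lra.
move=> /le_trans; apply; rewrite gaussN_box//.
have c20 : 0 < 2 * c by lra.
have := stdG_small c20; have : (0 <= stdG `](- (2 * c))%R, (2 * c)%R[%classic)%E by [].
rewrite -[stdG _]fineK ?fin_num_measure// !lee_fin; move: (fine _) => A A0 Ac.
rewrite prodEFin prodr_const card_ord lee_fin.
by apply: lerXn2r; rewrite ?nnegrE//; exact: ltW.
Qed.

End small_ball.

Section unique_solution_event_tall.
Context {R : realType} (m N : nat) (K : {set 'I_N}).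
Context d (T : measurableType d) (P : probability T R).
Variable a : 'I_m -> 'I_N -> {RV P >-> R}.
Hypotheses (aG : forall i j, std_normal_rv (a i j)) (aI : mutually_independent a).

(** A net of order h^(- k) points against ball probabilities of order h^n: the product vanishes with
    h as soon as k < n. *)
Lemma net_small_ball (M h : R) (k n : nat) : 0 < M -> 0 < h -> h <= 1 -> (k < n)%N ->
  (2 / h + 1) ^+ k * (2 * (M * h)) ^+ n <= 3 ^+ k * (2 * M) ^+ n * h.
Proof.
move=> M0 h0 h1 kn.
have h2 : 2 / h + 1 <= 3 / h.
  rewrite (_ : 3 / h = 2 / h + h^-1); last by ring.
  by rewrite lerD2l invf_ge1.
have hi : 0 <= h^-1 by rewrite invr_ge0 ltW.
apply: (@le_trans _ _ ((3 / h) ^+ k * (2 * (M * h)) ^+ n)).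
  apply: ler_wpM2r; first by rewrite exprn_ge0// !mulr_ge0// ltW.
  by apply: lerXn2r; rewrite ?nnegrE// ?addr_ge0 ?mulr_ge0.
have hk : h^-1 ^+ k * h ^+ k = 1 by rewrite -exprMn mulVf ?gt_eqF// expr1n.
have hn : h ^+ n = h * (h ^+ (n - k.+1) * h ^+ k).
  by rewrite -{1}(subnK kn) exprD exprS mulrCA.
have -> : (3 / h) ^+ k * (2 * (M * h)) ^+ n = 3 ^+ k * (2 * M) ^+ n * h * h ^+ (n - k.+1).
  rewrite exprMn mulrA exprMn hn -[RHS]mulr1 -hk; ring.
rewrite ler_piMr//; last by rewrite exprn_ile1// ltW.
by rewrite !mulr_ge0 ?exprn_ge0 ?mulr_ge0// ltW.
Qed.

Lemma unique_solution_event_tall (e : R) : (N < m)%N -> 0 < e ->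
  exists F : set T, [/\ measurable F,
    F `<=` [set omega | Pbin_unique_solution (gauss_mx a omega)
                          (gauss_mx a omega *m ind_vec K) (ind_vec K)] &
    (P (~` F) <= e%:E)%E].
Proof.
move=> Nm e0.
have m0 : (0 < m)%N by exact: leq_ltn_trans Nm.
have e20 : 0 < e / 2 by rewrite divr_gt0.
have [rad hrad] := @gaussN_bounded R #|{: 'I_m * 'I_N}| _ e20.
pose M : R := 1 + m%:R * (N%:R * `|rad|).
have M0 : 0 < M by rewrite ltr_wpDr// !mulr_ge0.
pose C : R := 3 ^+ N * (2 * M) ^+ m.
have C0 : 0 < C by rewrite mulr_gt0 ?exprn_gt0// mulr_gt0.
(* The union bound of [net_small_ball] is C h, here at most e / 2; the other half pays for large
   entries. *)
pose h := Num.min 1 (e / 2 / C).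
have h0 : 0 < h by rewrite lt_min ltr01 divr_gt0.
have h1 : h <= 1 by rewrite ge_min lexx.
have hC : C * h <= e / 2 by rewrite mulrC -ler_pdivlMr// ge_min lexx orbT.
pose Q (x : 'I_N -> R) := desc_cone K x /\ \sum_j x j ^+ 2 = 1.
have Q1 x : Q x -> forall j, `|x j| <= 1 by case=> _; exact: unit_coord_le1.
have [I [u [Qu cardI hu]]] := finite_net h0 Q1.
have c0 : 0 < M * h by rewrite mulr_gt0.
have small : m%:R * (N%:R * (rad * h)) ^+ 2 <= (M * h) ^+ 2.
  apply: (@le_trans _ _ ((m%:R * (N%:R * (rad * h))) ^+ 2)).
    rewrite [leRHS]exprMn ler_wpM2r ?sqr_ge0//.
    by rewrite expr2 ler_peMl// ler1n.
  rewrite -real_normK ?num_real// lerXn2r ?nnegrE ?(ltW c0)//.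
  rewrite normrM normr_nat normrM normr_nat normrM (ger0_norm (ltW h0)).
  by rewrite !mulrA ler_wpM2r ?(ltW h0)// /M mulrA lerDr.
pose S1 : set (#|{: 'I_m * 'I_N}|.-tuple R) := [set s | rad < nrm1 s].
pose E x := [set s | forall i : 'I_m, `|apply_mx s (u x) i| <= M * h].
pose S2 := [set s | exists x, E x s].
have mS1 : measurable S1 by apply: measurable_lt_fun => //; exact: measurable_nrm1.
have mE x : measurable (E x).
  rewrite (_ : E x = [set s | exists _ : unit, forall i : 'I_m, `]-oo, (M * h)]%classic `|apply_mx s (u x) i|]).
    apply: (@measurable_exists_forall _ _ _ unit 'I_m (fun _ i s => `|apply_mx s (u x) i|)) => // _ i.
    by apply: measurableT_comp => //; exact: measurable_apply_mx.
  apply/seteqP; split => s /=; first by move=> H; exists tt => i; rewrite /= in_itv/=.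
  by move=> [_ H] i; have := H i; rewrite /= in_itv.
have mS2 : measurable S2.
  rewrite (_ : S2 = \bigcup_(x in [set: I]) E x); first exact: fin_bigcup_measurable.
  by apply/seteqP; split => s [x]; [exists x|move=> _; exists x].
have mS : measurable (S1 `|` S2) by exact: measurableU.
exists (~` (entries a @^-1` (S1 `|` S2))); split.
- apply: measurableC; rewrite -[X in measurable X]setTI; exact: measurable_entries.
- move=> w /= /not_orP[/negP nS1 nS2].
  apply: unique_solution_of_escape => //.
  apply: (@desc_cone_escape R N K m (fun i j => a i j w) rad ((M * h) ^+ 2) h I u).
  + move=> i j; rewrite -entry_entries; apply: le_trans (nrm1_tnth _ _) _.
    by rewrite leNgt.
  + by move=> x xC x1; apply: hu.
  + exact: small.
  + move=> x; have [i hi] : exists i, M * h < `|apply_mx (entries a w) (u x) i|.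
      apply: contrapT => H; apply: nS2; exists x => i.
      by rewrite leNgt; apply/negP => Hi; apply: H; exists i.
    have -> : \sum_i (\sum_j a i j w * u x j) ^+ 2 = \sum_i apply_mx (entries a w) (u x) i ^+ 2.
      apply: eq_bigr => k _; congr (_ ^+ 2); apply: eq_bigr => j _.
      by rewrite entry_entries.
    apply: lt_le_trans (sqr_coord_le _ i).
    by rewrite -[ltRHS]real_normK ?num_real// ltrXn2r ?nnegrE ?(ltW c0).
- rewrite setCK law_entries//; apply: (le_trans (measureU2 _ mS1 mS2)).
  rewrite [e]splitr EFinD; apply: leeD; first exact: hrad.
  have u1 x : \sum_j u x j ^+ 2 = 1 by case: (Qu x).
  apply: le_trans (measure_exists_le mE (fun x => small_ball m (u1 x) c0)) _.
  rewrite lee_fin; apply: le_trans hC; apply: le_trans (net_small_ball M0 h0 h1 Nm).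
  by rewrite ler_wpM2r// exprn_ge0// !mulr_ge0// ltW.
Qed.

End unique_solution_event_tall.

(** * Numerical estimates for the final constants *)

Section failure_bound.
Context {R : realType}.

(** Since 0.96^16 > 1/2. It yields ln 4 >= 1.28 = (8/5)^2 / 2, hence b >= 8/5 whenever eps <= 1. *)
Lemma expR_64_le2 : expR (64 / 100) <= 2 :> R.
Proof.
have h : (1 - 4 / 100) ^+ 16 <= expR (- (64 / 100)) :> R.
  rewrite (_ : - (64 / 100) = - (4 / 100) * 16%:R); last by field.
  rewrite expRM_natr; apply: lerXn2r; rewrite ?nnegrE ?expR_ge0//; first by lra.
  exact: expR_ge1Dx.
have {}h : 2^-1 <= expR (- (64 / 100)) :> R by apply: le_trans h; lra.
by rewrite -[leRHS]invrK -[leLHS]invrK -expRN lef_pV2// posrE ?expR_gt0// invr_gt0.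
Qed.

Lemma sqrt_2ln_ge (eps : R) : 0 < eps -> eps <= 1 ->
  8 / 5 <= Num.sqrt (2 * ln (4 / eps)).
Proof.
move=> e0 e1.
have l4 : 128 / 100 <= ln (4 / eps).
  rewrite -[leLHS]expRK ler_ln ?posrE ?expR_gt0 ?divr_gt0//.
  apply: (@le_trans _ _ 4); last by rewrite ler_pdivlMr//; lra.
  rewrite (_ : 128 / 100 = 64 / 100 + 64 / 100); last by field.
  by rewrite expRD; have := expR_64_le2; have := expR_ge0 (64 / 100 : R); nra.
rewrite -[leLHS]ger0_norm; last by lra.
by rewrite -sqrtr_sqr ler_wsqrtr//; lra.
Qed.

(* The lower bound in Mills' ratio is the positivity of the second moment [mu1 (- b)]. *)
Lemma Phi_ge (b : R) : b * phi b <= (1 + b ^+ 2) * Phi (- b).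
Proof. by have := mu1_ge0 (- b); rewrite /mu1 phiN sqrrN; lra. Qed.

Lemma failure_constant (b : R) : 8 / 5 <= b ->
  Num.sqrt (pi *+ 2) * (1 + b ^+ 2) <= 37 / 10 * b * expR (b ^+ 2 / 4).
Proof.
move=> b1.
have s : Num.sqrt (pi *+ 2) <= 283 / 100 :> R.
  rewrite -[leRHS]ger0_norm; last by lra.
  by rewrite -sqrtr_sqr ler_wsqrtr//; rewrite -[pi *+ 2]mulr_natr; have := pihalf_lt2 R; lra.
have e : 1 + b ^+ 2 / 4 + b ^+ 4 / 64 <= expR (b ^+ 2 / 4).
  rewrite [b ^+ 2 / 4]splitr expRD -expr2.
  apply: (@le_trans _ _ ((1 + b ^+ 2 / 4 / 2) ^+ 2)); first by rewrite le_eqVlt; apply/orP; left; apply/eqP; field.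
  have y0 : 0 <= 1 + b ^+ 2 / 4 / 2 by rewrite addr_ge0// !divr_ge0// sqr_ge0.
  by apply: lerXn2r; rewrite ?nnegrE ?expR_ge0//; exact: expR_ge1Dx.
apply: (@le_trans _ _ (283 / 100 * (1 + b ^+ 2))).
  by rewrite ler_wpM2r// addr_ge0// sqr_ge0.
apply: (@le_trans _ _ (37 / 10 * b * (1 + b ^+ 2 / 4 + b ^+ 4 / 64))); last first.
  by rewrite ler_wpM2l//; lra.
(* Expanded around b = 8/5, the polynomial inequality becomes linear in the nonnegative powers of
   t. *)
pose t := b - 8 / 5; have t0 : 0 <= t by rewrite subr_ge0.
have -> : b = 8 / 5 + t by rewrite subrKC.
have t2 : 0 <= t ^+ 2 by exact: sqr_ge0.
have t3 : 0 <= t ^+ 3 by exact: exprn_ge0.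
have t4 : 0 <= t ^+ 4 by exact: exprn_ge0.
have t5 : 0 <= t ^+ 5 by exact: exprn_ge0.
lra.
Qed.

(** In terms of p = exp (- b^2 / 4), eps is 4 p^2 and the exponential is at most p^5 exp (1/25), so
    the claim reduces to p^3 <= 37/10 Phi (- b). Mills' lower bound makes Phi (- b) at least p^2 b /
    (sqrt (2 pi) (1 + b^2)), and [failure_constant] concludes. *)
Lemma failure_le (eps b x : R) : 8 / 5 <= b -> eps = 4 * expR (- (b ^+ 2 / 2)) ->
  x <= - (5 / 4 * b ^+ 2) + 1 / 25 ->
  0 < Phi (- b) /\ expR x / Phi (- b) <= 37 / 40 * eps * expR (1 / 25).
Proof.
move=> b1 epsE xle.
have q0 : 0 < 1 + b ^+ 2 by rewrite ltr_wpDr ?sqr_ge0.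
have P0 : 0 < Phi (- b).
  rewrite -(pmulr_rgt0 _ q0); apply: lt_le_trans (Phi_ge b).
  by rewrite mulr_gt0 ?phi_gt0//; lra.
split=> //; rewrite ler_pdivrMr//.
pose p := expR (- (b ^+ 2 / 4)); have p0 : 0 < p by exact: expR_gt0.
have p2 : expR (- (b ^+ 2 / 2)) = p ^+ 2.
  by rewrite /p -expRM_natr; congr expR; field.
have p5 : expR (- (5 / 4 * b ^+ 2)) = p ^+ 5.
  by rewrite /p -expRM_natr; congr expR; field.
apply: (@le_trans _ _ (p ^+ 5 * expR (1 / 25))); first by rewrite -p5 -expRD ler_expR.
suff : p ^+ 5 <= 37 / 40 * eps * Phi (- b).
  move=> h; rewrite -(mulrA _ (expR _)) (mulrC (expR _) (Phi _)) mulrA.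
  by apply: ler_wpM2r; [exact: expR_ge0|exact: h].
rewrite epsE p2.
have s0 : 0 < Num.sqrt (pi *+ 2) :> R by rewrite sqrtr_gt0 pmulrn_lgt0// pi_gt0.
have fc : Num.sqrt (pi *+ 2) * (1 + b ^+ 2) * p <= 37 / 10 * b.
  have := failure_constant b1; rewrite -(@ler_pM2r _ p)// => h; apply: le_trans h _.
  have E : expR (b ^+ 2 / 4) * p = 1 by rewrite /p -expRD subrr expR0.
  by rewrite -(mulrA _ (expR _) p) E mulr1.
have Pg := Phi_ge b.
have phE : phi b = (Num.sqrt (pi *+ 2))^-1 * p ^+ 2.
  by rewrite /phi mulNr p2.
rewrite phE in Pg; move: (Num.sqrt _) s0 fc Pg => s s0 fc Pg.
have h : p ^+ 3 <= 37 / 10 * Phi (- b).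
  rewrite -(ler_pM2l q0).
  apply: (@le_trans _ _ (37 / 10 * b * (s^-1 * p ^+ 2))); last by lra.
  have -> : (1 + b ^+ 2) * p ^+ 3 = s * (1 + b ^+ 2) * p * (s^-1 * p ^+ 2).
    by field; rewrite gt_eqF.
  by rewrite ler_wpM2r// mulr_ge0 ?sqr_ge0// invr_ge0 ltW.
rewrite (_ : p ^+ 5 = p ^+ 2 * p ^+ 3); last by ring.
apply: le_trans (ler_wpM2l (sqr_ge0 p) h) _.
by rewrite le_eqVlt; apply/orP; left; apply/eqP; field.
Qed.

Lemma expR_small : 37 / 40 * expR (1 / 25) <= 193 / 200 :> R.
Proof.
have h := expR_ge1Dx (- (1 / 25) : R).
have h2 : expR (1 / 25) * expR (- (1 / 25)) = 1 :> R by rewrite -expRD subrr expR0.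
by have := expR_gt0 (1 / 25 : R); nra.
Qed.

End failure_bound.

Section Delta_bin_facts.
Context {R : realType} (N : nat) (K : {set 'I_N}).

Lemma Delta_bin_funE (tau : R) : Delta_bin_fun N #|K| tau = (mean_cone_dist2 K tau)%:E.
Proof.
have E := integral_sqr_ge (- tau); rewrite opprK in E.
by rewrite /Delta_bin_fun integral_sqr_le E -!EFinM -EFinD.
Qed.

Lemma Delta_bin_ge0 : (0 <= @Delta_bin R N #|K|)%E.
Proof.
by apply/ereal_infP => _ [tau _ <-]; rewrite Delta_bin_funE lee_fin mean_cone_dist2_ge0.
Qed.

Lemma Delta_bin_attained (D : R) : (Delta_bin N #|K| < D%:E)%E ->
  exists2 tau, 0 <= tau & mean_cone_dist2 K tau <= D.
Proof.
move=> /ereal_inf_lt[_ [tau tau0 <-]]; rewrite Delta_bin_funE lte_fin => /ltW.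
by exists tau.
Qed.

End Delta_bin_facts.

Theorem theorem2p7 (R : realType) (eps : R) (m N : nat) (K : {set 'I_N})
  (d : measure_display) (T : measurableType d) (P : probability T R)
  (a : 'I_m -> 'I_N -> {RV P >-> R}) :
  0 < eps ->
  (forall i j, std_normal_rv (a i j)) ->
  mutually_independent a ->
  ((m%:R)%:E >= Delta_bin N #|K| +
     (Num.sqrt (8 * ln (4 / eps) * N%:R))%:E)%E ->
  exists F : set T, measurable F /\
    F `<=` [set omega | Pbin_unique_solution (gauss_mx a omega)
                          (gauss_mx a omega *m ind_vec K) (ind_vec K)] /\
    ((1 - eps)%:E < P F)%E.
Proof.
move=> eps0 aG aI.
have [eps1|eps1] := ltP 1 eps.
  by exists set0; rewrite measure0 lte_fin subr_lt0; split=> //; split.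
have [N0|N0] := posnP N.
  exists setT; rewrite probability_setT lte_fin gtrBl; split=> //; split=> // w _.
  split; first by split => // j; have := ltn_ord j; rewrite {2}N0.
  by move=> x _ xK; exfalso; apply: xK; apply/matrixP => j; have := ltn_ord j; rewrite {2}N0.
have := @Delta_bin_ge0 R N K; have := @Delta_bin_attained R N K.
(* The infimum is a real number: + oo contradicts the hypothesis on m, and - oo its
   nonnegativity. *)
case: (Delta_bin N #|K|) => [Del| |] Del_inf Del0; [|by rewrite addye// leye_eq|by rewrite leeNy_eq in Del0].
rewrite lee_fin in Del0; rewrite -EFinD lee_fin => Delm.
have b1 := sqrt_2ln_ge eps0 eps1.
have L0 : 0 < 2 * ln (4 / eps) by rewrite -sqrtr_gt0; lra.
have epsE : eps = 4 * expR (- (Num.sqrt (2 * ln (4 / eps)) ^+ 2 / 2)).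
  rewrite sqr_sqrtr ?ltW// (mulrC 2) mulfK// expRN lnK ?posrE ?divr_gt0//.
  by field; rewrite gt_eqF.
have sE : Num.sqrt (8 * ln (4 / eps) * N%:R) = 2 * Num.sqrt (2 * ln (4 / eps)) * Num.sqrt N%:R.
  have -> : 8 * ln (4 / eps) * N%:R = 2 ^+ 2 * (2 * ln (4 / eps)) * N%:R by ring.
  rewrite sqrtrM; last by rewrite mulr_ge0 ?sqr_ge0// ltW.
  by rewrite sqrtrM ?sqr_ge0// sqrtr_sqr ger0_norm.
rewrite sE in Delm; move: (Num.sqrt (2 * _)) b1 epsE Delm {sE} => b b1 epsE Delm.
have N1 : 1 <= Num.sqrt N%:R :> R by rewrite -[leLHS]sqrtr1 ler_wsqrtr// ler1n.
have m0 : (0 < m)%N by rewrite -(ltr0n R); nra.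
(* The factor 99/100 turns non-strict bounds into the strict inequality required. *)
suff [F [mF Fsub PF]] : exists F : set T, [/\ measurable F,
    F `<=` [set omega | Pbin_unique_solution (gauss_mx a omega)
                          (gauss_mx a omega *m ind_vec K) (ind_vec K)] &
    (P (~` F) <= (99 / 100 * eps)%:E)%E].
  exists F; split=> //; split=> //.
  have -> : P F = (1 - P (~` F))%E by rewrite -[in LHS](setCK F) probability_setC//; exact: measurableC.
  apply: (@lt_le_trans _ _ (1 - (99 / 100 * eps)%:E)%E); last exact: leeB.
  by rewrite -EFinB lte_fin; lra.
have [Nm|mN] := ltnP N m.
  by apply: unique_solution_event_tall => //; lra.
(* Size of each of four slacks: the norming factor [kap], the radius eta, the margin del, and the
   excess of D over the infimum. Together they cost 4 b z = 1/25 in the exponent. *)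
pose z := 1 / (100 * b); have z0 : 0 < z by rewrite divr_gt0//; lra.
have bz : b * z = 1 / 100 by rewrite /z; field; rewrite gt_eqF//; lra.
pose rm := Num.sqrt m%:R : R; have rm0 : 0 < rm by rewrite sqrtr_gt0 ltr0n.
pose rD := Num.sqrt Del; have rD0 : 0 <= rD by exact: sqrtr_ge0.
have gap : b <= rm - rD.
  (* As rD <= rm <= sqrt N, the hypothesis gives (rm - rD) (rm + rD) >= 2 b sqrt N >= b (rm + rD).
     This is where m <= N enters. *)
  rewrite leNgt; apply/negP => h.
  have rmN : rm <= Num.sqrt N%:R by rewrite ler_wsqrtr// ler_nat.
  have e1 : rm ^+ 2 = m%:R by rewrite sqr_sqrtr.
  have e2 : rD ^+ 2 = Del by rewrite sqr_sqrtr.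
  rewrite -e1 -e2 in Delm.
  have bN : 0 <= 2 * b * Num.sqrt N%:R by rewrite !mulr_ge0//; lra.
  have rDm : rD <= rm by rewrite -(@ler_pXn2r _ 2)// ?nnegrE ?(ltW rm0)//; lra.
  have h1 : (rm - rD) * (rm + rD) < b * (rm + rD) by rewrite ltr_pM2r//; lra.
  have h2 : b * (rm + rD) <= b * (2 * Num.sqrt N%:R) by rewrite ler_wpM2l//; lra.
  have h3 : (rm - rD) * (rm + rD) = rm ^+ 2 - rD ^+ 2 by ring.
  by lra.
(* A strictly larger level is used because the infimum may not be reached; it also keeps D positive
   when the infimum is 0. *)
have [tau tau0 meanD] : exists2 tau, 0 <= tau & mean_cone_dist2 K tau <= (rD + z) ^+ 2.
  apply: Del_inf; rewrite lte_fin -[ltLHS]sqr_sqrtr// -/rD.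
  by rewrite ltrXn2r ?nnegrE ?addr_ge0 ?(ltW z0)// ltrDl.
(* The term z / rm limits the loss in kap * rm to z, and 1/2 keeps kap positive. *)
pose kap := 1 - Num.min (1 / 2) (z / rm).
have k0 : 0 < kap.
  by rewrite subr_gt0 gt_min; apply/orP; left; lra.
have k1 : kap < 1.
  by rewrite gtrBl lt_min divr_gt0// divr_gt0.
have krm : rm - z <= kap * rm.
  rewrite /kap; have : Num.min (1 / 2) (z / rm) * rm <= z.
    by rewrite -ler_pdivlMr// ge_min lexx orbT.
  lra.
have v0 : 0 < b by lra.
have Dp : 0 < (rD + z) ^+ 2 by rewrite exprn_gt0// ltr_wpDl.
have rDz : Num.sqrt ((rD + z) ^+ 2) = rD + z by rewrite sqrtr_sqr ger0_norm// addr_ge0// ltW.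
have e0 : 0 < eps / 100 by rewrite divr_gt0.
(* Here v = b: one b from [gap] and one from the conditioning bound the exponent by 3/4 b^2 - b (2 b
   - 4 z) = - 5/4 b^2 + 1/25. *)
have [|Pb fl] := failure_le (x := 3 / 4 * b ^+ 2 - b * (kap * rm + (b - z - z) - Num.sqrt ((rD + z) ^+ 2))) b1 epsE.
  rewrite rDz.
  have : b * (2 * b - 4 * z) <= b * (kap * rm + (b - z - z) - (rD + z)).
    by rewrite ler_wpM2l ?(ltW v0)//; lra.
  nra.
have [F [mF Fsub PF]] := unique_solution_event aG aI m0 tau0 v0 Dp meanD k0 k1 z0 z0 e0 Pb.
exists F; split=> //; apply: le_trans PF _; rewrite lee_fin.
apply: le_trans (lerD (lexx _) fl) _.
have := @expR_small R; nra.
Qed.
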